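(* Let $M,N\in\mathbb{N}$ and let $m_0,m_1,\dots,m_N$ be moment functions of positive orders $s_0,s_1,\dots,s_N$ respectively; put $m=(m_1,\dots,m_N)$ and $s=(s_1,\dots,s_N)$. Let $\Lambda\subset\mathbb{N}_0\times\mathbb{N}_0^N$, and for $(j,\alpha)\in\Lambda$ let $a_{j,\alpha}(t)$ be holomorphic in a neighborhood of the origin of $\mathbb{C}$. Consider the Cauchy problem $$\left\{\begin{aligned}\partial_{m_0,t}^{M}u(t,z)+\sum_{(j,\alpha)\in\Lambda}a_{j,\alpha}(t)\,\partial_{m_0,t}^{j}\partial_{m,z}^{\alpha}u(t,z)&=f(t,z)\\ \partial_{m_0,t}^{j}u(0,z)&=\varphi_j(z)\quad\text{for }0\le j<M,\end{aligned}\right.$$ where $t\in\mathbb{C}$, $z=(z_1,\dots,z_N)\in\mathbb{C}^N$. For $(j,\alpha)\in\Lambda$ put $q_{j,\alpha}=\mathrm{ord}_t(a_{j,\alpha})-j+M$, and define $1/k_1\in[0,\infty)$ by $$\frac1{k_1}=\max\left\{0,\ \max_{(j,\alpha)\in\Lambda}\frac{s_0(j-M)+s\cdot\alpha}{q_{j,\alpha}}\right\}.$$ Assume that: (i) there is $R_0>0$ such that $\varphi_j\in\mathcal{O}_{R_0}$ for $j=0,\dots,M-1$ and $f(t,z)\in\mathcal{O}_{R_0}[[t]]_{1/k_1}$; (ii) the set $\Lambda$ is finite; (iii) $a_{j,\alpha}(t)\in\mathbb{C}[[t]]_{1/k_1}$ for every $(j,\alpha)\in\Lambda$; (iv) $\mathrm{ord}_t(a_{j,\alpha})\ge\max\{0,\,j-M+1\}$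 for every $(j,\alpha)\in\Lambda$; (v) $m_0$ is a regular moment function (of order $s_0$). Let $\hat u(t,z)=\sum_{n=0}^{\infty}u_n(z)t^n$ be a formal solution of this Cauchy problem. Then $\hat u(t,z)$ is of Gevrey order $1/k_1$ with respect to $t$, i.e. there exists $\tilde R>0$ such that for any $0<r<\tilde R$ there exist constants $C,H>0$ satisfying $$\sup_{z\in D_r^N}|u_n(z)|\le CH^n\,n!^{1/k_1}\quad\text{for every }n\in\mathbb{N}_0.$$
   Context: Notation. $\mathbb{N}=\{1,2,\dots\}$, $\mathbb{N}_0=\mathbb{N}\cup\{0\}$. $D_r^N=\{z\in\mathbb{C}^N:|z_j|<r,\ j=1,\dots,N\}$, $D_r=D_r^1$. $\mathcal{O}(G)$ is the set of holomorphic functions on $G$, and $\mathcal{O}(G,\mathbb{E})$ the set of holomorphic functions on $G$ with values in a complex Banach space $\mathbb{E}$. $\mathcal{O}_r=\mathcal{O}(D_r^N)\cap C(\overline{D_r^N})$ with the sup norm over $D_r^N$. $\mathbb{E}[[t]]$ is the space of formal power series in $t$ with coefficients in $\mathbb{E}$. $s\cdot\alpha=s_1\alpha_1+\dots+s_N\alpha_N$. $\mathrm{ord}_t(a)$ is the order of the zero of $a(t)$ at $t=0$ (identically zero coefficients do not contribute to the maximum defining $1/k_1$). Moment functions. For $d\in\mathbb{R}$, $\epsilon>0$ let $S_d(\epsilon)=\{z\in\mathbb{C}:|z|>0,\ d-\epsilon/2<\arg z<d+\epsilon/2\}$. A pair $e_m,E_m$ is a pair of kernel functions of order $k>1/2$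 if: (1) $e_m\in\mathcal{O}(S_0(\pi/k))$, $e_m(z)/z$ is integrable at the origin, $e_m(x)\in\mathbb{R}_+$ for $x\in\mathbb{R}_+$, and for every $\varepsilon>0$ there are $A,B>0$ with $|e_m(z)|\le Ae^{-(|z|/B)^k}$ for $z\in S_0(\pi/k-\varepsilon)$; (2) $E_m\in\mathcal{O}(\mathbb{C})$, there are $A,B>0$ with $|E_m(z)|\le Ae^{B|z|^k}$ for $z\in\mathbb{C}$, and $E_m(1/z)/z$ is integrable at the origin in $S_\pi(2\pi-\pi/k)$; (3) with the corresponding moment function $m$ of order $1/k$, $m(u):=\int_0^\infty x^{u-1}e_m(x)\,dx$ for $\mathrm{Re}\,u\ge0$, one has $E_m(z)=\sum_{n\ge0}z^n/m(n)$ for $z\in\mathbb{C}$; (4) $m(0)=1$. For arbitrary $k>0$, $e_m$ is a kernel function of order $k$ if there are $n\in\mathbb{N}$ with $nk>1/2$ and kernel functions $e_{\tilde m},E_{\tilde m}$ of order $nk$ with $e_m(z)=e_{\tilde m}(z^{1/n})/n$; then $m$ (the moment function of order $1/k$) and $E_m$ are defined by the same formulas. A moment function of order $0$ is a quotient $m_1/m_2$ of two moment functions of the same order. A moment function $m$ of order $s>0$ is called regular if there are $a,A>0$ with $an^s\le m(n)/m(n-1)\le An^s$ for all $n\in\mathbb{N}$. Moment derivatives. For a moment function $m$, $\partial_{m,t}\left(\sum_{n\ge0}\frac{u_n}{m(n)}t^n\right)=\sum_{n\ge0}\frac{u_{n+1}}{m(n)}t^n$; the same formula is used in each variable $z_i$,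 and $\partial_{m,z}^\alpha=\partial_{m_1,z_1}^{\alpha_1}\cdots\partial_{m_N,z_N}^{\alpha_N}$. Gevrey series. For $\sigma\ge0$, $\mathbb{E}[[t]]_\sigma$ is the set of $\hat u=\sum u_nt^n\in\mathbb{E}[[t]]$ such that $\sum\frac{u_n}{m(n)}t^n\in\mathcal{O}(D_r,\mathbb{E})$ for some $r>0$, where $m$ is a moment function of order $\sigma$; equivalently (independently of the choice of $m$) there are $B,C>0$ with $\|u_n\|_{\mathbb{E}}\le BC^n\Gamma(1+\sigma n)$ for all $n\in\mathbb{N}_0$. A formal solution is a formal power series in $t$, with coefficients that are power series in $z$, satisfying the equation and the initial conditions as identities of formal power series. *)

(* Defs.v *)
From mathcomp Require Import all_boot all_order all_algebra finmap.
From mathcomp Require Import all_classical all_reals all_analysis.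
From mathcomp.real_closed Require Import complex.

Set Implicit Arguments.
Unset Strict Implicit.
Unset Printing Implicit Defensive.

Import Order.TTheory GRing.Theory Num.Theory numFieldNormedType.Exports.

Local Open Scope classical_set_scope.
Local Open Scope ring_scope.

(* The numClosedFieldType alias of R[i] is what makes the
   topological and normed structures over the complex field (hence complex
   differentiability) available to unification. *)
Definition Cplx (R : realType) : numClosedFieldType := R[i].

Definition cmod (R : realType) (z : Cplx R) : R := ComplexField.Normc.normc z.

Definition ofR (R : realType) (x : R) : Cplx R := real_complex R x.

Definition polar (R : realType) (rho theta : R) : Cplx R :=
  Complex (rho * cos theta) (rho * sin theta).

Definition sector (R : realType) (d eps : R) : set (Cplx R) :=
  [set z | exists rho theta : R,
     [/\ 0 < rho, d - eps / 2 < theta < d + eps / 2 & z = polar rho theta]].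

(* Integrability at the origin in a sector, in Balser's sense: absolute
   integrability on ]0, x0] along every ray of the sector. *)
Definition integrable_at_origin (R : realType) (d eps : R)
    (g : Cplx R -> Cplx R) : Prop :=
  forall x0 theta : R, 0 < x0 -> d - eps / 2 < theta < d + eps / 2 ->
    (@lebesgue_measure R).-integrable `]0, x0]
      (fun x : R => (cmod (g (polar x theta)))%:E).

(* x ^ w for real x > 0 and complex w. *)
Definition cpow (R : realType) (x : R) (w : Cplx R) : Cplx R :=
  polar (x `^ complex.Re w) (complex.Im w * ln x).

(* The integral over ]0, +oo[ of x ^ (u - 1) * e(x), computed componentwise. *)
Definition mellin (R : realType) (e : R -> Cplx R) (u : Cplx R) : Cplx R :=
  Complex
    (\int[@lebesgue_measure R]_(x in `]0, +oo[)
       complex.Re (cpow x (u - 1) * e x))%R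
    (\int[@lebesgue_measure R]_(x in `]0, +oo[)
       complex.Im (cpow x (u - 1) * e x))%R.

(* In kernel_pos the order is that of R[i]: the value is real and positive. *)
Record kernel_pair (R : realType) (k : R) (e E m : Cplx R -> Cplx R) : Prop := {
  kernel_order : 2^-1 < k;
  kernel_holo : forall z, sector 0 (pi / k) z -> derivable e z 1;
  kernel_int : integrable_at_origin 0 (pi / k) (fun z => e z / z);
  kernel_pos : forall x : R, 0 < x -> 0 < e (ofR x);
  kernel_decay : forall eps : R, 0 < eps ->
    exists A B : R, [/\ 0 < A, 0 < B &
      forall z, sector 0 (pi / k - eps) z ->
        cmod (e z) <= A * expR (- (cmod z / B) `^ k)];
  cokernel_holo : forall z, derivable E z 1;
  cokernel_growth : exists A B : R, [/\ 0 < A, 0 < B &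
      forall z, cmod (E z) <= A * expR (B * cmod z `^ k)];
  cokernel_int :
    integrable_at_origin pi (2 * pi - pi / k) (fun z => E z^-1 / z);
  kernel_moment : forall u, 0 <= complex.Re u ->
    m u = mellin (fun x => e (ofR x)) u;
  cokernel_series : forall z,
    series (fun n : nat => z ^+ n / m n%:R) @ \oo --> E z;
  kernel_normalized : m 0 = 1
}.

(* m is a moment function of order s > 0, i.e. attached to kernel functions of
   order k = 1 / s; n = 1 is the case k > 1/2. The branch of z ^ (1 / n) is
   immaterial, since only positive z enter the moment integral. *)
Definition moment_function (R : realType) (s : R) (m : Cplx R -> Cplx R) : Prop :=
  exists (n : nat) (e E m' : Cplx R -> Cplx R),
    [/\ (0 < n)%N, kernel_pair (n%:R * s^-1) e E m' &
      forall u, 0 <= complex.Re u ->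
        m u = mellin (fun x => e (ofR (x `^ (n%:R^-1))) / n%:R) u].

(* The order is that of R[i], so the quotients are in particular real. *)
Definition regular_moment (R : realType) (s : R) (m : Cplx R -> Cplx R) : Prop :=
  exists a A : R, [/\ 0 < a, 0 < A & forall n : nat, (0 < n)%N ->
    ofR (a * n%:R `^ s) <= m n%:R / m n.-1%:R <= ofR (A * n%:R `^ s)].

Definition Gamma (R : realType) (x : R) : R :=
  (\int[@lebesgue_measure R]_(t in `]0, +oo[) (t `^ (x - 1) * expR (- t)))%R.

(* [nrm n] is the norm of the n-th coefficient of a formal power series in t;
   it is extended-real valued so that a supremum norm can be plugged in. *)
Definition gevrey (R : realType) (sigma : R) (nrm : nat -> \bar R) : Prop :=
  exists B H : R, [/\ 0 < B, 0 < H & forall n : nat,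
    (nrm n <= (B * H ^+ n * Gamma (1 + sigma * n%:R))%:E)%E].

Definition midx (N : nat) := {ffun 'I_N -> nat}.

(* C[[z_1, ..., z_N]] and C[[z_1, ..., z_N]][[t]], by their coefficients. *)
Definition zseries (R : realType) (N : nat) := midx N -> Cplx R.
Definition tzseries (R : realType) (N : nat) := nat -> zseries R N.

Definition zmonom (R : realType) (N : nat) (z : 'rV[Cplx R]_N) (b : midx N) :
  Cplx R := \prod_(i < N) z ord0 i ^+ b i.

(* Unconditional (equivalently, absolute) convergence at z, with sum l. *)
Definition zseries_sum (R : realType) (N : nat) (c : zseries R N)
    (z : 'rV[Cplx R]_N) (l : Cplx R) : Prop :=
  forall eps : R, 0 < eps -> exists A0 : {fset midx N},
    forall A : {fset midx N}, (A0 `<=` A)%fset ->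
      cmod (\sum_(b <- A) c b * zmonom z b - l) < eps.

Definition polydisc (R : realType) (N : nat) (r : R) : set 'rV[Cplx R]_N :=
  [set z | forall i : 'I_N, cmod (z ord0 i) < r].

Definition sup_norm (R : realType) (N : nat) (r : R)
    (g : 'rV[Cplx R]_N -> Cplx R) : \bar R :=
  ereal_sup [set (cmod (g z))%:E | z in polydisc r].

Definition in_O (R : realType) (N : nat) (r : R)
    (g : 'rV[Cplx R]_N -> Cplx R) : Prop :=
  (forall z, polydisc r z -> differentiable g z) /\
  {within closure (polydisc r), continuous g}.

Definition expansion (R : realType) (N : nat) (g : 'rV[Cplx R]_N -> Cplx R)
    (c : zseries R N) : Prop :=
  \forall z \near (0 : 'rV[Cplx R]_N), zseries_sum c z (g z).

(* A function holomorphic near 0 is represented by its expansion c at 0. *)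
Definition holomorphic_germ (R : realType) (c : nat -> Cplx R) : Prop :=
  exists g : Cplx R -> Cplx R,
    \forall t \near (0 : Cplx R), derivable g t 1 /\
      (series (fun n : nat => c n * t ^+ n) @ \oo --> g t).

Definition nonzero_series (R : realType) (c : nat -> Cplx R) : Prop :=
  exists n : nat, c n != 0.

(* The order at t = 0 of a nonzero series. The order of the zero series is
   +oo, which is not encoded: the value 0 given here is never used. *)
Definition ord_t (R : realType) (c : nat -> Cplx R) : nat :=
  match pselect (exists n : nat, c n != 0) with
  | left h => ex_minn h
  | right _ => 0%N
  end.

(* On coefficients, u_(n+1) / m(n) t^n replaces u_n / m(n) t^n. *)
Definition mdiff_t (R : realType) (N : nat) (m : Cplx R -> Cplx R)
    (u : tzseries R N) : tzseries R N :=
  fun n b => m n.+1%:R / m n%:R * u n.+1 b.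

Definition mdiff_z1 (R : realType) (N : nat) (m : Cplx R -> Cplx R) (i : 'I_N)
    (u : tzseries R N) : tzseries R N :=
  fun n b => m (b i).+1%:R / m (b i)%:R *
             u n [ffun l => (b l + (l == i))%N].

Definition mdiff_z (R : realType) (N : nat) (m : 'I_N -> Cplx R -> Cplx R)
    (alpha : midx N) (u : tzseries R N) : tzseries R N :=
  foldr (fun i v => iter (alpha i) (mdiff_z1 (m i) i) v) u (enum 'I_N).

Definition mul_t (R : realType) (N : nat) (a : nat -> Cplx R)
    (u : tzseries R N) : tzseries R N :=
  fun n b => \sum_(l < n.+1) a l * u (n - l)%N b.

Section CauchyProblem.
Variables (R : realType) (M N : nat).
Variables (m0 : Cplx R -> Cplx R) (m : 'I_N -> Cplx R -> Cplx R).
Variables (s0 : R) (s : 'I_N -> R).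
Variables (Lambda : set (nat * midx N)) (a : nat -> midx N -> nat -> Cplx R).

Definition q_exp (j : nat) (alpha : midx N) : int :=
  (ord_t (a j alpha))%:Z - j%:Z + M%:Z.

Definition slope (j : nat) (alpha : midx N) : R :=
  (s0 * (j%:R - M%:R) + \sum_(i < N) s i * (alpha i)%:R) /
  (q_exp j alpha)%:~R.

(* 1 / k_1; the maximum ranges over the nonzero coefficients only. *)
Definition inv_k1 : R :=
  \big[Num.max/0]_(p \in [set p | Lambda p /\ nonzero_series (a p.1 p.2)])
    slope p.1 p.2.

Definition formal_solution (phi : nat -> zseries R N) (f u : tzseries R N) :
    Prop :=
  (forall n b,
     iter M (mdiff_t m0) u n b +
       \sum_(p \in Lambda)
         mul_t (a p.1 p.2) (iter p.1 (mdiff_t m0) (mdiff_z m p.2 u)) n b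
     = f n b) /\
  (forall j, (j < M)%N -> forall b, iter j (mdiff_t m0) u 0%N b = phi j b).

End CauchyProblem.

(* Main.v *)
Require Import Defs.
From mathcomp Require Import all_boot all_order all_algebra finmap.
From mathcomp Require Import all_classical all_reals all_analysis.
From mathcomp Require Import measurable_realfun.
From mathcomp.real_closed Require Import complex.
From mathcomp Require Import ring lra zify.

Import Order.TTheory GRing.Theory Num.Theory numFieldNormedType.Exports.

Local Open Scope classical_set_scope.
Local Open Scope ring_scope.

Set Implicit Arguments.
Unset Strict Implicit.

(** Write the coefficients of the solution as u_(n,b) = v_(n,b) / (m0(n) m(b)),
    where m(b) is the product of the m_i(b_i). The moment derivatives are shifts
    of v, and the equation becomes a recursion
      v_(n+M,b) = f'_(n,b)
                  - sum over (j,alpha) and l of a_l (m0(n) / m0(n-l)) v_(n-l+j,b+alpha),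
    where a_l, the l-th coefficient of a_(j,alpha), vanishes for l < ord(a). As
    ord(a) > j - M, only indices below n + M occur on the right.

    Let sigma = 1/k1 and X = 1 + (s0 + sigma) n + s . b. The claim is that
    |v_(n,b)| <= C H^n K^|b| X^X for suitable C, H, K, proved by induction on n for
    all b simultaneously (growth_induction). Going from (n+M,b) to (n-l+j,b+alpha)
    lowers X by (s0 + sigma) (M-j+l) - s . alpha. The definition of 1/k1 as a
    maximum of slopes is the statement that this is at least
    s0 l + sigma (l - ord(a)) (growth_shift). The resulting gain, a power of X with
    this exponent, pays for m0(n) / m0(n-l), of size n^(s0 l) because m0 is regular,
    and for the Gevrey growth l^(sigma l) of the coefficients; what is left is
    geometric in l and carries a factor 1 / H (term_bound). Once H is large the
    induction closes.

    Two analytic facts connect this with the hypotheses. A moment function of order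
    s lies between geometric multiples of n^(s n) (moment_function_bounds): from
    above by the exponential decay of its kernel, from below because 1 / m(n) is a
    positive Taylor coefficient of an entire function of controlled growth. And the
    coefficients of the forcing term obey Cauchy's estimates on a fixed polydisc
    (cauchy_polydisc). The latter are derived from complex differentiability
    alone: Goursat's bisection argument in logarithmic polar coordinates shows that
    circle means are constant, which bounds the constant coefficient, and division
    by the variable gives the others up to a geometric factor.

    Finally X^X is at most n^(s0 n) n!^sigma times the product of the b_i^(s_i b_i),
    up to geometric factors (growth_le). Dividing by m0(n) m(b) leaves
    |u_(n,b)| <= C H^n n!^sigma K^|b|, and the sum over b of these bounds converges
    on every polydisc of radius less than 1 / (4 K). *)

(** * Goursat's theorem on rectangles, in real form *)

Section SegmentIntegral.
Variable R : realType.
Notation mu := (@lebesgue_measure R).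
Implicit Types (f g : R -> R) (a b c : R).

Definition continuous_on f a b := forall x, a <= x <= b -> {for x, continuous f}.

Lemma continuous_on_integrable f a b :
  continuous_on f a b -> mu.-integrable `[a, b] (EFin \o f).
Proof.
move=> cf; apply: continuous_compact_integrable; first exact: segment_compact.
by apply: continuous_in_subspaceT => x; rewrite inE /= in_itv /= => /cf.
Qed.

Lemma continuous_onS f a b a' b' :
  a <= a' -> b' <= b -> continuous_on f a b -> continuous_on f a' b'.
Proof.
move=> aa bb cf x /andP[h1 h2]; apply: cf.
by rewrite (le_trans aa h1) (le_trans h2 bb).
Qed.

Lemma segment_integral_split f a b c : a <= c -> c <= b -> continuous_on f a b ->
  \int[mu]_(x in `[a, b]) f x =
  \int[mu]_(x in `[a, c]) f x + \int[mu]_(x in `[c, b]) f x.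
Proof.
move=> ac cb cf.
have fi := continuous_on_integrable cf.
have := Rintegral_itvB (x := c) fi.
rewrite !bnd_simp => /(_ ac cb) /eqP; rewrite subr_eq => /eqP ->.
rewrite addrC Rintegral_itv_obnd_cbnd //.
have: mu.-integrable `[c, b] (EFin \o f).
  exact/continuous_on_integrable/(continuous_onS ac (lexx b)).
by apply: integrableS => //; apply: subset_itvr; rewrite bnd_simp.
Qed.

(** In Goursat's argument every integrand is close to a constant on a small
    rectangle. *)
Lemma segment_integral_near_cst f a b (K eta : R) : a <= b ->
  continuous_on f a b -> (forall x, a <= x <= b -> `|f x - K| <= eta) ->
  `|\int[mu]_(x in `[a, b]) f x - K * (b - a)| <= eta * (b - a).
Proof.
move=> ab cf H.
have fi := continuous_on_integrable cf.
have ci (k : R) : mu.-integrable `[a, b] (EFin \o (fun=> k)).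
  by apply: (@continuous_on_integrable (fun=> k)) => x _; exact: cst_continuous.
have E (k : R) : \int[mu]_(x in `[a, b]) k = k * (b - a).
  rewrite Rintegral_cst //= lebesgue_measure_itv /= lte_fin.
  move: ab; rewrite le_eqVlt => /predU1P[->|ab]; first by rewrite ltxx subrr.
  by rewrite ab.
rewrite -(E K) -RintegralB //.
have gi : mu.-integrable `[a, b] (EFin \o (fun x => f x - K)).
  by apply: continuous_on_integrable => x xab; exact: cvgB (cf x xab) (cvg_cst K).
apply: (le_trans (le_normr_Rintegral _ gi)) => //.
rewrite -(E eta); apply: le_Rintegral => //.
apply: (continuous_on_integrable (f := fun x => `|f x - K|)) => x xab.
by apply: cvg_norm; exact: (cvgB (cf x xab) (cvg_cst K)).
Qed.

End SegmentIntegral.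

Section Goursat.
Variable R : realType.
Notation mu := (@lebesgue_measure R).
Implicit Types (P Q : R -> R -> R).

(** Total differentiability of a real function of two real variables, with
    partial derivatives p and q. *)
Definition has_differential P (x y p q : R) := forall e : R, 0 < e ->
  exists2 d : R, 0 < d & forall x' y', `|x' - x| < d -> `|y' - y| < d ->
    `|P x' y' - P x y - (p * (x' - x) + q * (y' - y))|
      <= e * (`|x' - x| + `|y' - y|).

Lemma has_differential_continuous P x y p q : has_differential P x y p q ->
  {for x, continuous (fun x' => P x' y)} /\ {for y, continuous (P x)}.
Proof.
move=> /(_ 1 ltr01) [d d0 H].
have aux (k : R) : 0 <= k -> forall e : R, 0 < e ->
    exists2 d', 0 < d' & d' <= d /\ (k + 1) * d' < e.
  move=> k0 e e0; exists (Num.min d (e / (2 * (k + 1)))).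
    by rewrite lt_min d0 divr_gt0 // mulr_gt0 //; lra.
  rewrite ge_min lexx; split => //.
  apply: (@le_lt_trans _ _ (e / 2)); last lra.
  apply: (@le_trans _ _ ((k+1) * (e / (2 * (k + 1))))).
    by rewrite ler_pM2l; [rewrite ge_min lexx orbT|lra].
  by rewrite le_eqVlt; apply/orP; left; apply/eqP; field; lra.
split; apply/cvgrPdist_lt => e e0.
- have [d' d'0 [d'd d'e]] := aux `|p| (normr_ge0 p) e e0.
  exists d' => //= x'; rewrite /ball_ /= distrC => hx.
  have := H x' y (lt_le_trans hx d'd); rewrite subrr normr0 => /(_ d0).
  rewrite mulr0 !addr0 mul1r => {}H.
  rewrite distrC.
  have -> : P x' y - P x y = (P x' y - P x y - p * (x' - x)) + p * (x' - x).
    by rewrite subrK.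
  apply: (le_lt_trans (ler_normD _ _)).
  rewrite normrM; apply: (@le_lt_trans _ _ ((`|p| + 1) * `|x' - x|)); first lra.
  apply: le_lt_trans d'e; apply: ler_wpM2l; first by rewrite addr_ge0.
  exact: ltW.
- have [d' d'0 [d'd d'e]] := aux `|q| (normr_ge0 q) e e0.
  exists d' => //= y'; rewrite /ball_ /= distrC => hx.
  have := H x y'; rewrite subrr normr0 => /(_ d0 (lt_le_trans hx d'd)).
  rewrite mulr0 !add0r mul1r => {}H.
  rewrite distrC.
  have -> : P x y' - P x y = (P x y' - P x y - q * (y' - y)) + q * (y' - y).
    by rewrite subrK.
  apply: (le_lt_trans (ler_normD _ _)).
  rewrite normrM; apply: (@le_lt_trans _ _ ((`|q| + 1) * `|y' - y|)); first lra.
  apply: le_lt_trans d'e; apply: ler_wpM2l; first by rewrite addr_ge0.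
  exact: ltW.
Qed.

(** Integral of the form P dx + Q dy along the boundary of the rectangle with
    opposite corners (a, c) and (b, d). *)
Definition circulation P Q (a b c d : R) : R :=
  (\int[mu]_(x in `[a, b]) P x c - \int[mu]_(x in `[a, b]) P x d) +
  (\int[mu]_(y in `[c, d]) Q b y - \int[mu]_(y in `[c, d]) Q a y).

(** The shared p is the condition dP/dy = dQ/dx, at a single point: the real
    and imaginary parts of a complex differentiable function provide nothing
    stronger. *)
Definition closed_form_at P Q x y := exists p1 p q2,
  has_differential P x y p1 p /\ has_differential Q x y p q2.

Definition closed_form_on P Q a b c d := forall x y,
  a <= x <= b -> c <= y <= d -> closed_form_at P Q x y.

Lemma closed_form_continuous P Q a b c d : closed_form_on P Q a b c d ->
  (forall y, c <= y <= d -> continuous_on (P ^~ y) a b) /\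
  (forall x, a <= x <= b -> continuous_on (Q x) c d).
Proof.
move=> H; split=> [y hy x hx|x hx y hy];
  have [p1 [p [q2 [/has_differential_continuous[h1 h2]
    /has_differential_continuous [h3 h4]]]]] := H _ _ hx hy; by [].
Qed.

Lemma circulation_quarter P Q a m b c n d :
  a <= m -> m <= b -> c <= n -> n <= d -> closed_form_on P Q a b c d ->
  circulation P Q a b c d =
  circulation P Q a m c n + circulation P Q m b c n +
  (circulation P Q a m n d + circulation P Q m b n d).
Proof.
move=> am mb cn nd H.
have [cP cQ] := closed_form_continuous H.
have ab := le_trans am mb; have cd := le_trans cn nd.
rewrite /circulation.
rewrite !(segment_integral_split (f := P^~ c) am mb);
  last by apply: cP; rewrite lexx cd.
rewrite !(segment_integral_split (f := P^~ d) am mb);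
  last by apply: cP; rewrite lexx cd.
rewrite !(segment_integral_split (f := Q b) cn nd);
  last by apply: cQ; rewrite lexx ab.
rewrite !(segment_integral_split (f := Q a) cn nd);
  last by apply: cQ; rewrite lexx ab.
ring.
Qed.

(** Replacing P and Q by their affine approximations at (x, y), the mixed
    derivative p contributes p (c - d) (b - a) and p (b - a) (d - c), which
    cancel; the remainders contribute at most e times the square of the size. *)
Lemma circulation_small P Q (x y p1 p q2 e : R) :
  0 < e -> has_differential P x y p1 p -> has_differential Q x y p q2 ->
  exists2 r : R, 0 < r & forall a b c d,
    a <= x <= b -> c <= y <= d -> (b - a) + (d - c) < r ->
    closed_form_on P Q a b c d ->
    `|circulation P Q a b c d| <= e * ((b - a) + (d - c)) ^+ 2.
Proof.
move=> e0 hP hQ.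
have e20 : 0 < e / 2 by lra.
have [r1 r10 H1] := hP _ e20; have [r2 r20 H2] := hQ _ e20.
exists (Num.min r1 r2); first by rewrite lt_min r10.
move=> a b c d /andP[ax xb] /andP[cy yd]; rewrite lt_min => /andP[s1 s2] H.
have [cP cQ] := closed_form_continuous H.
have ab := le_trans ax xb; have cd := le_trans cy yd.
set s := (b - a) + (d - c) in s1 s2 *.
have s0 : 0 <= s by rewrite /s; lra.
have small z w : a <= z <= b -> c <= w <= d -> `|z - x| + `|w - y| <= s.
  move=> /andP[az zb] /andP[cw wd].
  have h1 : `|z - x| <= b - a by rewrite ler_norml; apply/andP; split; lra.
  have h2 : `|w - y| <= d - c by rewrite ler_norml; apply/andP; split; lra.
  by rewrite /s; lra.
have near z w : a <= z <= b -> c <= w <= d ->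
   `|P z w - P x y - (p1 * (z - x) + p * (w - y))| <= e / 2 * s /\
   `|Q z w - Q x y - (p * (z - x) + q2 * (w - y))| <= e / 2 * s.
  move=> hz hw; have hs := small z w hz hw.
  have n1 := normr_ge0 (z - x); have n2 := normr_ge0 (w - y).
  split.
    apply: (le_trans (H1 z w _ _)); [lra|lra|].
    by apply: ler_wpM2l => //; lra.
  apply: (le_trans (H2 z w _ _)); [lra|lra|].
  by apply: ler_wpM2l => //; lra.
have cc : c <= c <= d by rewrite lexx.
have dd : c <= d <= d by rewrite lexx andbT.
have aa : a <= a <= b by rewrite lexx.
have bb : a <= b <= b by rewrite lexx andbT.
rewrite /circulation -RintegralB //; [|exact/continuous_on_integrable/cP..].
rewrite -RintegralB //; [|exact/continuous_on_integrable/cQ..].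
have I1 : `|\int[mu]_(z in `[a, b]) (P z c - P z d) - p * (c - d) * (b - a)|
   <= e * s * (b - a).
  apply: segment_integral_near_cst => //.
    by move=> z hz; apply: cvgB; apply: (cP _ _ _ hz).
  move=> z hz; have [h1 _] := near z c hz cc; have [h2 _] := near z d hz dd.
  rewrite (_ : _ - _ = (P z c - P x y - (p1 * (z - x) + p * (c - y))) -
    (P z d - P x y - (p1 * (z - x) + p * (d - y)))); last by ring.
  by apply: (le_trans (ler_normB _ _)); lra.
have I2 : `|\int[mu]_(w in `[c, d]) (Q b w - Q a w) - p * (b - a) * (d - c)|
   <= e * s * (d - c).
  apply: segment_integral_near_cst => //.
    by move=> z hz; apply: cvgB; apply: (cQ _ _ _ hz).
  move=> w hw; have [_ h1] := near b w bb hw; have [_ h2] := near a w aa hw.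
  rewrite (_ : _ - _ = (Q b w - Q x y - (p * (b - x) + q2 * (w - y))) -
    (Q a w - Q x y - (p * (a - x) + q2 * (w - y)))); last by ring.
  by apply: (le_trans (ler_normB _ _)); lra.
set A := Rintegral _ _ _ in I1 *; set B := Rintegral _ _ _ in I2 *.
rewrite (_ : A + B = (A - p * (c - d) * (b - a)) + (B - p * (b - a) * (d - c)));
  last by ring.
apply: (le_trans (ler_normD _ _)).
rewrite (_ : e * s ^+ 2 = e * s * (b - a) + e * s * (d - c)); last first.
  by rewrite -mulrDr -/s expr2 mulrA.
lra.
Qed.

(** Bisection. If the circulation were eta > 0 in modulus, one of the four
    quarters would carry at least eta / 4, and so on; the nested rectangles
    shrink to a point, near which the circulation is o(size^2). *)
Lemma goursat P Q (a b c d : R) : a <= b -> c <= d ->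
  closed_form_on P Q a b c d -> circulation P Q a b c d = 0.
Proof.
move=> ab cd H; apply/eqP/negP => /negP J0.
set eta := `|circulation P Q a b c d|.
have eta0 : 0 < eta by rewrite normr_gt0.
pose L1 := b - a; pose L2 := d - c; pose h (n : nat) : R := 2^-1 ^+ n.
have h0 n : 0 < h n by rewrite exprn_gt0 // invr_gt0.
have hS n : h n = h n.+1 + h n.+1 by rewrite /h exprS; lra.
have L10 : 0 <= L1 by rewrite subr_ge0.
have L20 : 0 <= L2 by rewrite subr_ge0.
(* the invariant of the bisection, for the rectangle with lower corner z *)
pose bad n (z : R * R) := [/\ a <= z.1, z.1 + L1 * h n <= b, c <= z.2,
   z.2 + L2 * h n <= d & eta * h n ^+ 2 <=
   `|circulation P Q z.1 (z.1 + L1 * h n) z.2 (z.2 + L2 * h n)|].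
have step n z : bad n z -> {z' | bad n.+1 z' /\
    (z.1 <= z'.1 <= z.1 + L1 * h n.+1 /\ z.2 <= z'.2 <= z.2 + L2 * h n.+1)}.
  case: z => x y /= [/= ax xb cy yd bd]; apply: cid.
  set k1 := L1 * h n.+1; set k2 := L2 * h n.+1.
  have k10 : 0 <= k1 by rewrite mulr_ge0 // ltW.
  have k20 : 0 <= k2 by rewrite mulr_ge0 // ltW.
  have E1 : x + L1 * h n = x + k1 + k1 by rewrite (hS n) mulrDr addrA.
  have E2 : y + L2 * h n = y + k2 + k2 by rewrite (hS n) mulrDr addrA.
  rewrite E1 in xb bd; rewrite E2 in yd bd.
  rewrite (@circulation_quarter _ _ x (x + k1) _ y (y + k2)) in bd; try lra;
    last by move=> u v /andP[? ?] /andP[? ?]; apply: H; apply/andP; split; lra.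
  set c1 := circulation _ _ _ _ _ _ in bd.
  set c2 := circulation _ _ _ _ _ _ in bd.
  set c3 := circulation _ _ _ _ _ _ in bd.
  set c4 := circulation _ _ _ _ _ _ in bd.
  have E : eta * h n ^+ 2 = 4 * (eta * h n.+1 ^+ 2) by rewrite (hS n); ring.
  rewrite E in bd; set e' := eta * h n.+1 ^+ 2 in bd.
  have T : `|c1 + c2 + (c3 + c4)| <= `|c1| + `|c2| + (`|c3| + `|c4|).
    by apply: (le_trans (ler_normD _ _)); apply: lerD; exact: ler_normD.
  have [g|g1] := leP e' `|c1|.
    by exists (x, y); rewrite /bad /= -/k1 -/k2; do !split => //; lra.
  have [g|g2] := leP e' `|c2|.
    by exists (x + k1, y); rewrite /bad /= -/k1 -/k2; do !split => //; lra.
  have [g|g3] := leP e' `|c3|.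
    by exists (x, y + k2); rewrite /bad /= -/k1 -/k2; do !split => //; lra.
  exists (x + k1, y + k2); rewrite /bad /= -/k1 -/k2; do !split => //; try lra.
  by rewrite -/c4 -/e'; lra.
have bad0 : bad 0 (a, c).
  by rewrite /bad /= /h expr0 /L1 /L2 !mulr1 expr1n mulr1 !subrKC; split.
pose fix sq n : {z | bad n z} := match n with
  | 0%N => exist _ (a, c) bad0
  | n'.+1 => let: exist z hz := sq n' in
     let: exist z' hz' := step n' z hz in exist _ z' (proj1 hz') end.
pose z n := sval (sq n).
have zb n : bad n (z n) by rewrite /z; case: (sq n).
have zS n : (z n).1 <= (z n.+1).1 <= (z n).1 + L1 * h n.+1 /\
            (z n).2 <= (z n.+1).2 <= (z n).2 + L2 * h n.+1.
  rewrite /z /=; case: (sq n) => w hw /=.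
  by case: (step n w hw) => w' /= [].
have lim (f : nat -> R) (L : R) : 0 <= L ->
    (forall n, f n <= f n.+1 <= f n + L * h n.+1) ->
    exists x, forall n, f n <= x <= f n + L * h n.
  move=> L0 fS.
  have mono n m : f n <= f (n + m)%N <= f n + L * (h n - h (n + m)%N).
    elim: m => [|m /andP[i1 i2]]; first by rewrite addn0 subrr mulr0 addr0 lexx.
    have /andP[i3 i4] := fS (n + m)%N; rewrite addnS.
    rewrite (le_trans i1 i3) /=; apply: (le_trans i4).
    by move: i2; rewrite (hS (n + m)%N) => i2; lra.
  have up n m : f m <= f n + L * h n.
    have hn : 0 <= L * h n by rewrite mulr_ge0 // ltW.
    have [nm|/ltnW mn] := leqP n m.
      have := mono n (m - n)%N; rewrite subnKC // => /andP[_ i].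
      apply: (le_trans i); rewrite lerD2l ler_wpM2l // gerBl ltW //.
    have := mono m (n - m)%N; rewrite subnKC // => /andP[i _]; lra.
  have hs : has_sup (range f).
    split; first by exists (f 0%N); exists 0%N.
    by exists (f 0%N + L * h 0%N) => _ [m _ <-]; exact: up.
  exists (sup (range f)) => n; apply/andP; split.
    by apply: (ub_le_sup hs.2); exists n.
  by apply: (ge_sup hs.1) => _ [m _ <-]; exact: up.
have [x hx] := lim (fun n => (z n).1) L1 L10 (fun n => (zS n).1).
have [y hy] := lim (fun n => (z n).2) L2 L20 (fun n => (zS n).2).
have xab : a <= x <= b.
  have := hx 0%N; case: (zb 0%N) => ? ? _ _ _ /andP[? ?]; apply/andP; split; lra.
have yab : c <= y <= d.
  have := hy 0%N; case: (zb 0%N) => _ _ ? ? _ /andP[? ?]; apply/andP; split; lra.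
have [p1 [p [q2 [hP hQ]]]] := H x y xab yab.
pose S := L1 + L2 + 1.
have S0 : 0 < S by rewrite /S; lra.
(* this accuracy forces eta <= eta / 2 in the limit *)
have e0 : 0 < eta / (2 * S ^+ 2) by rewrite divr_gt0 // mulr_gt0 // exprn_gt0.
have [r r0 Hr] := circulation_small e0 hP hQ.
have [n hn] : exists n, S * h n < r.
  have /cvgrPdist_lt /(_ (r / S)) : h @ \oo --> (0 : R).
    by apply: cvg_expr; rewrite ger0_norm; lra.
  rewrite divr_gt0 // => /(_ isT) [n _ /(_ n (leqnn n))] /=.
  rewrite sub0r normrN gtr0_norm // ltr_pdivlMr // mulrC => ?.
  by exists n.
have [z1 z2 z3 z4 zz] := zb n.
have hnS : h n <= 1 by rewrite exprn_ile1 //; lra.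
have := Hr _ _ _ _ (hx n) (hy n).
have -> : (z n).1 + L1 * h n - (z n).1 + ((z n).2 + L2 * h n - (z n).2)
   = (L1 + L2) * h n by ring.
have hle : (L1 + L2) * h n <= S * h n by rewrite ler_wpM2r ?ltW // /S; lra.
move=> /(_ (le_lt_trans hle hn)) => K.
have {}K := le_trans zz (K _).
have {K} : eta * h n ^+ 2 <= eta / (2 * S ^+ 2) * ((L1 + L2) * h n) ^+ 2.
  by apply: K => u v /andP[? ?] /andP[? ?]; apply: H; apply/andP; split; lra.
rewrite exprMn [leRHS]mulrA ler_pM2r ?exprn_gt0 // => K.
have : eta / (2 * S ^+ 2) * (L1 + L2) ^+ 2 <= eta / (2 * S ^+ 2) * S ^+ 2.
  rewrite ler_pM2l // lerXn2r // ?nnegrE; [lra|exact: ltW|rewrite /S; lra].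
have -> : eta / (2 * S ^+ 2) * S ^+ 2 = eta / 2 by field; lra.
lra.
Qed.

End Goursat.

(** * Complex moduli and the exponential in polar form *)

Section Cmod.
Variable R : realType.
Implicit Types (z w : Cplx R) (x : R).

Lemma normE z : `|z| = ofR (cmod z).
Proof. by case: z. Qed.

Lemma ltr_ofR x y : (ofR x < ofR y :> Cplx R) = (x < y).
Proof. exact: ltcR. Qed.

Lemma ler_ofR x y : (ofR x <= ofR y :> Cplx R) = (x <= y).
Proof. exact: lecR. Qed.

Lemma ofRD x y : ofR (x + y) = ofR x + ofR y.
Proof. exact: rmorphD. Qed.

Lemma ofRM x y : ofR (x * y) = ofR x * ofR y.
Proof. exact: rmorphM. Qed.

Lemma ofRX x n : ofR (x ^+ n) = ofR x ^+ n.
Proof. exact: rmorphXn. Qed.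

Lemma ofR0 : ofR 0 = 0 :> Cplx R. Proof. by []. Qed.

Lemma ofR_inj x y : ofR x = ofR y -> x = y.
Proof. by case. Qed.

Lemma cmod_ge0 z : 0 <= cmod z.
Proof. by rewrite -ler_ofR -normE normr_ge0. Qed.

Lemma cmodM z w : cmod (z * w) = cmod z * cmod w.
Proof. by apply: ofR_inj; rewrite ofRM -!normE normrM. Qed.

Lemma cmodD z w : cmod (z + w) <= cmod z + cmod w.
Proof. by rewrite -ler_ofR ofRD -!normE ler_normD. Qed.

Lemma cmodN z : cmod (- z) = cmod z.
Proof. by apply: ofR_inj; rewrite -!normE normrN. Qed.

Lemma cmodB z w : cmod (z - w) <= cmod z + cmod w.
Proof. by rewrite -(cmodN w) cmodD. Qed.

Lemma cmod_distC z w : cmod (z - w) = cmod (w - z).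
Proof. by rewrite -cmodN opprB. Qed.

Lemma cmod_eq0 z : (cmod z == 0) = (z == 0).
Proof.
rewrite -[RHS]normr_eq0 normE; apply/eqP/eqP => [->//|h].
exact: ofR_inj.
Qed.

Lemma cmod0 : cmod (0 : Cplx R) = 0.
Proof. by apply/eqP; rewrite cmod_eq0. Qed.

Lemma cmod1 : cmod (1 : Cplx R) = 1.
Proof. by apply: ofR_inj; rewrite -normE normr1. Qed.

Lemma cmod_gt0 z : (0 < cmod z) = (z != 0).
Proof. by rewrite lt_neqAle cmod_ge0 andbT eq_sym cmod_eq0. Qed.

Lemma cmodV z : cmod z^-1 = (cmod z)^-1.
Proof.
have [->|z0] := eqVneq z 0; first by rewrite invr0 cmod0 invr0.
have m0 : cmod z != 0 by rewrite cmod_eq0.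
by apply: (mulfI m0); rewrite -cmodM !mulfV // cmod1.
Qed.

Lemma cmodX z n : cmod (z ^+ n) = cmod z ^+ n.
Proof. by elim: n => [|n IH]; rewrite ?expr0 ?cmod1 // !exprS cmodM IH. Qed.

Lemma cmod_ofR x : cmod (ofR x) = `|x|.
Proof. by rewrite /cmod /= expr0n addr0 sqrtr_sqr. Qed.

Lemma cmod_sum (I : Type) (r : seq I) (P : pred I) (F : I -> Cplx R) :
  cmod (\sum_(i <- r | P i) F i) <= \sum_(i <- r | P i) cmod (F i).
Proof.
elim/big_rec2: _ => [|i y z _ h]; first by rewrite cmod0.
by apply: (le_trans (cmodD _ _)); rewrite lerD2l.
Qed.

Lemma cmod_prod (I : Type) (r : seq I) (P : pred I) (F : I -> Cplx R) :
  cmod (\prod_(i <- r | P i) F i) = \prod_(i <- r | P i) cmod (F i).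
Proof. by elim/big_rec2: _ => [|i y z _ <-]; rewrite ?cmod1 ?cmodM. Qed.

Lemma Re_le_cmod z : `|complex.Re z| <= cmod z.
Proof.
by rewrite -sqrtr_sqr; case: z => a b /=; apply: ler_wsqrtr; rewrite lerDl sqr_ge0.
Qed.

Lemma Im_le_cmod z : `|complex.Im z| <= cmod z.
Proof.
by rewrite -sqrtr_sqr; case: z => a b /=; apply: ler_wsqrtr; rewrite lerDr sqr_ge0.
Qed.

Lemma cmod_le_ReIm z : cmod z <= `|complex.Re z| + `|complex.Im z|.
Proof.
case: z => a b /=; rewrite -(@ler_pXn2r _ 2) ?nnegrE ?sqrtr_ge0 ?addr_ge0 //.
rewrite sqr_sqrtr ?addr_ge0 ?sqr_ge0 // sqrrD !real_normK ?num_real //.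
by rewrite lerD2r lerDl mulrn_wge0 // mulr_ge0.
Qed.

Lemma ReB z w : complex.Re (z - w) = complex.Re z - complex.Re w.
Proof. by case: z w => [a b] [c d]. Qed.

Lemma ImB z w : complex.Im (z - w) = complex.Im z - complex.Im w.
Proof. by case: z w => [a b] [c d]. Qed.

Lemma polarM (r1 t1 r2 t2 : R) :
  polar r1 t1 * polar r2 t2 = polar (r1 * r2) (t1 + t2).
Proof.
rewrite /polar; apply/eqP; rewrite eq_complex /= cosD sinD.
by apply/andP; split; apply/eqP; ring.
Qed.

Lemma cmod_polar (r t : R) : 0 <= r -> cmod (polar r t) = r.
Proof.
move=> r0; rewrite /cmod /polar /= !exprMn -mulrDr cos2Dsin2 mulr1 sqrtr_sqr.
exact: ger0_norm.
Qed.

(** Neighbourhoods in the complex field are given by complex radii; this and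
    the next lemma trade them for real ones. *)
Lemma near_cplxP (z : Cplx R) (P : Cplx R -> Prop) :
  (\forall w \near z, P w) <->
  exists2 d : R, 0 < d & forall w, cmod (w - z) < d -> P w.
Proof.
split=> [/nbhs_ballP[e /= e0 He]|[d d0 H]].
  have eR : e = ofR (complex.Re e) by rewrite /ofR /= RRe_real // gtr0_real.
  exists (complex.Re e); first by rewrite -ltr_ofR -eR ofR0.
  move=> w hw; apply: He; rewrite /ball /= eR.
  by rewrite normE ltr_ofR cmod_distC.
apply/nbhs_ballP; exists (ofR d); first by rewrite /= -ofR0 ltr_ofR.
by move=> w; rewrite /ball /= normE ltr_ofR cmod_distC; exact: H.
Qed.

Lemma cvgn_cplxP (u : nat -> Cplx R) (l : Cplx R) : u @ \oo --> l <->
  forall e : R, 0 < e -> exists n0, forall n, (n0 <= n)%N -> cmod (u n - l) < e.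
Proof.
split=> [/cvgrPdist_lt H e e0|H].
  have /H : 0 < ofR e :> Cplx R by rewrite -ofR0 ltr_ofR.
  case=> n0 _ hn0; exists n0 => n /hn0 /=.
  by rewrite normE ltr_ofR cmod_distC.
apply/cvgrPdist_lt => e e0.
have eR : e = ofR (complex.Re e) by rewrite /ofR /= RRe_real // gtr0_real.
have /H[n0 h0] : 0 < complex.Re e by rewrite -ltr_ofR -eR ofR0.
by exists n0 => // n /h0; rewrite /= eR normE ltr_ofR cmod_distC.
Qed.

Definition cderiv_at (h : Cplx R -> Cplx R) z (D : Cplx R) :=
  forall e : R, 0 < e -> exists2 d : R, 0 < d & forall w, cmod (w - z) < d ->
    cmod (h w - h z - D * (w - z)) <= e * cmod (w - z).

Lemma derivable_cderiv_at h z : derivable h z 1 -> exists D, cderiv_at h z D.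
Proof.
move=> dh; exists ('D_1 h z) => e e0.
have /eqaddoP H := derivable_nbhs dh.
have /H /near_cplxP[d d0 {}H] : 0 < ofR e :> Cplx R by rewrite -ofR0 ltr_ofR.
exists d => // w hw.
have := H (w - z); rewrite subr0 => /(_ hw).
rewrite !fctE /= [_ *: 1]mulr1 subrK !normE -ofRM ler_ofR.
by rewrite [_ *: _]mulrC opprD addrA.
Qed.

End Cmod.

Section ComplexExp.
Variable R : realType.

Lemma real_taylor1 (f : R -> R) (l : R) : is_derive (0:R) (1:R) f l ->
  forall e : R, 0 < e -> exists2 d : R, 0 < d & forall x, `|x| < d ->
    `|f x - f 0 - l * x| <= e * `|x|.
Proof.
move=> [df dl] e e0.
have := @derivable_nbhs _ _ _ f 0 1 df; rewrite dl => /eqaddoP /(_ e e0).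
move=> /nbhs_ballP[d /= d0 H]; exists d => // x xd.
have := H x; rewrite /ball /= sub0r normrN => /(_ xd) /=.
rewrite !fctE /= addr0 [_ *: 1]mulr1 [_ *: l]mulrC.
by rewrite opprD addrA.
Qed.

(** This is exp (x + i y) = 1 + (x + i y) + o(|x| + |y|). *)
Lemma polar_exp_taylor1 (e : R) : 0 < e ->
  exists2 d : R, 0 < d & forall x y : R, `|x| < d -> `|y| < d ->
    cmod (polar (expR x) y - 1 - Complex x y) <= e * (`|x| + `|y|).
Proof.
move=> e0; have e80 : 0 < Num.min 1 (e / 8) by rewrite lt_min ltr01 /=; lra.
have [d1 d10 H1] := real_taylor1 (@is_derive_expR R 0) e80.
have [d2 d20 H2] := real_taylor1 (@is_derive_cos R 0) e80.
have [d3 d30 H3] := real_taylor1 (@is_derive_sin R 0) e80.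
exists (Num.min (Num.min d1 d2) (Num.min d3 (Num.min 1 (e / 8)))).
  by rewrite !lt_min d10 d20 d30 /=; rewrite lt_min in e80.
move=> x y; rewrite !lt_min => /andP[/andP[x1 _] /andP[_ /andP[x2 x3]]].
move=> /andP[/andP[_ y2] /andP[y3 /andP[y4 y5]]].
have := H1 x x1; rewrite expR0 mul1r => h1.
have := H2 y y2; rewrite cos0 sin0 oppr0 mul0r subr0 => h2.
have := H3 y y3; rewrite sin0 cos0 subr0 mul1r => h3.
set m := Num.min 1 (e / 8) in h1 h2 h3.
have m1 : m <= 1 by rewrite ge_min lexx.
have me : m <= e / 8 by rewrite ge_min lexx orbT.
have nx := normr_ge0 x; have ny := normr_ge0 y.
have mx : m * `|x| <= e / 8 * `|x| by rewrite ler_wpM2r.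
have my : m * `|y| <= e / 8 * `|y| by rewrite ler_wpM2r.
have ex : `|expR x - 1| <= 2 * `|x|.
  rewrite (_ : _ - _ = (expR x - 1 - x) + x); last by rewrite subrK.
  apply: (le_trans (ler_normD _ _)).
  have : m * `|x| <= 1 * `|x| by rewrite ler_wpM2r.
  lra.
have ex3 : `|expR x| <= 3.
  rewrite (_ : expR x = (expR x - 1) + 1); last by rewrite subrK.
  by apply: (le_trans (ler_normD _ _)); rewrite normr1; lra.
apply: (le_trans (cmod_le_ReIm _)).
have -> : complex.Re (polar (expR x) y - 1 - Complex x y) =
  expR x * (cos y - 1) + (expR x - 1 - x) by rewrite /=; ring.
have -> : complex.Im (polar (expR x) y - 1 - Complex x y) =
  (expR x - 1) * y + expR x * (sin y - y) by rewrite /=; ring.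
have t1 : `|expR x * (cos y - 1)| <= 3 * (e / 8 * `|y|).
  by rewrite normrM; apply: ler_pM => //; apply: le_trans my.
have t2 : `|expR x * (sin y - y)| <= 3 * (e / 8 * `|y|).
  by rewrite normrM; apply: ler_pM => //; apply: le_trans my.
have t3 : `|(expR x - 1) * y| <= 2 * (e / 8) * `|y|.
  rewrite normrM; apply: ler_wpM2r => //; lra.
have := ler_normD (expR x * (cos y - 1)) (expR x - 1 - x).
have := ler_normD ((expR x - 1) * y) (expR x * (sin y - y)).
have e8x : 0 <= e / 8 * `|x| by rewrite mulr_ge0 //; lra.
have e8y : 0 <= e / 8 * `|y| by rewrite mulr_ge0 //; lra.
clear H1 H2 H3; lra.
Qed.

(** Chain rule for h o exp in logarithmic coordinates (x, y), in which circles
    around the origin become vertical segments and the punctured disc becomes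
    a half-plane. *)
Lemma has_differential_polar (h : Cplx R -> Cplx R) (D : Cplx R) (x y : R) :
  cderiv_at h (polar (expR x) y) D ->
  let c := D * polar (expR x) y in
  forall e : R, 0 < e -> exists2 d : R, 0 < d & forall x' y' : R,
    `|x' - x| < d -> `|y' - y| < d ->
    cmod (h (polar (expR x') y') - h (polar (expR x) y)
          - c * Complex (x' - x) (y' - y)) <= e * (`|x' - x| + `|y' - y|).
Proof.
move=> Hd c e e0; set w := polar (expR x) y in Hd c *.
pose W := cmod w; pose M := cmod D.
have W0 : 0 < W by rewrite /W cmod_polar ?expR_ge0 // expR_gt0.
have M0 : 0 <= M := cmod_ge0 D.
have e1 : 0 < e / (4 * W) by rewrite divr_gt0 // mulr_gt0.
have e2 : 0 < Num.min 1 (e / (2 * (M * W + 1))).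
  by rewrite lt_min ltr01 /= divr_gt0 // mulr_gt0 // ltr_wpDl // mulr_ge0 // ltW.
have [d1 d10 H1] := Hd _ e1.
have [d2 d20 H2] := polar_exp_taylor1 e2.
exists (Num.min d2 (d1 / (8 * W))).
  by rewrite lt_min d20 divr_gt0 // mulr_gt0.
move=> x' y'; rewrite !lt_min => /andP[x1 x2] /andP[y1 y2].
set a := x' - x in x1 x2 *; set b := y' - y in y1 y2 *.
have {}H2 := H2 _ _ x1 y1.
have E : polar (expR x') y' = w * polar (expR a) b.
  by rewrite /w polarM -expRD /a /b !subrKC.
set m := Num.min _ _ in e2 H2.
have m1 : m <= 1 by rewrite ge_min lexx.
have me : m <= e / (2 * (M * W + 1)) by rewrite ge_min lexx orbT.
set s := `|a| + `|b| in H2 *.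
have s0 : 0 <= s by rewrite addr_ge0.
have cab : cmod (Complex a b) <= s by exact: cmod_le_ReIm.
have q : cmod (polar (expR a) b - 1) <= 2 * s.
  rewrite (_ : _ - _ = (polar (expR a) b - 1 - Complex a b) + Complex a b);
    last by rewrite subrK.
  apply: (le_trans (cmodD _ _)).
  have : m * s <= 1 * s by rewrite ler_wpM2r.
  lra.
rewrite E.
have Ew : w * polar (expR a) b - w = w * (polar (expR a) b - 1).
  by rewrite mulrBr mulr1.
have qw : cmod (w * polar (expR a) b - w) <= W * (2 * s).
  by rewrite Ew cmodM ler_wpM2l // ltW.
have lt1 : W * (2 * s) < d1.
  rewrite ltr_pdivlMr ?mulr_gt0 // in x2; rewrite ltr_pdivlMr ?mulr_gt0 // in y2.
  rewrite /s; set u := `|a| in x2 *; set v := `|b| in y2 *.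
  clear - x2 y2 d10; nra.
have {}H1 := H1 _ (le_lt_trans qw lt1).
rewrite (_ : _ - c * _ = (h (w * polar (expR a) b) - h w -
   D * (w * polar (expR a) b - w)) + D * w * (polar (expR a) b - 1 - Complex a b));
  last by rewrite Ew /c; ring.
apply: (le_trans (cmodD _ _)); rewrite [cmod (D * w * _)]cmodM [cmod (D * w)]cmodM.
have b1 : e / (4 * W) * cmod (w * polar (expR a) b - w) <= e / 2 * s.
  apply: (@le_trans _ _ (e / (4 * W) * (W * (2 * s)))).
    by rewrite ler_wpM2l // ltW.
  by rewrite le_eqVlt; apply/orP; left; apply/eqP; field; lra.
have b2 : M * W * cmod (polar (expR a) b - 1 - Complex a b) <= e / 2 * s.
  have MW0 : 0 <= M * W by rewrite mulr_ge0 // ltW.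
  apply: (@le_trans _ _ ((M * W + 1) * (e / (2 * (M * W + 1)) * s))).
    apply: ler_pM => //; [exact: cmod_ge0|by rewrite lerDl|].
    by apply: (le_trans H2); rewrite ler_wpM2r.
  by rewrite le_eqVlt; apply/orP; left; apply/eqP; field; lra.
rewrite -/M -/W; lra.
Qed.

End ComplexExp.

(** * Cauchy's estimates in one variable *)

Section CauchyOneVariable.
Variable R : realType.
Notation mu := (@lebesgue_measure R).

(** The Cauchy-Riemann equations: multiplication by c sends (1, 0) to
    (Re c, Im c) and (0, 1) to (- Im c, Re c). *)
Lemma has_differential_Re_Im (H : R -> R -> Cplx R) (c : Cplx R) (x y : R) :
  (forall e : R, 0 < e -> exists2 d : R, 0 < d & forall x' y' : R,
    `|x' - x| < d -> `|y' - y| < d ->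
    cmod (H x' y' - H x y - c * Complex (x' - x) (y' - y))
      <= e * (`|x' - x| + `|y' - y|)) ->
  closed_form_at (fun x y => complex.Im (H x y)) (fun x y => complex.Re (H x y)) x y.
Proof.
move=> hH; exists (complex.Im c), (complex.Re c), (- complex.Im c).
split=> e e0; have [d d0 {}hH] := hH e e0; exists d => // x' y' hx hy;
  apply: le_trans (hH x' y' hx hy).
  apply: le_trans (Im_le_cmod _); rewrite !ImB.
  by case: c {hH} => c1 c2 /=; rewrite [c2 * _ + _]addrC.
apply: le_trans (Re_le_cmod _); rewrite !ReB.
by case: c {hH} => c1 c2 /=; rewrite mulNr.
Qed.

(** In logarithmic coordinates h is periodic in y, so the horizontal sides of
    a rectangle of height 2 pi cancel and Goursat's theorem says that the mean
    of h over a circle does not depend on the radius. On small circles the mean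
    tends to p. *)
Lemma cauchy_mean (h : Cplx R -> Cplx R) (p : Cplx R) (S : R) :
  (forall z, 0 < cmod z < 1 -> derivable h z 1) ->
  (forall e : R, 0 < e -> exists2 d : R, 0 < d &
     forall z, 0 < cmod z < d -> cmod (h z - p) <= e) ->
  (forall z, cmod z = 2^-1 -> cmod (h z) <= S) ->
  cmod p <= S.
Proof.
move=> dh h0 hS.
have S0 : 0 <= S.
  apply: le_trans (hS (ofR 2^-1) _); first exact: cmod_ge0.
  by rewrite cmod_ofR ger0_norm // invr_ge0.
have [->|p0] := eqVneq p 0; first by rewrite cmod0.
(* the rotation that makes p real and positive, so that real parts suffice *)
pose l := ofR (cmod p) / p.
have lp : l * p = ofR (cmod p) by rewrite /l divfK.
have l1 : cmod l = 1.
  by rewrite cmodM cmodV cmod_ofR ger0_norm ?cmod_ge0 // mulfV // cmod_eq0.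
pose H x y := l * h (polar (expR x) y).
pose P x y := complex.Im (H x y); pose Q x y := complex.Re (H x y).
have cpol x y : cmod (polar (expR x) y) = expR x by rewrite cmod_polar // expR_ge0.
pose b : R := ln 2^-1.
have eb : expR b = 2^-1 by rewrite lnK // posrE invr_gt0.
have cf a x y : a <= x <= b -> 0 <= y <= pi *+ 2 -> closed_form_at P Q x y.
  move=> /andP[_ xb] _.
  have ex1 : expR x < 1.
    by apply: (@le_lt_trans _ _ (expR b)); rewrite ?ler_expR // eb; lra.
  have hd : derivable h (polar (expR x) y) 1.
    by apply: dh; rewrite cpol expR_gt0.
  have [D /has_differential_polar hD] := derivable_cderiv_at hd.
  apply: (@has_differential_Re_Im H (l * (D * polar (expR x) y))) => e e0.
  have [d d0 {}hD] := hD e e0; exists d => // x' y' hx hy.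
  rewrite /H -!mulrBr -[l * _ * _]mulrA -mulrBr cmodM l1 mul1r; exact: hD.
have pi2 : (0 : R) <= pi *+ 2 by rewrite mulrn_wge0 // pi_ge0.
have pi20 : (0 : R) < pi *+ 2 by rewrite pmulrn_rgt0 // pi_gt0.
rewrite leNgt; apply/negP => Sp.
have e0 : 0 < (cmod p - S) / 2 by lra.
set e := (cmod p - S) / 2 in e0 *.
have [d d0 hd] := h0 e e0.
(* the inner circle lies in the region where h is close to p *)
pose a := Num.min b (ln (d / 2)).
have ab : a <= b by rewrite ge_min lexx.
have ea : expR a < d.
  apply: (@le_lt_trans _ _ (expR (ln (d / 2)))).
    by rewrite ler_expR ge_min lexx orbT.
  rewrite lnK ?posrE; lra.
have G := goursat ab pi2 (cf a).
have [_ cQ] := closed_form_continuous (cf a).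
have per : \int[mu]_(x in `[a, b]) P x 0 = \int[mu]_(x in `[a, b]) P x (pi *+ 2).
  by apply: eq_Rintegral => x _; rewrite /P /H /polar cos2pi sin2pi cos0 sin0.
move: G; rewrite /circulation per subrr add0r => /eqP; rewrite subr_eq0 => /eqP G.
have B1 : `|\int[mu]_(y in `[0, pi *+ 2]) Q b y - 0 * (pi *+ 2 - 0)|
    <= S * (pi *+ 2 - 0).
  apply: segment_integral_near_cst pi2 _ _; first by apply: cQ; rewrite lexx ab.
  move=> y _; rewrite subr0; apply: (le_trans (Re_le_cmod _)).
  by rewrite /H cmodM l1 mul1r hS // cpol eb.
have B2 : `|\int[mu]_(y in `[0, pi *+ 2]) Q a y - cmod p * (pi *+ 2 - 0)|
    <= e * (pi *+ 2 - 0).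
  apply: segment_integral_near_cst pi2 _ _; first by apply: cQ; rewrite lexx ab.
  move=> y _; have -> : cmod p = complex.Re (l * p) by rewrite lp.
  rewrite -ReB /H -mulrBr; apply: (le_trans (Re_le_cmod _)).
  by rewrite cmodM l1 mul1r hd // cpol expR_gt0.
rewrite G mul0r !subr0 in B1 B2.
set I := Rintegral _ _ _ in B1 B2.
have : cmod p * (pi *+ 2) <= (S + e) * (pi *+ 2).
  move: B1 B2; rewrite !ler_norml mulrDl => /andP[_ B1] /andP[B2 _].
  clear -B1 B2; lra.
rewrite ler_pM2r // /e; clear -Sp; lra.
Qed.

Lemma cvgn_bounded (u : nat -> Cplx R) (l : Cplx R) : u @ \oo --> l ->
  exists2 C : R, 0 < C & forall n, cmod (u n) <= C.
Proof.
move=> /cvgn_cplxP /(_ 1 ltr01)[n0 hn].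
exists (1 + cmod l + \sum_(i < n0) cmod (u i)).
  by rewrite !ltr_wpDr ?cmod_ge0 // sumr_ge0 // => i _; exact: cmod_ge0.
move=> n; have [h|h] := leqP n0 n.
  apply: (@le_trans _ _ (1 + cmod l)).
    rewrite -[u n](subrK l) (le_trans (cmodD _ _)) // lerD2r; exact/ltW/hn.
  by rewrite lerDl sumr_ge0 // => i _; exact: cmod_ge0.
rewrite (bigD1 (Ordinal h)) //= addrCA lerDl.
by rewrite !addr_ge0 ?cmod_ge0 // sumr_ge0 // => i _; exact: cmod_ge0.
Qed.

(** The point 0 is left out so that the quotients (h z - p 0) / z, which take a
    default value there, fall under the definition. *)
Definition sums_near0 (p : nat -> Cplx R) (h : Cplx R -> Cplx R) :=
  exists2 d : R, 0 < d & forall z, 0 < cmod z < d ->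
    series (fun n => p n * z ^+ n) @ \oo --> h z.

Lemma sums_near0_lim p h : sums_near0 p h -> forall e : R, 0 < e ->
  exists2 d : R, 0 < d & forall z, 0 < cmod z < d -> cmod (h z - p 0%N) <= e.
Proof.
move=> [d d0 H] e e0.
pose r := d / 2; have r0 : 0 < r by rewrite divr_gt0.
have [C C0 hC] : exists2 C : R, 0 < C & forall n, cmod (p n) * r ^+ n <= C.
  have /cvgn_bounded[C C0 hC] : series (fun n => p n * ofR r ^+ n) @ \oo --> h (ofR r).
    by apply: H; rewrite cmod_ofR gtr0_norm // r0 /r; lra.
  exists (C + C); first by rewrite addr_gt0.
  move=> n.
  have -> : cmod (p n) * r ^+ n = cmod (series (fun n => p n * ofR r ^+ n) n.+1
      - series (fun n => p n * ofR r ^+ n) n).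
    by rewrite !seriesEnat /= big_nat_recr //= addrAC subrr add0r cmodM
      -ofRX cmod_ofR ger0_norm // exprn_ge0 // ltW.
  by apply: (le_trans (cmodB _ _)); apply: lerD; exact: hC.
exists (Num.min (r / 2) (e * r / (4 * C))).
  by rewrite lt_min !divr_gt0 // mulr_gt0.
move=> z; rewrite lt_min => /andP[z0 /andP[z1 z2]].
have zd : 0 < cmod z < d by rewrite z0 (lt_trans z1) // /r; lra.
have /cvgn_cplxP hz := H z zd.
have e20 : 0 < e / 2 by rewrite divr_gt0.
have [n0 hn] := hz _ e20.
have {}hn := hn n0.+1 (leqnSn _); rewrite cmod_distC in hn.
set s := series _ _ in hn.
have -> : h z - p 0%N = (h z - s) + (s - p 0%N) by rewrite addrA subrK.
apply: (le_trans (cmodD _ _)).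
suff : cmod (s - p 0%N) <= e / 2 by lra.
have -> : s - p 0%N = \sum_(i < n0) p i.+1 * z ^+ i.+1.
  by rewrite /s seriesEnat /= big_mkord big_ord_recl expr0 mulr1 addrAC subrr add0r.
pose t := cmod z / r.
have t0 : 0 <= t by rewrite divr_ge0 // ltW.
have t1 : t <= 1 / 2 by rewrite ler_pdivrMr // (le_trans (ltW z1)) //; lra.
apply: (@le_trans _ _ (\sum_(i < n0) C * t * (1 / 2) ^+ i)).
  apply: (le_trans (cmod_sum _ _ _)); apply: ler_sum => i _.
  have -> : cmod (p i.+1 * z ^+ i.+1) = (cmod (p i.+1) * r ^+ i.+1) * t ^+ i.+1.
    by rewrite cmodM cmodX -mulrA -exprMn /t mulrCA mulfV ?mulr1 // gt_eqF.
  rewrite -[C * t * _]mulrA; apply: ler_pM => //.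
  - by rewrite mulr_ge0 ?cmod_ge0 // exprn_ge0 // ltW.
  - by rewrite exprn_ge0.
  - by rewrite exprS ler_wpM2l // lerXn2r // nnegrE.
rewrite -mulr_sumr.
have G : \sum_(i < n0) (1 / 2 : R) ^+ i <= 2.
  have := subrX1 (1 / 2 : R) n0.
  have : 0 <= (1 / 2 : R) ^+ n0 by rewrite exprn_ge0.
  set q := (_ ^+ n0); set w := \sum_(i < n0) _; lra.
apply: (@le_trans _ _ (C * t * 2)).
  by rewrite ler_wpM2l // mulr_ge0 // ltW.
move: z2; rewrite ltr_pdivlMr ?mulr_gt0 // => z2.
rewrite /t mulrA mulrAC ler_pdivrMr //; lra.
Qed.

Lemma sums_near0_shift (p : nat -> Cplx R) (h : Cplx R -> Cplx R) : sums_near0 p h ->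
  sums_near0 (fun n => p n.+1) (fun z => (h z - p 0%N) / z).
Proof.
move=> [d d0 H]; exists d; first exact: d0.
move=> z zd; apply: (cvgn_cplxP _ _).2 => e e0.
have z0 : 0 < cmod z by case/andP: zd.
have zn0 : z != 0 by rewrite -cmod_gt0.
have /cvgn_cplxP /(_ (e * cmod z)) := H z zd.
rewrite mulr_gt0 // => /(_ isT)[n0 hn]; exists n0 => n n0n.
have := hn n.+1 (leqW n0n).
have -> : series (fun n => p n * z ^+ n) n.+1 =
    p 0%N + z * series (fun n => p n.+1 * z ^+ n) n.
  rewrite !seriesEnat /= !big_mkord big_ord_recl expr0 mulr1; congr (_ + _).
  by rewrite mulr_sumr; apply: eq_bigr => i _; rewrite exprS mulrCA.
set s := series _ n.
have -> : p 0%N + z * s - h z = z * (s - (h z - p 0%N) / z).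
  by rewrite mulrBr [z * (_ / z)]mulrCA mulfV // mulr1; ring.
by rewrite cmodM mulrC ltr_pM2r.
Qed.

(** The function (h z - p 0) / z has the shifted coefficients, and its bound
    on the circle of radius 1/2 is at most 2 (S + S). Iterating costs a factor 4
    per coefficient, and cauchy_mean bounds the constant coefficient each time. *)
Lemma cauchy_coef_bound (h : Cplx R -> Cplx R) (p : nat -> Cplx R) (S : R) :
  (forall z, 0 < cmod z < 1 -> derivable h z 1) ->
  (forall z, cmod z = 2^-1 -> cmod (h z) <= S) ->
  sums_near0 p h -> forall n, cmod (p n) <= S * 4 ^+ n.
Proof.
move=> dh hS hp n; elim: n h p S dh hS hp => [|n IH] h p S dh hS hp;
  have p0 := cauchy_mean dh (sums_near0_lim hp) hS.
  by rewrite expr0 mulr1.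
rewrite exprS mulrA.
apply: (IH (fun z => (h z - p 0%N) / z) (fun n => p n.+1)).
- move=> z z01; apply: derivableM.
    by apply: derivableB; [exact: dh|exact: derivable_cst].
  apply: derivableV; last exact: derivable_id.
  by rewrite -cmod_gt0; case/andP: z01.
- move=> z hz; rewrite cmodM cmodV hz invrK.
  have := hS z hz; have := cmodB (h z) (p 0%N); lra.
- exact: sums_near0_shift.
Qed.

End CauchyOneVariable.

(** * Cauchy's estimates in a polydisc *)

Section MultiIndex.
Variable N : nat.
Implicit Types b : midx N.

Definition mdeg b : nat := (\sum_(i < N) b i)%N.

Definition midx_of_ord n (f : {ffun 'I_N -> 'I_n}) : midx N :=
  [ffun i => val (f i)].

Definition box (n : nat) : {fset midx N} :=
  [fset b in [seq midx_of_ord f | f : {ffun 'I_N -> 'I_n}]]%fset.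

Lemma boxP n b : reflect (forall i, (b i < n)%N) (b \in box n).
Proof.
rewrite !inE /=; apply: (iffP mapP) => [[f _ ->] i|H].
  by rewrite ffunE ltn_ord.
exists [ffun i => Ordinal (H i)]; first by rewrite mem_enum.
by apply/ffunP => i; rewrite !ffunE.
Qed.

Lemma leq_mdeg b i : (b i <= mdeg b)%N.
Proof. by rewrite /mdeg (bigD1 i) //= leq_addr. Qed.

Lemma mdeg_box n b : (mdeg b < n)%N -> b \in box n.
Proof. by move=> h; apply/boxP => i; apply: leq_ltn_trans h; exact: leq_mdeg. Qed.

Definition degree_eq (d : nat) : {fset midx N} :=
  [fset b in box d.+1 | mdeg b == d]%fset.

Definition degree_lt (n : nat) : {fset midx N} :=
  [fset b in box n | (mdeg b < n)%N]%fset.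

Lemma in_degree_eq d b : (b \in degree_eq d) = (mdeg b == d).
Proof.
rewrite !inE /=; apply: andb_idl => /eqP h.
by have := @mdeg_box d.+1 b; rewrite h ltnSn !inE /=; apply.
Qed.

Lemma in_degree_lt n b : (b \in degree_lt n) = (mdeg b < n)%N.
Proof.
rewrite !inE /=; apply: andb_idl => h.
by have := mdeg_box h; rewrite !inE.
Qed.

(** Grouping a multiple power series by total degree turns it, along a complex
    line through the origin, into a power series in one variable. *)
Lemma sum_degree_lt (V : zmodType) (F : midx N -> V) n :
  \sum_(b <- degree_lt n) F b = \sum_(0 <= d < n) \sum_(b <- degree_eq d) F b.
Proof.
rewrite big_mkord.
transitivity (\sum_(b <- degree_lt n) \sum_(d < n | mdeg b == d) F b).
  rewrite [LHS]big_seq [RHS]big_seq; apply: eq_bigr => b.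
  rewrite in_degree_lt => h.
  by rewrite (big_pred1 (Ordinal h)) // => d; rewrite /= -val_eqE /= eq_sym.
rewrite (exchange_big_dep predT) //=; apply: eq_bigr => d _.
rewrite big_fset_condE; apply: eq_fbig => // b.
have := in_degree_lt n b; have := in_degree_eq d b.
rewrite !inE /= => E1 E2; rewrite E1 E2.
by rewrite andbC; case: eqP => //= ->; rewrite ltn_ord.
Qed.

End MultiIndex.

Section CauchyPolydisc.
Variable R : realType.

Lemma derivable_finite_sum (I : Type) (r : seq I) (P : pred I)
  (h : I -> Cplx R -> Cplx R) (z : Cplx R) :
  (forall i, derivable (h i) z 1) ->
  derivable (fun z : Cplx R => \sum_(i <- r | P i) h i z) z 1.
Proof.
move=> dh; elim: r => [|i r IH].
  rewrite (_ : (fun _ => _) = cst 0); first exact: derivable_cst.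
  by apply/funext => w; rewrite big_nil.
case Pi : (P i).
  rewrite (_ : (fun _ => _) = h i + (fun z => \sum_(i <- r | P i) h i z)).
    by apply: derivableD; [exact: dh|exact: IH].
  by apply/funext => w; rewrite big_cons Pi.
rewrite (_ : (fun _ => _) = (fun z => \sum_(i <- r | P i) h i z)); first exact: IH.
by apply/funext => w; rewrite big_cons Pi.
Qed.

Lemma derivable_monomial (c z : Cplx R) (n : nat) : derivable (fun z : Cplx R => c * z ^+ n) z 1.
Proof.
apply: derivableM; first exact: derivable_cst.
exact: exprn_derivable.
Qed.

(** The case of a polynomial, whose coefficient of z^n collects all indices
    with k i = n. *)
Lemma monomial_sum_coef_bound (I : eqType) (r : seq I) (P : pred I)
    (c : I -> Cplx R) (k : I -> nat) (S : R) (n : nat) :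
  (forall z, cmod z <= 1 -> cmod (\sum_(i <- r | P i) c i * z ^+ k i) <= S) ->
  cmod (\sum_(i <- r | P i && (k i == n)) c i) <= S * 4 ^+ n.
Proof.
move=> hS.
pose p n := \sum_(i <- r | P i && (k i == n)) c i.
apply: (@cauchy_coef_bound _ (fun z => \sum_(i <- r | P i) c i * z ^+ k i) p).
- by move=> z _; apply: derivable_finite_sum => i; exact: derivable_monomial.
- by move=> z hz; apply: hS; rewrite hz; lra.
exists 1; first exact: ltr01.
move=> z _; apply: (cvgn_cplxP _ _).2 => e e0.
exists (\max_(i <- r) (k i).+1)%N => m hm.
rewrite (_ : series _ m = \sum_(i <- r | P i) c i * z ^+ k i) ?subrr ?cmod0 //.
rewrite seriesEnat /= big_mkord.
transitivity (\sum_(d < m) \sum_(i <- r | P i && (k i == d)) c i * z ^+ d).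
  by apply: eq_bigr => d _; rewrite -mulr_suml.
rewrite (exchange_big_dep P) /=; last by move=> d i _ /andP[].
rewrite [LHS]big_seq_cond [RHS]big_seq_cond; apply: eq_bigr => i /andP[ir Pi].
have km : (k i < m)%N by apply: leq_trans hm; exact: leq_bigmax_seq.
rewrite (big_pred1 (Ordinal km)) // => d; rewrite Pi /= -val_eqE /= eq_sym.
by [].
Qed.

Variable N : nat.
Implicit Types (b : midx N) (w : 'I_N -> Cplx R).

(** The one-variable estimate is applied to one variable after another: agree k
    keeps the monomials with the right exponents in the first k variables, and
    mon k is what remains of a monomial when these variables are removed. *)
Lemma polynomial_coef_bound (A : {fset midx N}) (c : midx N -> Cplx R) (r S : R) :
  0 < r ->
  (forall w, (forall i, cmod (w i) <= r) ->
     cmod (\sum_(b <- A) c b * \prod_(i < N) w i ^+ b i) <= S) ->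
  forall b, b \in A -> cmod (c b) <= S * (4 / r) ^+ mdeg b.
Proof.
move=> r0 hS beta bA.
pose agree k b := [forall i : 'I_N, (i < k)%N ==> (b i == beta i)].
pose mon k w b := \prod_(i < N | (k <= i)%N) w i ^+ b i.
suff K k : (k <= N)%N -> forall w, (forall i, cmod (w i) <= r) ->
    cmod (\sum_(b <- A | agree k b) c b * mon k w b) <=
    S * (4 / r) ^+ (\sum_(i < N | (i < k)%N) beta i)%N.
  have := K N (leqnn N) (fun=> 0); rewrite cmod0 => /(_ (fun=> ltW r0)).
  have -> : \sum_(b <- A | agree N b) c b * mon N (fun=> 0) b = c beta.
    rewrite (eq_bigl (pred1 beta)).
      rewrite big_fset_condE (_ : [fset _ | _ in _ & _]%fset = [fset beta]%fset).
        rewrite big_seq_fset1 /mon big1 ?mulr1 // => i.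
        by rewrite leqNgt ltn_ord.
      apply/fsetP => b; rewrite !inE /= andbC; case: eqP => //= ->; exact: bA.
    move=> b; apply/forallP/eqP => [h|-> i]; last by rewrite eqxx implybT.
    by apply/ffunP => i; have := h i; rewrite ltn_ord => /eqP.
  by rewrite (eq_bigl xpredT) // => i; rewrite ltn_ord.
elim: k => [_ w hw|k IH kN w hw].
  rewrite [X in _ ^+ X]big1 // mulr1.
  apply: le_trans (hS w hw); rewrite le_eqVlt; apply/orP; left; apply/eqP.
  congr cmod; apply: eq_bigl => b; apply/forallP => i //.
pose ik := Ordinal kN.
pose w' (z : Cplx R) i := if i == ik then z * ofR r else w i.
have hw' z : cmod z <= 1 -> forall i, cmod (w' z i) <= r.
  move=> hz i; rewrite /w'; case: eqP => // _.
  by rewrite cmodM cmod_ofR gtr0_norm // ler_piMl // ltW.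
have monE z b : mon k (w' z) b = z ^+ b ik * (ofR r ^+ b ik * mon k.+1 w b).
  rewrite /mon (bigD1 ik) //= /w' eqxx exprMn -mulrA; congr (_ * (_ * _)).
  rewrite (eq_bigl (fun i : 'I_N => (k < i)%N)) => [|i].
    apply: eq_bigr => i ki; case: eqP => // E.
    by rewrite E ltnn in ki.
  by rewrite ltn_neqAle -val_eqE /= andbC eq_sym.
pose c' b := c b * (ofR r ^+ b ik * mon k.+1 w b).
have := @monomial_sum_coef_bound _ A (agree k) c' (fun b => b ik)
  (S * (4 / r) ^+ (\sum_(i < N | (i < k)%N) beta i)%N) (beta ik).
have agS b : agree k b && (b ik == beta ik) = agree k.+1 b.
  apply/andP/forallP => [[/forallP h /eqP h2] i|h].
    rewrite ltnS leq_eqVlt; case: eqP => /= [E|_]; last exact: h.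
    by rewrite (_ : i = ik) ?h2 //; apply: val_inj.
  split; last by have := h ik; rewrite ltnSn.
  by apply/forallP => i; apply/implyP => ik'; have := h i; rewrite ltnW.
rewrite (eq_bigl _ _ agS).
have E : \sum_(b <- A | agree k.+1 b) c' b =
    ofR r ^+ beta ik * \sum_(b <- A | agree k.+1 b) c b * mon k.+1 w b.
  rewrite mulr_sumr; apply: eq_bigr => b /forallP /(_ ik); rewrite ltnSn => /eqP bk.
  by rewrite /c' bk mulrCA.
rewrite E cmodM -ofRX cmod_ofR ger0_norm ?exprn_ge0 ?(ltW r0) // => hb.
have sumS : (\sum_(i < N | (i < k.+1)%N) beta i =
    beta ik + \sum_(i < N | (i < k)%N) beta i)%N.
  rewrite (bigD1 ik) //=; congr (_ + _)%N; apply: eq_bigl => i.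
  by rewrite ltnS leq_eqVlt -val_eqE /=; case: ltngtP.
have rb0 : 0 < r ^+ beta ik by rewrite exprn_gt0.
rewrite sumS exprD [(4 / r) ^+ beta ik]expr_div_n -(ler_pM2l rb0).
have -> (x q : R) : r ^+ beta ik * (S * (x / r ^+ beta ik * q)) = S * q * x.
  by field; rewrite gt_eqF.
apply: hb => z hz.
apply: le_trans (IH (ltnW kN) (w' z) (hw' z hz)); rewrite le_eqVlt.
apply/orP; left; apply/eqP; congr cmod; apply: eq_bigr => b _.
by rewrite monE /c' -mulrA [_ * z ^+ _]mulrC.
Qed.

Lemma near_rV_coord (P : 'rV[Cplx R]_N -> Prop) :
  (\forall z \near (0 : 'rV[Cplx R]_N), P z) ->
  exists2 d : R, 0 < d & forall z : 'rV[Cplx R]_N,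
    (forall i, cmod (z ord0 i) < d) -> P z.
Proof.
move=> /nbhs_ballP[e /= e0 He].
have eR : e = ofR (complex.Re e) by rewrite /ofR /= RRe_real // gtr0_real.
exists (complex.Re e); first by rewrite -ltr_ofR -eR ofR0.
move=> z hz; apply: He; split; first exact: e0.
move=> i j; rewrite mxE (ord1 i) /ball /= eR.
by rewrite normE ltr_ofR sub0r cmodN.
Qed.

Definition row_of w : 'rV[Cplx R]_N := \row_i w i.

Lemma zmonom_scale (t : Cplx R) w b :
  zmonom (t *: row_of w) b = t ^+ mdeg b * \prod_(i < N) w i ^+ b i.
Proof.
rewrite /zmonom /mdeg -prodrXr -big_split /=; apply: eq_bigr => i _.
by rewrite !mxE exprMn.
Qed.

(** The expansion c is only known to represent g near 0, at a distance that is
    not controlled, whereas the bound must depend on r alone. Restricting g to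
    the line t w gives a function on the whole unit disc whose n-th coefficient
    is the homogeneous part of degree n at w; the one-variable estimate bounds
    that part on the whole polydisc, and then each of its coefficients. *)
Lemma cauchy_polydisc (r S : R) (g : 'rV[Cplx R]_N -> Cplx R) (c : zseries R N) :
  0 < r -> (forall z, polydisc r z -> differentiable g z) ->
  (forall z, polydisc r z -> cmod (g z) <= S) -> expansion g c ->
  forall b, cmod (c b) <= S * (16 / r) ^+ mdeg b.
Proof.
move=> r0 dg gS gc b.
pose d := mdeg b.
pose p w n : Cplx R := \sum_(b <- degree_eq N n) c b * \prod_(i < N) w i ^+ b i.
suff pS w : (forall i, cmod (w i) <= r) -> cmod (p w d) <= S * 4 ^+ d.
  have := polynomial_coef_bound (A := degree_eq N d) r0 pS.
  move=> /(_ b); rewrite in_degree_eq eqxx => /(_ isT).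
  by rewrite -/d -mulrA -exprMn mulrA -natrM.
move=> hw; pose h (t : Cplx R) : Cplx R := g (t *: row_of w).
have inD (t : Cplx R) : cmod t < 1 -> polydisc r (t *: row_of w).
  move=> t1 i; rewrite !mxE cmodM.
  apply: (@le_lt_trans _ _ (cmod t * r)); first by rewrite ler_wpM2l // cmod_ge0.
  by rewrite gtr_pMl.
apply: (@cauchy_coef_bound _ h (p w)).
- move=> t /andP[_ t1]; apply: (derivable1_diffP _ _).2.
  apply: (@differentiable_comp _ _ _ _ (fun t : Cplx R => t *: row_of w) g).
    by apply: differentiableZl; apply: (derivable1_diffP _ _).1; exact: derivable_id.
  exact/dg/inD.
- by move=> t ht; apply/gS/inD; rewrite ht; lra.
have [e e0 he] := near_rV_coord gc.
exists (e / r); first exact: divr_gt0.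
move=> t /andP[_ te]; apply: (cvgn_cplxP _ _).2 => eps eps0.
have hsum : zseries_sum c (t *: row_of w) (h t).
  apply: he => i; rewrite !mxE cmodM.
  apply: (@le_lt_trans _ _ (cmod t * r)); first by rewrite ler_wpM2l // cmod_ge0.
  by rewrite -ltr_pdivlMr.
have [A0 hA] := hsum eps eps0.
exists (\max_(b <- A0) (mdeg b).+1)%N => n hn.
have := hA (degree_lt N n) _.
rewrite (_ : \sum_(b <- degree_lt N n) _ = series (fun k => p w k * t ^+ k) n).
  apply; apply/fsubsetP => b' b'A; rewrite in_degree_lt; apply: leq_trans hn.
  by rewrite (big_fsetD1 b' b'A) leq_maxl.
rewrite sum_degree_lt seriesEnat; apply: eq_bigr => k _.
rewrite mulr_suml big_seq [RHS]big_seq; apply: eq_bigr => b'.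
by rewrite in_degree_eq zmonom_scale => /eqP ->; rewrite mulrCA mulrC.
Qed.

End CauchyPolydisc.

(** * Integrals over the positive axis *)

Section PositiveAxis.
Variable R : realType.
Notation mu := (@lebesgue_measure R).
Implicit Types (f g rho : R -> R).

Definition continuous_pos f := forall x, 0 < x -> {for x, continuous f}.

Lemma continuous_pos_measurable f :
  continuous_pos f -> measurable_fun (`]0, +oo[ : set R) f.
Proof.
move=> cf; apply: subspace_continuous_measurable_fun; first exact: measurable_itv.
by apply: continuous_in_subspaceT => x; rewrite inE /= in_itv /= andbT => /cf.
Qed.

Lemma continuous_pos_powR (a : R) : continuous_pos (fun x => x `^ a).
Proof.
move=> x x0; have [d _] := is_derive1_powR a x0.
by apply/differentiable_continuous/derivable1_diffP.
Qed.

(** Changes of variables are made on compact intervals, where the integrands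
    are continuous up to the end points, and then carried to the half-line. *)
Lemma exhaust_pos_integral (f : R -> R) (a b : nat -> R) :
  continuous_pos f -> (forall x, 0 < x -> 0 <= f x) ->
  (forall k, 0 < a k) -> (forall i j, (i <= j)%N -> a j <= a i) ->
  (forall i j, (i <= j)%N -> b i <= b j) ->
  (forall x, 0 < x -> exists k, a k <= x <= b k) ->
  (\int[mu]_(x in `[a k, b k]) (f x)%:E)%E @[k --> \oo] -->
  (\int[mu]_(x in `]0%R, +oo[) (f x)%:E)%E.
Proof.
move=> cf f0 a0 ha hb ab.
have -> : (`]0, +oo[ = \bigcup_k `[a k, b k])%classic.
  apply/seteqP; split => x /=.
    by rewrite in_itv /= andbT => /ab[k hk]; exists k => //; rewrite /= in_itv.
  by move=> [k _]; rewrite /= in_itv /= => /andP[h _]; rewrite in_itv /= andbT (lt_le_trans (a0 k)).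
apply: ge0_nondecreasing_set_cvg_integral.
- move=> i j ij; apply/subsetPset => x /=; rewrite !in_itv /= => /andP[h1 h2].
  by rewrite (le_trans (ha _ _ ij) h1) (le_trans h2 (hb _ _ ij)).
- by move=> i; exact: measurable_itv.
- move=> i; apply/measurable_EFinP; apply: measurable_funS (continuous_pos_measurable cf).
    exact: measurable_itv.
  move=> x /=; rewrite !in_itv /= andbT => /andP[h _]; exact: lt_le_trans h.
- move=> i x /=; rewrite in_itv /= => /andP[h _]; rewrite lee_fin f0 //.
  exact: lt_le_trans h.
Qed.

(** This is x = y^n. It relates the moments of a kernel e(z^(1/n)) / n, used
    to define moment functions of large order, to those of e itself. *)
Lemma integral_root_substitution (n p : nat) rho : (0 < n)%N ->
  continuous_pos rho -> (forall x, 0 < x -> 0 <= rho x) ->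
  (\int[mu]_(x in `]0%R, +oo[)
     (x `^ (p%:R - 1) * (rho (x `^ n%:R^-1) / n%:R))%:E =
   \int[mu]_(x in `]0%R, +oo[) (x `^ ((n * p)%:R - 1) * rho x)%:E)%E.
Proof.
move=> n0 crho rho0.
have nR : (0 : R) < n%:R by rewrite ltr0n.
pose F (x : R) := x ^+ n.
pose G (x : R) := x `^ (p%:R - 1) * (rho (x `^ n%:R^-1) / n%:R).
pose a k : R := k.+1%:R^-1; pose b k : R := k.+1%:R.
have a0 k : 0 < a k by rewrite invr_gt0 ltr0n.
have b0 k : 0 < b k by rewrite ltr0n.
have homF (x y : R) : 0 <= x -> x < y -> F x < F y.
  by move=> x0 xy; rewrite /F ltrXn2r ?xy ?orbT // -?lt0n // nnegrE.
have hle (x y : R) : 0 <= x -> x <= y -> F x <= F y.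
  by move=> x0 xy; apply: lerXn2r => //; rewrite nnegrE // (le_trans x0).
have ha : (forall i j, (i <= j)%N -> a j <= a i).
  by move=> i j ij; rewrite lef_pV2 ?posrE ?ltr0n // ler_nat ltnS.
have hb : (forall i j, (i <= j)%N -> b i <= b j).
  by move=> i j ij; rewrite ler_nat ltnS.
have exh (x : R) : 0 < x -> exists k, a k <= x <= b k.
  move=> x0.
  have [k1 h1] : exists k : nat, x < k%:R by exists (Num.bound x); exact: archi_boundP (ltW x0).
  have xi : 0 <= x^-1 by rewrite invr_ge0 ltW.
  have [k2 h2] : exists k : nat, x^-1 < k%:R by exists (Num.bound x^-1); exact: archi_boundP.
  exists (maxn k1 k2); apply/andP; split.
    rewrite -[x]invrK lef_pV2 ?posrE ?invr_gt0 ?ltr0n //.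
    by apply: (le_trans (ltW h2)); rewrite ler_nat leqW // leq_maxr.
  by apply: (le_trans (ltW h1)); rewrite ler_nat leqW // leq_maxl.
have rootK (x : R) : 0 <= x -> (x ^+ n) `^ n%:R^-1 = x.
  by move=> x0; rewrite -powR_mulrn // -powRrM mulfV ?powRr1 // gt_eqF.
have cG : continuous_pos G.
  move=> x x0; apply: continuousM; first exact: continuous_pos_powR.
  apply: continuousM; last exact: cst_continuous.
  apply: (@continuous_comp _ _ _ (fun x => x `^ n%:R^-1) rho).
    exact: continuous_pos_powR.
  by apply: crho; rewrite powR_gt0.
have G0 (x : R) : 0 < x -> 0 <= G x.
  by move=> x0; rewrite mulr_ge0 ?powR_ge0 // divr_ge0 ?rho0 ?powR_gt0 // ltW.
pose H (x : R) := x `^ ((n * p)%:R - 1) * rho x.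
have cH : continuous_pos H.
  by move=> x x0; apply: continuousM; [exact: continuous_pos_powR|exact: crho].
have H0 (x : R) : 0 < x -> 0 <= H x.
  by move=> x0; rewrite mulr_ge0 ?powR_ge0 // rho0.
have lim1 := @exhaust_pos_integral G (F \o a) (F \o b) cG G0.
have lim2 := @exhaust_pos_integral H a b cH H0 a0 ha hb exh.
have {}lim1 : (\int[mu]_(x in `[F (a k), F (b k)]) (G x)%:E)%E @[k --> \oo] -->
  (\int[mu]_(x in `]0%R, +oo[) (G x)%:E)%E.
  apply: lim1.
  - by move=> k; rewrite /= exprn_gt0.
  - by move=> i j ij; apply: hle; [exact: ltW|exact: ha].
  - by move=> i j ij; apply: hle; [exact: ltW|exact: hb].
  move=> x x0; have [k /andP[h1 h2]] := exh (x `^ n%:R^-1) (powR_gt0 _ x0).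
  have xE : F (x `^ n%:R^-1) = x.
    by rewrite /F -powR_mulrn ?powR_ge0 // -powRrM mulVf ?powRr1 ?gt_eqF // ltW.
  by exists k; rewrite -xE /= !hle ?powR_ge0 // ltW.
apply: (cvg_unique _ lim1); first exact: ereal_hausdorff.
suff -> : (fun k => \int[mu]_(x in `[F (a k), F (b k)]) (G x)%:E)%E =
   (fun k => \int[mu]_(x in `[a k, b k]) (H x)%:E)%E by exact: lim2.
apply/funext => k.
have dF (x : R) : derivable F x 1 by exact: exprn_derivable.
have F'E (x : R) : F^`()%classic x = n%:R * x ^+ n.-1.
  exact: exp_derive1.
have cF' : continuous (F^`()%classic).
  move=> x; rewrite (_ : F^`()%classic = fun x => n%:R * x ^+ n.-1).
    exact: (cvgM (cvg_cst _) (@exprn_continuous R n.-1 x)).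
  by apply/funext => y; rewrite F'E.
have cF : continuous F by move=> x; exact: exprn_continuous.
rewrite integration_by_substitution_increasing.
- apply: eq_integral => x; rewrite inE /= in_itv /= => /andP[h1 h2].
  have x0 : 0 < x by exact: lt_le_trans h1.
  congr EFin; rewrite -[LHS]/(G (F x) * F^`()%classic x) F'E /G /H /F rootK ?(ltW x0) //.
  have -> : (x ^+ n) `^ (p%:R - 1) = x `^ ((n * p)%:R - n%:R).
    by rewrite -powR_mulrn ?(ltW x0) // -powRrM mulrBr mulr1 natrM.
  have -> : (n * p)%:R - 1 = ((n * p)%:R - n%:R) + n.-1%:R :> R.
    by rewrite -[in n%:R](prednK n0) -natr1; ring.
  rewrite [in RHS]powRD ?(gt_eqF x0) ?implybT // powR_mulrn ?(ltW x0) //.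
  by field; rewrite gt_eqF.
- apply: (le_trans (ha 0%N k (leq0n k))); apply: le_trans (hb 0%N k (leq0n k)).
  by rewrite /a /b invr1.
- move=> x y; rewrite !in_itv /= => /andP[h1 _] _; apply: homF.
  exact: le_trans (ltW (a0 k)) h1.
- by move=> x _; exact: cF'.
- by apply/cvg_ex; exists (F^`()%classic (a k)); apply: cvg_at_right_filter; exact: cF'.
- by apply/cvg_ex; exists (F^`()%classic (b k)); apply: cvg_at_left_filter; exact: cF'.
- split; first by move=> x _; exact: dF.
  + by apply: cvg_at_right_filter; exact: cF.
  + by apply: cvg_at_left_filter; exact: cF.
- apply: continuous_in_subspaceT => x; rewrite inE /= in_itv /= => /andP[h _].
  by apply: cG; apply: lt_le_trans h; rewrite exprn_gt0.
Qed.

End PositiveAxis.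

(** * Integrals with exponential decay *)

Section DecayIntegrals.
Variable R : realType.
Notation mu := (@lebesgue_measure R).

(** With y = x c / q, the claim y^q <= e^(q y) is ln y <= y. *)
Lemma powR_mul_expR_le (q c x : R) : 0 <= q -> 0 < c -> 0 < x ->
  x `^ q * expR (- (c * x)) <= (q / c) `^ q.
Proof.
move=> q0 c0 x0; have [->|qn0] := eqVneq q 0.
  by rewrite !powRr0 mul1r -expR0 ler_expR oppr_le0 mulr_ge0 // ltW.
have q1 : 0 < q by rewrite lt_neqAle eq_sym qn0.
rewrite expRN ler_pdivrMr ?expR_gt0 //.
have y0 : 0 < x * c / q by rewrite divr_gt0 // mulr_gt0.
have {1}-> : x = (q / c) * (x * c / q) by field; rewrite !gt_eqF.
rewrite powRM ?(ltW y0) ?divr_ge0 // ?(ltW c0) // ler_pM2l ?powR_gt0 ?divr_gt0 //.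
rewrite /powR gt_eqF // ler_expR.
apply: (@le_trans _ _ (q * (x * c / q))); first by rewrite ler_pM2l // ltW // ln_sublinear.
by rewrite le_eqVlt; apply/orP; left; apply/eqP; field; rewrite gt_eqF.
Qed.

Lemma powR_mul_decay_le (q c k x : R) : 0 <= q -> 0 < c -> 0 < k -> 0 < x ->
  x `^ q * expR (- (c * x `^ k)) <= (q / k / c) `^ (q / k).
Proof.
move=> q0 c0 k0 x0.
have {1}-> : q = k * (q / k) by field; rewrite gt_eqF.
rewrite powRrM; apply: powR_mul_expR_le => //; last exact: powR_gt0.
by rewrite divr_ge0 // ltW.
Qed.

Lemma pos_integral_le (f : R -> R) (K : R) : continuous_pos f ->
  (forall x, 0 < x -> 0 <= f x) -> 0 <= K ->
  (forall x, 0 < x -> f x * (1 + x ^+ 2) <= K) ->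
  (\int[mu]_(x in `]0%R, +oo[) (f x)%:E <= (K * (pi / 2))%:E)%E.
Proof.
move=> cf f0 K0 fK.
have mpos : measurable (`]0, +oo[ : set R) by exact: measurable_itv.
pose g (x : R) := (oneDsqr x)^-1.
have cg : continuous g by exact: continuous_oneDsqrV.
have g0 (x : R) : 0 <= g x by rewrite invr_ge0; apply: addr_ge0 => //; exact: sqr_ge0.
have mg : measurable_fun (`]0, +oo[ : set R) g.
  by apply: continuous_pos_measurable => x _; exact: cg.
apply: (@le_trans _ _ (\int[mu]_(x in `]0%R, +oo[) (K%:E * (g x)%:E))%E).
  apply: ge0_le_integral => //.
  - by move=> x /=; rewrite in_itv /= andbT => x0; rewrite lee_fin f0.
  - by apply/measurable_EFinP; exact: continuous_pos_measurable.
  - by apply/measurable_EFinP; apply: measurable_funM => //; exact: measurable_cst.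
  - move=> x /=; rewrite in_itv /= andbT => x0; rewrite -EFinM lee_fin.
    rewrite /g ler_pdivlMr ?fK // /oneDsqr ltr_wpDr ?sqr_ge0 //.
rewrite ge0_integralZl_EFin //; last 2 first.
- by move=> x _; rewrite lee_fin.
- by apply/measurable_EFinP.
rewrite integral_itv_obnd_cbnd; last by apply/measurable_EFinP.
by rewrite integral0y_oneDsqr EFinM.
Qed.

Lemma pos_Rintegral_le (f : R -> R) (K : R) : continuous_pos f ->
  (forall x, 0 < x -> 0 <= f x) -> 0 <= K ->
  (forall x, 0 < x -> f x * (1 + x ^+ 2) <= K) ->
  \int[mu]_(x in `]0%R, +oo[) f x <= K * (pi / 2).
Proof.
move=> cf f0 K0 fK; have h := pos_integral_le cf f0 K0 fK.
rewrite /Rintegral -lee_fin fineK // ge0_fin_numE ?(le_lt_trans h) ?ltry //.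
by apply: integral_ge0 => x /=; rewrite in_itv /= andbT => x0; rewrite lee_fin f0.
Qed.

(** The integral is finite, hence not truncated to 0, and it is at least the
    minimum of f over [1, 2]. *)
Lemma pos_Rintegral_gt0 (f : R -> R) (K : R) : continuous_pos f ->
  (forall x, 0 < x -> 0 < f x) -> 0 <= K ->
  (forall x, 0 < x -> f x * (1 + x ^+ 2) <= K) ->
  0 < \int[mu]_(x in `]0%R, +oo[) f x.
Proof.
move=> cf f0 K0 fK; have h := pos_integral_le cf (fun x x0 => ltW (f0 x x0)) K0 fK.
have [c c12 hc] : exists2 c, c \in `[1%R, 2%R] & forall t, t \in `[1, 2] -> f c <= f t.
  apply: EVT_min; first lra.
  apply: continuous_in_subspaceT => x; rewrite inE /= in_itv /= => /andP[x1 _].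
  by apply: cf; lra.
have fc0 : 0 < f c by apply: f0; move: c12; rewrite in_itv /= => /andP[? _]; lra.
have f_ge0 : (0 <= \int[mu]_(x in `]0%R, +oo[) (f x)%:E)%E.
  by apply: integral_ge0 => x /=; rewrite in_itv /= andbT => x0; rewrite lee_fin ltW ?f0.
rewrite /Rintegral -lte_fin fineK; last by rewrite ge0_fin_numE ?(le_lt_trans h) ?ltry.
have mf : measurable_fun (`]0, +oo[ : set R) (EFin \o f).
  by apply/measurable_EFinP; exact: continuous_pos_measurable.
have sub : `[1%R, 2%R] `<=` (`]0%R, +oo[ : set R).
  by move=> x /=; rewrite !in_itv /= andbT => /andP[? _]; lra.
apply: (@lt_le_trans _ _ (\int[mu]_(x in `[1%R, 2%R]) (f x)%:E)%E); last first.
  apply: ge0_subset_integral => //.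
  by move=> x /=; rewrite in_itv /= andbT => x0; rewrite lee_fin ltW ?f0.
apply: (@lt_le_trans _ _ (\int[mu]_(x in `[1%R, 2%R]) (f c)%:E)%E).
  rewrite integral_cst //= lebesgue_measure_itv /= lte_fin.
  by rewrite (_ : (1 < 2 :> R)) ?ltr1n // -EFinD -EFinM lte_fin mulr_gt0 //; lra.
apply: ge0_le_integral => //.
- by move=> x _; rewrite lee_fin ltW.
- by apply: measurable_funS mf; [exact: measurable_itv|exact: sub].
Qed.

(** The factor 1 + x^2 makes the bound integrable against (1 + x^2)^-1; half
    of the exponential pays for it, the other half for the power. *)
Lemma powR_decay_weight_le (q c k x : R) : 0 <= q -> 0 < c -> 0 < k -> 0 < x ->
  x `^ q * expR (- (c * x `^ k)) * (1 + x ^+ 2) <=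
  (q / k / (c / 2)) `^ (q / k) * (1 + (2 / k / (c / 2)) `^ (2 / k)).
Proof.
move=> q0 c0 k0 x0; have c20 : 0 < c / 2 by lra.
have -> : expR (- (c * x `^ k)) =
    expR (- (c / 2 * x `^ k)) * expR (- (c / 2 * x `^ k)).
  by rewrite -expRD; congr expR; field.
rewrite mulrA -mulrA; apply: ler_pM => //.
- by rewrite mulr_ge0 ?powR_ge0 ?expR_ge0.
- by rewrite mulr_ge0 ?expR_ge0 ?addr_ge0 ?sqr_ge0.
- exact: powR_mul_decay_le.
rewrite mulrDr mulr1 lerD //.
  by rewrite expR_le1 oppr_le0 mulr_ge0 ?powR_ge0 // ltW.
by rewrite mulrC -powR_mulrn ?(ltW x0) //; apply: powR_mul_decay_le.
Qed.

Lemma Gamma_le : exists2 C : R, 0 < C &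
  forall x : R, 0 <= x -> Gamma (1 + x) <= C * (2 * x) `^ x.
Proof.
exists ((1 + (2 / 1 / (1 / 2)) `^ (2 / 1)) * (pi / 2)).
  by rewrite mulr_gt0 ?divr_gt0 ?pi_gt0 // ltr_wpDr ?powR_ge0.
move=> x x0; rewrite /Gamma.
have E (t : R) : t `^ (1 + x - 1) * expR (- t) = t `^ x * expR (- (1 * t)).
  by rewrite addrAC subrr add0r mul1r.
under eq_Rintegral do rewrite E.
rewrite [leRHS]mulrC [leRHS]mulrA; apply: pos_Rintegral_le.
- move=> t t0; apply: continuousM; first exact: continuous_pos_powR.
  apply: continuous_comp; last exact: continuous_expR.
  by apply: continuousN; apply: cvgM; [exact: cvg_cst|exact: cvg_id].
- by move=> t t0; rewrite mulr_ge0 ?powR_ge0 ?expR_ge0.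
- by rewrite mulr_ge0 ?powR_ge0 // addr_ge0 ?powR_ge0.
move=> t t0.
have := powR_decay_weight_le x0 ltr01 ltr01 t0.
by rewrite powRr1 ?(ltW t0) // !divr1 (_ : x / (1 / 2) = 2 * x) //; field.
Qed.

End DecayIntegrals.

(** * Two-sided bounds for moment functions *)

Section MomentBounds.
Variable R : realType.
Notation mu := (@lebesgue_measure R).

Lemma mellin_real (e : R -> Cplx R) (r : R -> R) (q : nat) :
  (forall x, 0 < x -> e x = ofR (r x)) ->
  mellin e q%:R = ofR (\int[mu]_(x in `]0%R, +oo[) (x `^ (q%:R - 1) * r x)).
Proof.
move=> er; rewrite /mellin /ofR.
have qR : (q%:R - 1 : Cplx R) = ofR (q%:R - 1) by rewrite /ofR rmorphB rmorph_nat.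
have E (x : R) : x \in `]0%R, +oo[%classic ->
    cpow x (q%:R - 1) * e x = ofR (x `^ (q%:R - 1) * r x).
  rewrite inE /= in_itv /= andbT => x0; rewrite er // ofRM; congr (_ * _).
  by rewrite /cpow qR /= mul0r /polar cos0 sin0 mulr0 mulr1.
congr Complex.
  by apply: eq_Rintegral => x /E ->.
rewrite (@eq_Rintegral _ _ _ _ _ (fun=> 0)); last by move=> x /E ->.
by rewrite /Rintegral integral0.
Qed.

Definition profile (e : Cplx R -> Cplx R) (x : R) : R := complex.Re (e (ofR x)).

Definition real_moment (r : R -> R) (q : nat) : R :=
  \int[mu]_(x in `]0%R, +oo[) (x `^ (q%:R - 1) * r x).

Section KernelPair.
Variables (k : R) (e E m : Cplx R -> Cplx R).
Hypothesis H : kernel_pair k e E m.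

Let rho := profile e.
Let nu := real_moment rho.

Let k0 : 0 < k.
Proof. by apply: lt_trans (kernel_order H); rewrite invr_gt0. Qed.

Lemma profileE x : 0 < x -> e (ofR x) = ofR (profile e x).
Proof.
by move=> x0; rewrite /profile /ofR RRe_real // gtr0_real // (kernel_pos H).
Qed.

Lemma profile_gt0 x : 0 < x -> 0 < profile e x.
Proof. by move=> x0; rewrite -ltr_ofR -profileE // (kernel_pos H). Qed.

Lemma positive_in_sector (a x : R) : 0 < a -> 0 < x -> sector 0 a (ofR x).
Proof.
move=> a0 x0; exists x, 0; split=> //; first by apply/andP; split; lra.
by rewrite /polar cos0 sin0 mulr1 mulr0.
Qed.

Lemma profile_continuous : continuous_pos (profile e).
Proof.
move=> x x0.
have [D hD] := derivable_cderiv_at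
  (kernel_holo H (positive_in_sector (divr_gt0 (pi_gt0 R) k0) x0)).
have [d d0 hd] := hD 1 ltr01.
apply/cvgrPdist_lt => eps eps0.
have M0 : 0 < 1 + cmod D by rewrite ltr_wpDr ?cmod_ge0.
have min0 : 0 < Num.min d (eps / (1 + cmod D)) by rewrite lt_min d0 divr_gt0.
exists (Num.min d (eps / (1 + cmod D))) => //= y; rewrite /ball_ /= distrC => hy.
have oE : ofR y - ofR x = ofR (y - x) :> Cplx R by rewrite /ofR rmorphB.
move: hy; rewrite lt_min => /andP[y1 y2].
have := hd (ofR y); rewrite oE cmod_ofR => /(_ y1) h1.
rewrite distrC /profile -ReB; apply: (le_lt_trans (Re_le_cmod _)).
rewrite -[_ - _](subrK (D * ofR (y - x))).
apply: (le_lt_trans (cmodD _ _)); rewrite cmodM cmod_ofR.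
move: y2; rewrite ltr_pdivlMr // => y2; lra.
Qed.

Lemma profile_decay : exists A c : R, [/\ 0 < A, 0 < c &
  forall x, 0 < x -> profile e x <= A * expR (- (c * x `^ k))].
Proof.
have a0 : 0 < pi / k / 2 by rewrite !divr_gt0 ?pi_gt0.
have [A [B [A0 B0 hAB]]] := kernel_decay H a0.
exists A, (B^-1 `^ k); split => //; first by rewrite powR_gt0 // invr_gt0.
move=> x x0.
have sx : sector 0 (pi / k - pi / k / 2) (ofR x).
  by apply: positive_in_sector => //; lra.
have := hAB _ sx; rewrite profileE // !cmod_ofR (gtr0_norm x0).
rewrite ger0_norm; last exact/ltW/profile_gt0.
have xB : (x / B) `^ k = B^-1 `^ k * x `^ k.
  by rewrite mulrC powRM //; [rewrite invr_ge0; exact: ltW|exact: ltW].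
by rewrite xB => h; exact: h.
Qed.

Lemma moment_nat q : m q%:R = ofR (nu q).
Proof.
rewrite (kernel_moment H); last by rewrite -(rmorph_nat (real_complex R)) /= ler0n.
by apply: mellin_real => x x0; exact: profileE.
Qed.

Lemma real_moment0 : nu 0 = 1.
Proof. by have := moment_nat 0; rewrite (kernel_normalized H) => /esym /ofR_inj. Qed.

Let integrand q x := x `^ (q%:R - 1) * rho x.

Lemma integrand_continuous q : continuous_pos (integrand q).
Proof.
move=> x x0; apply: continuousM; first exact: continuous_pos_powR.
exact: profile_continuous.
Qed.

Lemma integrand_gt0 q x : 0 < x -> 0 < integrand q x.
Proof. by move=> x0; rewrite mulr_gt0 ?powR_gt0 ?profile_gt0. Qed.

(** For q > 0 the exponent q - 1 is nonnegative and the decay of the kernel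
    along the positive axis suffices. *)
Lemma integrand_weight_le : exists C D : R, [/\ 1 <= C, 1 <= D &
  forall q, (0 < q)%N -> forall x, 0 < x ->
   integrand q x * (1 + x ^+ 2) <= C * D ^+ q * q%:R `^ (q%:R / k)].
Proof.
have [A [c [A0 c0 hA]]] := profile_decay.
set C1 := 1 + (2 / k / (c / 2)) `^ (2 / k).
have C10 : 1 <= C1 by rewrite lerDl powR_ge0.
pose w := (k * (c / 2))^-1.
have w0 : 0 < w by rewrite invr_gt0 !mulr_gt0 ?invr_gt0.
pose D := 1 + w `^ k^-1.
have D1 : 1 <= D by rewrite lerDl powR_ge0.
exists (1 + A * C1), D; split=> //.
  by rewrite lerDl mulr_ge0 ?(ltW A0) //; lra.
move=> q q0 x x0.
have q1 : 0 <= q%:R - 1 :> R by rewrite subr_ge0 ler1n.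
have qR : 0 < q%:R :> R by rewrite ltr0n.
have step : integrand q x * (1 + x ^+ 2) <=
    A * (x `^ (q%:R - 1) * expR (- (c * x `^ k)) * (1 + x ^+ 2)).
  rewrite mulrA ler_wpM2r ?addr_ge0 ?sqr_ge0 // /integrand mulrCA.
  by rewrite ler_wpM2l ?powR_ge0 // hA.
apply: (le_trans step).
have := powR_decay_weight_le q1 c0 k0 x0; rewrite -/C1 => h.
have h2 : ((q%:R - 1) / k / (c / 2)) `^ ((q%:R - 1) / k) <= D ^+ q * q%:R `^ (q%:R / k).
  have -> : (q%:R - 1) / k / (c / 2) = w * (q%:R - 1).
    by rewrite /w; field; rewrite !gt_eqF.
  rewrite powRM ?(ltW w0) //; apply: ler_pM; rewrite ?powR_ge0 //.
    apply: (@le_trans _ _ (D `^ (q%:R - 1))).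
      rewrite [(q%:R - 1) / k]mulrC powRrM; apply: ge0_ler_powR => //.
      - by rewrite nnegrE powR_ge0.
      - by rewrite nnegrE; lra.
      - by rewrite /D lerDr.
    by rewrite -powR_mulrn; [apply: ler_powR; lra|lra].
  apply: (@le_trans _ _ (q%:R `^ ((q%:R - 1) / k))).
    apply: ge0_ler_powR; rewrite ?nnegrE ?divr_ge0 ?(ltW k0) //; lra.
  by apply: ler_powR; [rewrite ler1n|rewrite ler_pM2r ?invr_gt0 //; lra].
apply: (@le_trans _ _ (A * ((D ^+ q * q%:R `^ (q%:R / k)) * C1))).
  rewrite ler_pM2l //; apply: (le_trans h); rewrite ler_wpM2r //; lra.
rewrite -[leRHS]mulrA -subr_ge0; set Q := D ^+ q * _.
have -> : (1 + A * C1) * Q - A * (Q * C1) = Q by ring.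
by rewrite mulr_ge0 ?powR_ge0 // exprn_ge0 //; lra.
Qed.

Lemma real_moment_gt0 q : 0 < nu q.
Proof.
have [->|] := posnP q; first by rewrite real_moment0.
move=> q0; have [C [D [C1 D1 h]]] := integrand_weight_le.
apply: (@pos_Rintegral_gt0 _ (integrand q) (C * D ^+ q * q%:R `^ (q%:R / k))).
- exact: integrand_continuous.
- exact: integrand_gt0.
- by rewrite !mulr_ge0 ?powR_ge0 ?exprn_ge0 //; lra.
- exact: h.
Qed.

Lemma real_moment_le : exists C D : R, [/\ 0 < C, 0 < D &
  forall q, nu q <= C * D ^+ q * q%:R `^ (q%:R / k)].
Proof.
have [C [D [C1 D1 h]]] := integrand_weight_le.
exists (C * (1 + pi / 2)), D; split; try lra.
  by rewrite mulr_gt0 //; [lra|rewrite ltr_wpDr // divr_ge0 ?pi_ge0].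
move=> q; have [->|] := posnP q.
  rewrite real_moment0 expr0 mul0r powRr0 !mulr1 -[leLHS]mulr1 ler_pM //.
  by rewrite lerDl divr_ge0 // pi_ge0.
move=> q0.
have K0 : 0 <= C * D ^+ q * q%:R `^ (q%:R / k).
  by rewrite !mulr_ge0 ?powR_ge0 ?exprn_ge0 //; lra.
have := @pos_Rintegral_le _ (integrand q) _ (@integrand_continuous q)
   (fun x x0 => ltW (@integrand_gt0 q x x0)) K0 (h q q0).
move=> h2; apply: (le_trans h2).
set K := C * _ * _ in K0 *.
have -> : C * (1 + pi / 2) * D ^+ q * q%:R `^ (q%:R / k) = K + K * (pi / 2).
  by rewrite /K; ring.
by rewrite lerDr.
Qed.

(** All coefficients 1 / m(q) of E are positive, so each term r^q / m(q) is at
    most E(r). The growth of E at r = q^(1/k) then gives the bound. *)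
Lemma real_moment_ge : exists c d : R, [/\ 0 < c, 0 < d &
  forall q, c * d ^+ q * q%:R `^ (q%:R / k) <= nu q].
Proof.
have [A [B [A0 B0 hE]]] := cokernel_growth H.
have key (r : R) q : 0 <= r -> r ^+ q / nu q <= A * expR (B * r `^ k).
  move=> r0; have := hE (ofR r); rewrite cmod_ofR (ger0_norm r0).
  move=> hEr; apply: le_trans hEr.
  apply/ler_addgt0Pr => eps eps0.
  have /cvgn_cplxP /(_ eps eps0)[n0 hn] := @cokernel_series _ _ _ _ _ H (ofR r).
  have {}hn := hn (maxn n0 q.+1) (leq_maxl _ _).
  set n := maxn n0 q.+1 in hn.
  have t0 i : 0 <= r ^+ i / nu i by rewrite divr_ge0 ?exprn_ge0 // ltW ?real_moment_gt0.
  have sE : series (fun n => ofR r ^+ n / m n%:R) n = ofR (\sum_(i < n) r ^+ i / nu i).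
    rewrite seriesEnat /= big_mkord [RHS]/ofR rmorph_sum; apply: eq_bigr => i _.
    by rewrite moment_nat /= rmorphM fmorphV rmorphXn.
  rewrite sE in hn.
  have qn : (q < n)%N by rewrite leq_max leqnn orbT.
  apply: (@le_trans _ _ (\sum_(i < n) r ^+ i / nu i)).
    by rewrite (bigD1 (Ordinal qn)) //= lerDl sumr_ge0.
  rewrite -[leLHS]ger0_norm ?sumr_ge0 // -cmod_ofR.
  rewrite -[ofR _](subrK (E (ofR r))) (le_trans (cmodD _ _)) //.
  by rewrite addrC lerD2l ltW.
exists (Num.min 1 A^-1), (expR (- B)); split.
- by rewrite lt_min ltr01 invr_gt0.
- exact: expR_gt0.
move=> q; have [->|q0] := posnP q.
  by rewrite expr0 mul0r powRr0 !mulr1 real_moment0 ge_min lexx.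
have qR : 0 < q%:R :> R by rewrite ltr0n.
have := key (q%:R `^ k^-1) q (powR_ge0 _ _).
rewrite -powRrM mulVf ?gt_eqF // powRr1 ?(ltW qR) //.
rewrite -powR_mulrn ?powR_ge0 // -powRrM [k^-1 * _]mulrC.
rewrite ler_pdivrMr ?real_moment_gt0 // => h.
apply: (@le_trans _ _ (A^-1 * expR (- B) ^+ q * q%:R `^ (q%:R / k))).
  by rewrite !ler_wpM2r ?powR_ge0 ?exprn_ge0 ?expR_ge0 // ge_min lexx orbT.
apply: (@le_trans _ _ (A^-1 * expR (- B) ^+ q * (A * expR (B * q%:R) * nu q))).
  by rewrite ler_wpM2l // mulr_ge0 ?exprn_ge0 ?expR_ge0 ?invr_ge0 // ltW.
rewrite expRM_natr expRN exprVn.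
rewrite le_eqVlt; apply/orP; left; apply/eqP; field.
by rewrite expf_neq0 ?gt_eqF ?expR_gt0.
Qed.

End KernelPair.

(** By the substitution x = y^n, m(p) is the (n p)-th moment of a kernel of order
    n / s, whose bounds involve (n p)^(s p) = (n^s)^p p^(s p). *)
Lemma moment_function_bounds (s : R) (m : Cplx R -> Cplx R) :
  0 < s -> moment_function s m ->
  exists mr : nat -> R, [/\ forall n, m n%:R = ofR (mr n), forall n, 0 < mr n,
    exists C D : R, [/\ 0 < C, 0 < D &
      forall n, mr n <= C * D ^+ n * n%:R `^ (s * n%:R)] &
    exists c d : R, [/\ 0 < c, 0 < d &
      forall n, c * d ^+ n * n%:R `^ (s * n%:R) <= mr n]].
Proof.
move=> s0 [n [e [E [m' [n0 H hm]]]]].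
have nR : 0 < n%:R :> R by rewrite ltr0n.
pose nu := real_moment (profile e).
have mE p : m p%:R = ofR (nu (n * p)%N).
  rewrite hm; last by rewrite -(rmorph_nat (real_complex R)) /= ler0n.
  rewrite (@mellin_real _ (fun x => profile e (x `^ n%:R^-1) / n%:R)); last first.
    move=> x x0; rewrite (profileE H) ?powR_gt0 // /ofR rmorphM fmorphV /=.
    by rewrite rmorph_nat.
  congr ofR; rewrite /nu /real_moment /Rintegral integral_root_substitution //.
    exact: profile_continuous H.
  by move=> x x0; exact/ltW/(profile_gt0 H).
have expE p : (n * p)%:R `^ ((n * p)%:R / (n%:R * s^-1)) =
    (n%:R `^ s) ^+ p * p%:R `^ (s * p%:R) :> R.
  have -> : (n * p)%:R / (n%:R * s^-1) = s * p%:R.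
    by rewrite natrM; field; rewrite !gt_eqF.
  by rewrite natrM powRM // -powR_mulrn ?powR_ge0 // -powRrM.
exists (fun p => nu (n * p)%N); split => //.
- by move=> p; exact: real_moment_gt0 H _.
- have [C [D [C0 D0 h]]] := real_moment_le H.
  exists C, (D ^+ n * n%:R `^ s); split => //.
    by rewrite mulr_gt0 ?exprn_gt0 ?powR_gt0.
  move=> p; apply: (le_trans (h _)); rewrite expE exprMn exprM !mulrA.
  exact: lexx.
- have [c [d [c0 d0 h]]] := real_moment_ge H.
  exists c, (d ^+ n * n%:R `^ s); split => //.
    by rewrite mulr_gt0 ?exprn_gt0 ?powR_gt0.
  move=> p; apply: le_trans (h _); rewrite expE exprMn exprM !mulrA.
  exact: lexx.
Qed.

End MomentBounds.

(** * Summation of geometrically bounded power series *)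

Section GeometricSeries.
Variables (R : realType) (N : nat).
Implicit Types (b : midx N) (c : zseries R N).

Lemma sum_box_half n : \sum_(b <- box N n) (2^-1 : R) ^+ mdeg b <= 2 ^+ N.
Proof.
have -> : \sum_(b <- box N n) (2^-1 : R) ^+ mdeg b =
    \sum_(f : {ffun 'I_N -> 'I_n}) \prod_(i < N) (2^-1 : R) ^+ val (f i).
  rewrite (perm_big [seq midx_of_ord f | f : {ffun 'I_N -> 'I_n}]) /=.
    rewrite big_map big_enum /=; apply: eq_bigr => f _.
    rewrite /mdeg -prodrXr; apply: eq_bigr => i _.
    by rewrite ffunE.
  apply: uniq_perm; first exact: fset_uniq.
    rewrite map_inj_uniq ?enum_uniq // => f g /ffunP fg.
    by apply/ffunP => i; apply: val_inj; have := fg i; rewrite !ffunE.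
  by move=> b; rewrite !inE.
rewrite -(bigA_distr_bigA (fun (i : 'I_N) (j : 'I_n) => (2^-1 : R) ^+ j)) /=.
apply: (@le_trans _ _ (\prod_(i < N) 2)); last by rewrite prodr_const card_ord.
apply: ler_prod => i _; rewrite sumr_ge0 /=; last by move=> j _; rewrite exprn_ge0.
have := subrX1 (2^-1 : R) n.
have : 0 <= (2^-1 : R) ^+ n by rewrite exprn_ge0.
set q := (_ ^+ n); set w := \sum_(j < n) _; lra.
Qed.

Lemma sum_fset_half (A : {fset midx N}) : \sum_(b <- A) (2^-1 : R) ^+ mdeg b <= 2 ^+ N.
Proof.
pose n := (\sum_(b <- A) (mdeg b).+1)%N.
apply: le_trans (sum_box_half n).
have sub : (A `<=` box N n)%fset.
  apply/fsubsetP => b bA; apply: mdeg_box.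
  by rewrite /n (big_fsetD1 b bA) leq_addr.
rewrite [leRHS](big_fsetID _ (mem A)) /=.
rewrite [X in _ <= X + _](_ : _ = \sum_(b <- A) (2^-1 : R) ^+ mdeg b).
  by rewrite lerDl sumr_ge0 // => b _; rewrite exprn_ge0.
apply: eq_fbig => // b; rewrite in_fset /= inE /=.
by apply: andb_idl => /(fsubsetP sub).
Qed.

(** Since 1/4 = 1/2 * 1/2, a family of indices of degree at least n gains
    (1/2)^n over a sum that stays bounded. *)
Lemma sum_tail_quarter (A : {fset midx N}) n :
  (forall b, b \in A -> (n <= mdeg b)%N) ->
  \sum_(b <- A) (4^-1 : R) ^+ mdeg b <= 2^-1 ^+ n * 2 ^+ N.
Proof.
move=> hA.
apply: (@le_trans _ _ (\sum_(b <- A) 2^-1 ^+ n * (2^-1 : R) ^+ mdeg b)).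
  rewrite big_seq [leRHS]big_seq; apply: ler_sum => b bA.
  have -> : (4^-1 : R) = 2^-1 * 2^-1 by lra.
  rewrite exprMn ler_wpM2r ?exprn_ge0 //.
  by apply: ler_wiXn2l; [lra|lra|exact: hA].
by rewrite -mulr_sumr ler_wpM2l ?exprn_ge0 ?sum_fset_half.
Qed.

Lemma real_cauchy_limit (u : nat -> R) (e : nat -> R) : e @ \oo --> (0 : R) ->
  (forall n m, (n <= m)%N -> `|u m - u n| <= e n) ->
  exists l, forall n, `|l - u n| <= e n.
Proof.
move=> /cvgrPdist_lt e0 hu.
have cu : cvg (u @ \oo).
  apply/cauchy_cvgP/cauchy_exP => eps eps0.
  have [n _ /(_ n (leqnn n)) /=] := e0 eps eps0.
  rewrite sub0r normrN => hn; exists (u n); exists n => // m /= nm.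
  rewrite /ball /= distrC; apply: le_lt_trans (hu n m nm) _.
  exact: le_lt_trans (ler_norm _) hn.
have [l hl] := (cvg_ex _).1 cu; exists l => n.
apply/ler_addgt0Pr => eps eps0.
have /cvgrPdist_lt /(_ eps eps0)[n0 _ hn] := hl.
have {}hn := hn (maxn n n0) (leq_maxr _ _).
have := hu n (maxn n n0) (leq_maxl _ _).
set v := u (maxn n n0) in hn * => h.
rewrite (_ : l - u n = (v - u n) + (l - v)); last by ring.
apply: (le_trans (ler_normD _ _)); apply: lerD => //; exact: ltW.
Qed.

(** Unconditional sums are obtained as limits over the boxes, with an error
    that any larger finite set of indices obeys as well. *)
Lemma geometric_zseries_sum c (B K r : R) : 0 <= B -> 0 <= K -> 0 <= r ->
  K * r <= 4^-1 -> (forall b, cmod (c b) <= B * K ^+ mdeg b) ->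
  exists U : 'rV[Cplx R]_N -> Cplx R,
    (forall z, polydisc r z -> zseries_sum c z (U z)) /\
    (sup_norm r U <= (B * 2 ^+ N)%:E)%E.
Proof.
move=> B0 K0 r0 Kr hc.
suff main z : exists l, polydisc r z -> zseries_sum c z l /\ cmod l <= B * 2 ^+ N.
  have [U hU] := choice main; exists U; split=> [z /hU[]//|].
  by apply: ge_ereal_sup => _ [z zr <-]; rewrite lee_fin; case: (hU z zr).
have [zr|] := pselect (polydisc r z); last by move=> nz; exists 0.
pose t b := c b * zmonom z b.
have tb b : cmod (t b) <= B * (4^-1) ^+ mdeg b.
  rewrite /t cmodM /zmonom cmod_prod.
  apply: (@le_trans _ _ (B * K ^+ mdeg b * r ^+ mdeg b)).
    apply: ler_pM; [exact: cmod_ge0| |exact: hc|].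
      by apply: prodr_ge0 => i _; exact: cmod_ge0.
    rewrite /mdeg -prodrXr; apply: ler_prod => i _.
    by rewrite cmod_ge0 cmodX lerXn2r ?nnegrE ?cmod_ge0 // ltW.
  rewrite -mulrA -exprMn ler_wpM2l // lerXn2r ?nnegrE ?mulr_ge0 //.
pose e n : R := B * (2^-1 ^+ n * 2 ^+ N).
have e0 n : 0 <= e n by rewrite !mulr_ge0 ?exprn_ge0.
have tail (A : {fset midx N}) n : (box N n `<=` A)%fset ->
    cmod (\sum_(b <- A) t b - \sum_(b <- box N n) t b) <= e n.
  move=> /fsubsetP sub.
  rewrite (big_fsetID _ (mem (box N n))) /=.
  rewrite [X in X + _ - _](_ : _ = \sum_(b <- box N n) t b); last first.
    apply: eq_fbig => // b; rewrite in_fset /= inE /=.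
    by apply: andb_idl => /sub.
  rewrite addrAC subrr add0r; apply: (le_trans (cmod_sum _ _ _)).
  set A' := [fset _ | _ in _ & _]%fset.
  apply: (@le_trans _ _ (\sum_(b <- A') B * (4^-1) ^+ mdeg b)); first exact: ler_sum.
  rewrite -mulr_sumr ler_wpM2l //; apply: sum_tail_quarter => b.
  rewrite in_fset /= inE /= => /andP[_ nb]; rewrite leqNgt; apply/negP => /mdeg_box.
  exact/negP.
have boxS n m : (n <= m)%N -> (box N n `<=` box N m)%fset.
  move=> nm; apply/fsubsetP => b /boxP h; apply/boxP => i; exact: leq_trans (h i) nm.
have e_to0 : e @ \oo --> (0 : R).
  rewrite (_ : e = fun n => (B * 2 ^+ N) * 2^-1 ^+ n); last first.
    by apply/funext => n; rewrite /e mulrCA mulrC.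
  rewrite -(mulr0 (B * 2 ^+ N)); apply: cvgM; first exact: cvg_cst.
  by apply: cvg_expr; rewrite ger0_norm; lra.
pose S n := \sum_(b <- box N n) t b.
have [x hx] : exists x, forall n, `|x - complex.Re (S n)| <= e n.
  apply: real_cauchy_limit e_to0 _ => n m nm; rewrite -ReB.
  exact/(le_trans (Re_le_cmod _))/tail/boxS.
have [y hy] : exists y, forall n, `|y - complex.Im (S n)| <= e n.
  apply: real_cauchy_limit e_to0 _ => n m nm; rewrite -ImB.
  exact/(le_trans (Im_le_cmod _))/tail/boxS.
pose l : Cplx R := Complex x y.
have hl n : cmod (S n - l) <= 2 * e n.
  rewrite cmod_distC; apply: (le_trans (cmod_le_ReIm _)).
  rewrite ReB ImB /=; have := hx n; have := hy n; lra.
have sumP : zseries_sum c z l.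
  move=> eps eps0.
  have /cvgrPdist_lt /(_ (eps / 4)) := e_to0.
  rewrite divr_gt0 // => /(_ isT)[n _ /(_ n (leqnn n)) /=].
  rewrite sub0r normrN ger0_norm // => hn.
  exists (box N n) => A hA.
  have -> : \sum_(b <- A) c b * zmonom z b - l =
    (\sum_(b <- A) t b - S n) + (S n - l) by rewrite addrA subrK.
  apply: (le_lt_trans (cmodD _ _)); have := tail A n hA; have := hl n; lra.
exists l => _; split; first exact: sumP.
apply/ler_addgt0Pr => eps eps0.
have [A0 /(_ A0 (fsubset_refl _)) h] := sumP eps eps0.
rewrite -[l](subrK (\sum_(b <- A0) t b)).
apply: (le_trans (cmodD _ _)); rewrite addrC; apply: lerD.
  apply: (le_trans (cmod_sum _ _ _)).
  apply: (@le_trans _ _ (\sum_(b <- A0) B * (2^-1) ^+ mdeg b)).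
    apply: ler_sum => b _; apply: (le_trans (tb b)); rewrite ler_wpM2l //.
    by rewrite lerXn2r ?nnegrE //; lra.
  by rewrite -mulr_sumr ler_wpM2l // sum_fset_half.
by rewrite cmod_distC ltW.
Qed.

End GeometricSeries.

(** * The equation in terms of weighted coefficients *)

Section MomentDerivatives.
Variables (R : realType) (N : nat).
Implicit Types (b alpha : midx N) (u : tzseries R N).

Definition midx_add b alpha : midx N := [ffun i => (b i + alpha i)%N].

Lemma mdeg_add b alpha : mdeg (midx_add b alpha) = (mdeg b + mdeg alpha)%N.
Proof. by rewrite /mdeg -big_split; apply: eq_bigr => i _; rewrite ffunE. Qed.

Variables (m0 : Cplx R -> Cplx R) (m : 'I_N -> Cplx R -> Cplx R).
Hypothesis m0_neq0 : forall n : nat, m0 n%:R != 0.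
Hypothesis m_neq0 : forall i (n : nat), m i n%:R != 0.

Lemma iter_mdiff_t j u n b :
  iter j (mdiff_t m0) u n b = m0 (n + j)%:R / m0 n%:R * u (n + j)%N b.
Proof.
elim: j n => [|j IH] n; first by rewrite addn0 divff // mul1r.
rewrite iterS /mdiff_t IH addSnnS mulrA; congr (_ * _).
by rewrite mulrC mulrA divfK.
Qed.

Lemma iter_mdiff_z1 i k u n b :
  iter k (mdiff_z1 (m i) i) u n b =
  m i (b i + k)%:R / m i (b i)%:R *
    u n [ffun l => (b l + (if l == i then k else 0))%N].
Proof.
elim: k b => [|k IH] b.
  rewrite addn0 divff // mul1r; congr (u n _); apply/ffunP => l.
  by rewrite ffunE if_same addn0.
rewrite iterS /mdiff_z1 IH ffunE eqxx addn1 addSnnS mulrA; congr (_ * u n _).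
  by rewrite mulrC mulrA divfK.
by apply/ffunP => l; rewrite !ffunE; case: eqP => _; rewrite ?addn0 // addn1 addSnnS.
Qed.

(** The factors telescope in each variable, so that after multiplication of the
    coefficients by the moments the operators become plain shifts. *)
Lemma mdiff_zE alpha u n b :
  mdiff_z m alpha u n b =
  (\prod_(i < N) (m i (b i + alpha i)%:R / m i (b i)%:R)) *
    u n (midx_add b alpha).
Proof.
rewrite /mdiff_z -big_enum /=.
have -> : midx_add b alpha =
    [ffun l => (b l + (if l \in enum 'I_N then alpha l else 0))%N].
  by apply/ffunP => l; rewrite !ffunE mem_enum.
have := enum_uniq 'I_N; elim: (enum 'I_N) b => [b _|i r IH b /= /andP[ir ur]].
  rewrite big_nil mul1r /=; congr (u n _); apply/ffunP => l.
  by rewrite ffunE addn0.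
rewrite iter_mdiff_z1 IH // big_cons !mulrA; congr (_ * _ * u n _).
  apply: eq_big_seq => l lr; rewrite !ffunE; case: eqP => [E|_].
    by rewrite E in lr; rewrite lr in ir.
  by rewrite addn0.
apply/ffunP => l; rewrite !ffunE inE; case: eqP => [->|_] /=.
  by rewrite (negbTE ir) addn0.
by rewrite addn0.
Qed.

End MomentDerivatives.

Section Recursion.
Variables (R : realType) (M N : nat).
Variables (m0 : Cplx R -> Cplx R) (m : 'I_N -> Cplx R -> Cplx R).
Variables (m0r : nat -> R) (mr : 'I_N -> nat -> R).
Hypothesis m0E : forall n : nat, m0 n%:R = ofR (m0r n).
Hypothesis mE : forall i (n : nat), m i n%:R = ofR (mr i n).
Hypothesis m0r_gt0 : forall n, 0 < m0r n.
Hypothesis mr_gt0 : forall i n, 0 < mr i n.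

Definition moment_prod (b : midx N) : R := \prod_(i < N) mr i (b i).

Lemma moment_prod_gt0 b : 0 < moment_prod b.
Proof. by apply: prodr_gt0 => i _. Qed.

(** Modulus of the coefficient of the series whose terms are written
    v_(n,b) t^n z^b / (m0(n) m(b)). *)
Definition weighted (u : tzseries R N) (n : nat) (b : midx N) : R :=
  cmod (u n b) * (m0r n * moment_prod b).

Let m0_neq0 n : m0 n%:R != 0.
Proof. by rewrite m0E -cmod_gt0 cmod_ofR normr_gt0 gt_eqF. Qed.

Let m_neq0 i n : m i n%:R != 0.
Proof. by rewrite mE -cmod_gt0 cmod_ofR normr_gt0 gt_eqF. Qed.

Lemma cmod_iter_mdiff_t j u n b :
  cmod (iter j (mdiff_t m0) u n b) * (m0r n * moment_prod b) = weighted u (n + j) b.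
Proof.
rewrite iter_mdiff_t // !cmodM cmodV !m0E !cmod_ofR !gtr0_norm // /weighted.
by field; rewrite gt_eqF.
Qed.

Lemma cmod_iter_mdiff_tz j alpha u n b :
  cmod (iter j (mdiff_t m0) (mdiff_z m alpha u) n b) * (m0r n * moment_prod b) =
  weighted u (n + j) (midx_add b alpha).
Proof.
rewrite iter_mdiff_t // mdiff_zE // !cmodM cmodV !m0E !cmod_ofR !gtr0_norm //.
rewrite cmod_prod.
have -> : \prod_(i < N) cmod (m i (b i + alpha i)%:R / m i (b i)%:R) =
    moment_prod (midx_add b alpha) / moment_prod b.
  rewrite /moment_prod -prodf_div; apply: eq_bigr => i _.
  by rewrite cmodM cmodV !mE !cmod_ofR !gtr0_norm // ffunE.
have := moment_prod_gt0 b; have := moment_prod_gt0 (midx_add b alpha).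
set x := moment_prod _; set y := moment_prod _ => x0 y0.
by rewrite /weighted -/x; field; rewrite !gt_eqF.
Qed.

Variables (Lambda : set (nat * midx N)) (a : nat -> midx N -> nat -> Cplx R).
Variables (phi : nat -> zseries R N) (f u : tzseries R N).
Hypothesis finL : finite_set Lambda.
Hypothesis hu : formal_solution M m0 m Lambda a phi f u.

Lemma weighted_init n b : (n < M)%N ->
  weighted u n b = cmod (phi n b) * (m0r 0 * moment_prod b).
Proof.
by move=> nM; rewrite -(proj2 hu n nM b) cmod_iter_mdiff_t add0n.
Qed.

Lemma weighted_step n b :
  weighted u (n + M) b <= weighted f n b +
    \sum_(p <- fset_set Lambda) \sum_(l < n.+1)
      cmod (a p.1 p.2 l) * (m0r n / m0r (n - l)%N) *
      weighted u (n - l + p.1) (midx_add b p.2).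
Proof.
have := proj1 hu n b; rewrite fsbig_finite //= => E.
rewrite -cmod_iter_mdiff_t (_ : iter M _ _ _ _ = f n b -
  \sum_(p <- fset_set Lambda) mul_t (a p.1 p.2)
       (iter p.1 (mdiff_t m0) (mdiff_z m p.2 u)) n b); last by rewrite -E addrK.
have w0 : 0 <= m0r n * moment_prod b by rewrite mulr_ge0 ?ltW // moment_prod_gt0.
apply: (@le_trans _ _ ((cmod (f n b) + \sum_(p <- fset_set Lambda)
    \sum_(l < n.+1) cmod (a p.1 p.2 l) *
      cmod (iter p.1 (mdiff_t m0) (mdiff_z m p.2 u) (n - l)%N b)) *
    (m0r n * moment_prod b))).
  rewrite ler_wpM2r //; apply: (le_trans (cmodB _ _)); rewrite lerD2l.
  apply: (le_trans (cmod_sum _ _ _)); apply: ler_sum => p _.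
  apply: (le_trans (cmod_sum _ _ _)); apply: ler_sum => l _.
  by rewrite cmodM.
rewrite mulrDl lerD2l mulr_suml; apply: ler_sum => p _.
rewrite mulr_suml; apply: ler_sum => l _.
rewrite -cmod_iter_mdiff_tz le_eqVlt; apply/orP; left; apply/eqP.
by field; rewrite gt_eqF.
Qed.

End Recursion.

(** * The growth function and the terms of the recursion *)

Section GrowthFunction.
Variables (R : realType) (N : nat) (s : 'I_N -> R) (A : R).
Hypothesis s_gt0 : forall i, 0 < s i.
Hypothesis A_gt0 : 0 < A.
Implicit Types (b alpha : midx N).

Definition sdot b : R := \sum_(i < N) s i * (b i)%:R.

(** The coefficients of the solution are compared with X^X, where X is linear in
    (n, b), with slope A = s0 + 1/k1 in n; this replaces the Gamma function, whose
    quotients are less convenient, and 1 keeps the base away from 0. *)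
Definition weight n b : R := 1 + A * n%:R + sdot b.

Definition growth n b : R := weight n b `^ weight n b.

Lemma sdot_ge0 b : 0 <= sdot b.
Proof. by apply: sumr_ge0 => i _; rewrite mulr_ge0 // ltW. Qed.

Lemma sdot_add b alpha : sdot (midx_add b alpha) = sdot b + sdot alpha.
Proof.
by rewrite /sdot -big_split; apply: eq_bigr => i _; rewrite ffunE natrD mulrDr.
Qed.

Lemma weight_ge1 n b : 1 <= weight n b.
Proof.
by rewrite /weight -addrA lerDl addr_ge0 ?sdot_ge0 // mulr_ge0 // ltW.
Qed.

Lemma weight_gt0 n b : 0 < weight n b.
Proof. exact: lt_le_trans (weight_ge1 n b). Qed.

Lemma sdot_le_weight n b : sdot b <= weight n b.
Proof. by rewrite /weight lerDr addr_ge0 // mulr_ge0 // ltW. Qed.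

Lemma nat_le_weight n n' b : (n <= n')%N -> n%:R <= weight n' b / A.
Proof.
move=> nn; rewrite ler_pdivlMr //.
have : n%:R <= n'%:R :> R by rewrite ler_nat.
rewrite -(ler_pM2l A_gt0) /weight; have := sdot_ge0 b; lra.
Qed.

Lemma growth_gt0 n b : 0 < growth n b.
Proof. by rewrite powR_gt0 // weight_gt0. Qed.

Lemma weight_mono n n' b : (n <= n')%N -> weight n b <= weight n' b.
Proof.
move=> nn; rewrite /weight lerD2r lerD2l ler_pM2l //.
by rewrite ler_nat.
Qed.

(** From x^x <= y^x <= y^(y - d). *)
Lemma powR_self_le (x y d : R) : 1 <= x -> 1 <= y -> 0 <= d -> x <= y - d ->
  x `^ x <= y `^ y * y `^ (- d).
Proof.
move=> x1 y1 d0 xy.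
have y0 : 0 < y by lra.
rewrite -powRD; last by rewrite (gt_eqF y0) implybT.
apply: (@le_trans _ _ (y `^ x)); last exact: ler_powR.
by apply: ge0_ler_powR; rewrite ?nnegrE; lra.
Qed.

Lemma growth_mono n n' b : (n <= n')%N -> growth n b <= growth n' b.
Proof.
move=> nn; rewrite /growth.
have := @powR_self_le _ _ 0 (weight_ge1 n b) (weight_ge1 n' b) (lexx 0).
by rewrite subr0 oppr0 powRr0 mulr1; apply; exact: weight_mono.
Qed.

Lemma powR_nat_le (q x : R) n : 0 <= x -> 0 < q -> n%:R <= q ->
  n%:R `^ x <= q `^ x.
Proof. by move=> x0 q0 nq; apply: ge0_ler_powR; rewrite ?nnegrE // ltW. Qed.

(** From n ln (X / n) <= X: powers of the total weight can be distributed
    among its parts at an exponential cost only. *)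
Lemma powR_le_expR (X y : R) n : 0 < X -> 0 <= y ->
  X `^ (y * n%:R) <= expR (y * X) * n%:R `^ (y * n%:R).
Proof.
move=> X0 y0; have [->|n0] := posnP n.
  by rewrite mulr0 !powRr0 mulr1 -expR0 ler_expR mulr_ge0 // ltW.
have nR : 0 < n%:R :> R by rewrite ltr0n.
have E : X = n%:R * (X / n%:R) by field; rewrite gt_eqF.
rewrite {1}E powRM ?(ltW nR) ?divr_ge0 ?(ltW X0) ?(ltW nR) // mulrC ler_wpM2r ?powR_ge0 //.
rewrite /powR gt_eqF ?divr_gt0 // ler_expR.
apply: (@le_trans _ _ (y * n%:R * (X / n%:R))).
  rewrite ler_wpM2l ?mulr_ge0 ?(ltW nR) //; apply/ltW/ln_sublinear.
  exact: divr_gt0.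
by rewrite le_eqVlt; apply/orP; left; apply/eqP; field; rewrite gt_eqF.
Qed.

(** From n^n / n! <= e^n, a single term of the exponential series. *)
Lemma nat_powR_fact (x : R) n : 0 <= x ->
  n%:R `^ (x * n%:R) <= expR x ^+ n * (n`!)%:R `^ x.
Proof.
move=> x0; rewrite -expRM_natr mulrC powRrM powR_mulrn // expRM.
rewrite -powRM ?expR_ge0 // -natrX.
apply: ge0_ler_powR; rewrite ?nnegrE ?mulr_ge0 ?expR_ge0 //.
have f0 : 0 < (n`!)%:R :> R by rewrite ltr0n fact_gt0.
rewrite -ler_pdivrMr // natrX; case: n f0 => [|n] f0.
  by rewrite expr0 fact0 divr1 expR0.
have := @expR_ge1Dxn R n.+1%:R n (ler0n _ _); lra.
Qed.

End GrowthFunction.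

Section TermBound.
Variables (R : realType) (M N : nat) (s : 'I_N -> R) (s0 sigma : R).
Hypothesis s_gt0 : forall i, 0 < s i.
Hypothesis s0_gt0 : 0 < s0.
Hypothesis sigma_ge0 : 0 <= sigma.
Let A := s0 + sigma.
Let A_gt0 : 0 < A. Proof. by rewrite /A ltr_pwDl. Qed.
Let wt := weight s A.
Let gr := growth s A.
Variables (m0r : nat -> R) (Am : R).
Hypothesis m0r_gt0 : forall n, 0 < m0r n.
Hypothesis Am_ge1 : 1 <= Am.
Hypothesis m0_ratio : forall n l, (l <= n)%N ->
  m0r n / m0r (n - l)%N <= Am ^+ l * n%:R `^ (s0 * l%:R).

(** Part of the Gevrey growth of the l-th coefficient is geometric, as l <= 2^l;
    the rest is matched with the gap l - o between l and the order of vanishing. *)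
Lemma gevrey_split l o n : (o <= l)%N -> (l <= n)%N ->
  l%:R `^ (sigma * l%:R) <=
  (2 `^ (sigma * o%:R)) ^+ l * n%:R `^ (sigma * (l - o)%:R) :> R.
Proof.
move=> ol ln; have [l0|l0] := posnP l.
  have -> : o = 0%N by apply/eqP; rewrite -leqn0 -l0.
  by rewrite l0 subnn expr0 !mulr0 !powRr0 mulr1.
have lR : 0 < l%:R :> R by rewrite ltr0n.
have -> : sigma * l%:R = sigma * o%:R + sigma * (l - o)%:R.
  by rewrite -mulrDr -natrD subnKC.
rewrite powRD; last by rewrite (gt_eqF lR) implybT.
have so : 0 <= sigma * o%:R by rewrite mulr_ge0.
apply: ler_pM; rewrite ?powR_ge0 //.
  have -> : (2 `^ (sigma * o%:R)) ^+ l = (2 ^+ l) `^ (sigma * o%:R) :> R.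
    rewrite -powR_mulrn ?powR_ge0 // -[2 ^+ l]powR_mulrn // -!powRrM.
    by congr (_ `^ _); exact: mulrC.
  apply: ge0_ler_powR; rewrite ?nnegrE ?exprn_ge0 //.
  by rewrite -natrX ler_nat ltnW // ltn_expl.
apply: ge0_ler_powR; rewrite ?nnegrE ?ler_nat //.
by rewrite mulr_ge0.
Qed.

Variables (j : nat) (alpha : midx N) (o : nat) (al : nat -> R).
Hypothesis al_ge0 : forall l, 0 <= al l.
Hypothesis al_lt : forall l, (l < o)%N -> al l = 0.
Variables (Ba Ta : R).
Hypothesis Ba_ge0 : 0 <= Ba.
Hypothesis Ta_ge0 : 0 <= Ta.
Hypothesis al_le : forall l, al l <= Ba * Ta ^+ l * l%:R `^ (sigma * l%:R).
Hypothesis jo : (j < M + o)%N.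
Hypothesis slope_le :
  s0 * (j%:R - M%:R) + sdot s alpha <= sigma * (o%:R - j%:R + M%:R).

(** The point where 1/k1 enters. Passing from (n + M, b) to
    (n - l + j, b + alpha) lowers the weight by
    (s0 + sigma) (M + l - j) - s . alpha, and the slope condition says exactly
    that this is at least s0 l + sigma (l - o). *)
Lemma growth_shift n l b : (o <= l)%N -> (l <= n)%N ->
  gr (n - l + j)%N (midx_add b alpha) <=
  gr (n + M)%N b * wt (n + M)%N b `^ (- (s0 * l%:R + sigma * (l - o)%:R)).
Proof.
move=> ol ln; apply: powR_self_le; try exact: weight_ge1.
  by rewrite addr_ge0 // mulr_ge0 // ltW.
rewrite /weight sdot_add !natrD !natrB // /A.
have h := slope_le; lra.
Qed.

(** The gain X^(- s0 l - sigma (l - o)) compensates the moment quotient, of size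
    n^(s0 l), and the Gevrey growth of the coefficient, so that the l-th term
    is geometric in l. The index n - l + j is at most n + M - 1 because
    l >= o > j - M, which leaves a spare factor 1 / H. *)
Lemma term_bound : exists E H0 : R, [/\ 0 < E, 1 <= H0 &
  forall K C H : R, 1 <= K -> 0 <= C -> H0 <= H ->
  forall (W : nat -> midx N -> R) n b,
    (forall n' b', (n' < n + M)%N -> W n' b' <= C * H ^+ n' * K ^+ mdeg b' * gr n' b') ->
    \sum_(l < n.+1) al l * (m0r n / m0r (n - l)%N) * W (n - l + j)%N (midx_add b alpha)
      <= E * K ^+ mdeg alpha / H * (C * H ^+ (n + M) * K ^+ mdeg b * gr (n + M)%N b)].
Proof.
have sg0 := sigma_ge0; have s00 := s0_gt0; have Ba0 := Ba_ge0.
have Ta0 := Ta_ge0; have Am1 := Am_ge1; have A0 := A_gt0.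
have Ai0 : 0 < A^-1 by rewrite invr_gt0.
(* the geometric factor per unit of l; for H >= 2 Q the terms decrease like
     2^-l once the power of H is taken into account *)
pose Q := (Ta + 1) * 2 `^ (sigma * o%:R) * Am * (1 + A^-1) `^ A.
have Q1 : 1 <= Q.
  have q1 : 1 <= Ta + 1 by lra.
  have q2 : 1 <= 2 `^ (sigma * o%:R) :> R.
    by rewrite -[leLHS](powRr0 2); apply: ler_powR; rewrite ?mulr_ge0 //; lra.
  have q3 : 1 <= (1 + A^-1) `^ A.
    by rewrite -[leLHS](powRr0 (1 + A^-1)); apply: ler_powR; lra.
  by rewrite /Q; do 3 (apply: mulr_ege1 => //).
exists (2 * (Ba + 1) * (2 * Q) ^+ o), (2 * Q); split.
- by rewrite !mulr_gt0 ?exprn_gt0 //; lra.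
- lra.
move=> K C H K1 C0 QH W n b hW.
have H1 : 1 <= H by lra.
have Hgt0 : 0 < H by lra.
have K0 : 0 <= K by lra.
set X := wt (n + M)%N b; set G := gr (n + M)%N b.
have X0 : 0 < X by exact: weight_gt0.
have G0 : 0 < G by exact: growth_gt0.
pose T := C * K ^+ (mdeg b + mdeg alpha)%N * G * (Ba + 1) * (2 * Q) ^+ o * (H ^+ (n + M) / H).
have T0 : 0 <= T.
  rewrite /T !mulr_ge0 ?exprn_ge0 ?invr_ge0 ?(ltW G0) ?(ltW Hgt0) //; lra.
have one l : (l <= n)%N ->
    al l * (m0r n / m0r (n - l)%N) * W (n - l + j)%N (midx_add b alpha) <= T * 2^-1 ^+ l.
  move=> ln; have [lo|ol] := ltnP l o.
    by rewrite al_lt // !mul0r mulr_ge0 // exprn_ge0.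
  have hlt : (n - l + j < n + M)%N.
    rewrite -(ltn_add2r l) -addnA [(j + l)%N]addnC addnA subnK // -addnA ltn_add2l.
    by apply: leq_trans jo _; rewrite leq_add2l.
  set d1 := s0 * l%:R; set d2 := sigma * (l - o)%:R.
  have d10 : 0 <= d1 by rewrite mulr_ge0 // ltW.
  have d20 : 0 <= d2 by rewrite mulr_ge0.
  have nX : n%:R <= X / A by apply: nat_le_weight => //; exact: leq_addr.
  have XA0 : 0 < X / A by rewrite divr_gt0.
  have c1 : al l * (m0r n / m0r (n - l)%N) <= (Ba + 1) * Q ^+ l * X `^ (d1 + d2).
    apply: (@le_trans _ _ ((Ba * Ta ^+ l * ((2 `^ (sigma * o%:R)) ^+ l * (X / A) `^ d2)) *
       (Am ^+ l * (X / A) `^ d1))).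
      apply: ler_pM; rewrite ?divr_ge0 ?(ltW (m0r_gt0 _)) //.
        apply: (le_trans (al_le l)); rewrite ler_wpM2l ?mulr_ge0 ?exprn_ge0 //.
        apply: (le_trans (gevrey_split ol ln)); rewrite ler_wpM2l ?exprn_ge0 ?powR_ge0 //.
        exact: powR_nat_le.
      apply: (le_trans (m0_ratio ln)); rewrite ler_wpM2l ?exprn_ge0 //; first lra.
      exact: powR_nat_le.
    have -> : (X / A) `^ d2 = X `^ d2 * A^-1 `^ d2 by rewrite powRM // ltW.
    have -> : (X / A) `^ d1 = X `^ d1 * A^-1 `^ d1 by rewrite powRM // ltW.
    have -> : X `^ (d1 + d2) = X `^ d1 * X `^ d2.
      by rewrite powRD // (gt_eqF X0) implybT.
    have cA : A^-1 `^ d1 * A^-1 `^ d2 <= ((1 + A^-1) `^ A) ^+ l.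
      rewrite -powRD; last by rewrite (gt_eqF Ai0) implybT.
      rewrite -powR_mulrn ?powR_ge0 // -powRrM.
      apply: (@le_trans _ _ ((1 + A^-1) `^ (d1 + d2))).
        by apply: ge0_ler_powR; rewrite ?nnegrE; lra.
      apply: ler_powR; first lra.
      rewrite /d1 /d2 /A mulrDl lerD2l ler_wpM2l // ler_nat leq_subr.
      by [].
    have cT : Ba * Ta ^+ l <= (Ba + 1) * (Ta + 1) ^+ l.
      by apply: ler_pM; rewrite ?exprn_ge0 ?lerXn2r ?nnegrE //; lra.
    rewrite /Q !exprMn.
    rewrite [leLHS](_ : _ = (Ba * Ta ^+ l) * (A^-1 `^ d1 * A^-1 `^ d2) *
       ((2 `^ (sigma * o%:R)) ^+ l * Am ^+ l * (X `^ d1 * X `^ d2))); last by ring.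
    rewrite [leRHS](_ : _ = ((Ba + 1) * (Ta + 1) ^+ l) *
       (((1 + A^-1) `^ A) ^+ l) *
       ((2 `^ (sigma * o%:R)) ^+ l * Am ^+ l * (X `^ d1 * X `^ d2))); last by ring.
    have Am0 : 0 <= Am by lra.
    apply: ler_wpM2r; first by rewrite !mulr_ge0 ?powR_ge0 ?exprn_ge0 ?powR_ge0.
    by apply: ler_pM; rewrite ?mulr_ge0 ?powR_ge0 ?exprn_ge0.
  have c2 : W (n - l + j)%N (midx_add b alpha) <= C * H ^+ (n - l + j) *
      K ^+ (mdeg b + mdeg alpha)%N * (G * X `^ (- (d1 + d2))).
    apply: (le_trans (hW _ _ hlt)); rewrite mdeg_add ler_wpM2l //.
      by rewrite !mulr_ge0 ?exprn_ge0 // ltW.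
    exact: growth_shift.
  have c3 : Q ^+ l * H ^+ (n - l + j) <= (2 * Q) ^+ o * 2^-1 ^+ l * (H ^+ (n + M) / H).
    have E1 : Q ^+ l = (2 * Q) ^+ l * 2^-1 ^+ l by rewrite -exprMn mulrAC mulfV // mul1r.
    have E2 : (2 * Q) ^+ l = (2 * Q) ^+ o * (2 * Q) ^+ (l - o) by rewrite -exprD subnKC.
    rewrite E1 E2 -!mulrA ler_wpM2l ?exprn_ge0 //; first lra.
    rewrite mulrCA ler_wpM2l ?exprn_ge0 //.
    apply: (@le_trans _ _ (H ^+ (l - o) * H ^+ (n - l + j))).
      by rewrite ler_wpM2r ?exprn_ge0 ?(ltW Hgt0) // lerXn2r ?nnegrE //; lra.
    rewrite -exprD ler_pdivlMr // -exprSr; apply: ler_weXn2l => //.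
    move: ol ln jo; clear; lia.
  have al0 : 0 <= al l * (m0r n / m0r (n - l)%N).
    by rewrite mulr_ge0 // divr_ge0 // ltW.
  apply: (@le_trans _ _ (al l * (m0r n / m0r (n - l)%N) * (C * H ^+ (n - l + j) *
      K ^+ (mdeg b + mdeg alpha)%N * (G * X `^ (- (d1 + d2)))))).
    by rewrite ler_wpM2l.
  have rest0 : 0 <= C * H ^+ (n - l + j) * K ^+ (mdeg b + mdeg alpha)%N *
      (G * X `^ (- (d1 + d2))).
    by rewrite !mulr_ge0 ?exprn_ge0 ?powR_ge0 // ltW.
  apply: (le_trans (ler_wpM2r rest0 c1)).
  have XX : X `^ (d1 + d2) * X `^ (- (d1 + d2)) = 1.
    by rewrite -powRD ?subrr ?powRr0 // (gt_eqF X0) implybT.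
  rewrite [leLHS](_ : _ = C * K ^+ (mdeg b + mdeg alpha)%N * G * (Ba + 1) *
     (Q ^+ l * H ^+ (n - l + j)) * (X `^ (d1 + d2) * X `^ (- (d1 + d2)))); last by ring.
  rewrite XX mulr1.
  rewrite [leRHS](_ : _ = C * K ^+ (mdeg b + mdeg alpha)%N * G * (Ba + 1) *
     ((2 * Q) ^+ o * 2^-1 ^+ l * (H ^+ (n + M) / H))); last by rewrite /T; ring.
  rewrite ler_wpM2l // !mulr_ge0 ?exprn_ge0 ?(ltW G0) //; lra.
apply: (@le_trans _ _ (\sum_(l < n.+1) T * 2^-1 ^+ l)).
  by apply: ler_sum => l _; apply: one; rewrite -ltnS.
rewrite -mulr_sumr.
have geo : \sum_(l < n.+1) (2^-1 : R) ^+ l <= 2.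
  have := subrX1 (2^-1 : R) n.+1.
  have : 0 <= (2^-1 : R) ^+ n.+1 by rewrite exprn_ge0.
  set q := (_ ^+ n.+1); set w := \sum_(l < n.+1) _; lra.
apply: (@le_trans _ _ (T * 2)); first by rewrite ler_wpM2l.
rewrite le_eqVlt; apply/orP; left; apply/eqP; rewrite /T exprD.
by field; rewrite gt_eqF.
Qed.

End TermBound.

(** * Bounds for the data of the problem *)

Section Coefficients.
Variables (R : realType) (N : nat).

(** Gamma(1 + x) is at most C (2 x)^x. *)
Lemma gevrey_powR (sigma : R) (nrm : nat -> \bar R) : 0 <= sigma ->
  gevrey sigma nrm -> exists B H : R, [/\ 0 < B, 0 < H &
    forall n, (nrm n <= (B * H ^+ n * n%:R `^ (sigma * n%:R))%:E)%E].
Proof.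
move=> s0 [B [H [B0 H0 h]]]; have [C C0 hC] := Gamma_le R.
exists (B * C), (H * ((2 * sigma) `^ sigma + 1)); split.
- exact: mulr_gt0.
- by rewrite mulr_gt0 // ltr_wpDl ?powR_ge0.
move=> n; apply: (le_trans (h n)); rewrite lee_fin.
have sn : 0 <= sigma * n%:R by rewrite mulr_ge0.
apply: (@le_trans _ _ (B * H ^+ n * (C * (2 * (sigma * n%:R)) `^ (sigma * n%:R)))).
  by rewrite ler_wpM2l ?hC // mulr_ge0 ?exprn_ge0 // ltW.
have -> : (2 * (sigma * n%:R)) `^ (sigma * n%:R) =
    ((2 * sigma) `^ sigma) ^+ n * n%:R `^ (sigma * n%:R).
  rewrite mulrA powRM ?mulr_ge0 //; congr (_ * _).
  by rewrite powRrM powR_mulrn // powR_ge0.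
rewrite exprMn.
have -> : B * H ^+ n * (C * (((2 * sigma) `^ sigma) ^+ n * n%:R `^ (sigma * n%:R))) =
   (B * C * H ^+ n * n%:R `^ (sigma * n%:R)) * ((2 * sigma) `^ sigma) ^+ n by ring.
have -> : B * C * (H ^+ n * ((2 * sigma) `^ sigma + 1) ^+ n) * n%:R `^ (sigma * n%:R) =
  (B * C * H ^+ n * n%:R `^ (sigma * n%:R)) * ((2 * sigma) `^ sigma + 1) ^+ n by ring.
rewrite ler_wpM2l //; first by rewrite !mulr_ge0 ?exprn_ge0 ?powR_ge0 // ltW.
by apply: lerXn2r; rewrite ?nnegrE ?addr_ge0 ?powR_ge0 // lerDl.
Qed.

(** An unconditionally convergent series has bounded terms: a term outside the
    finite set A0 is the difference of two sums close to the limit. The constants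
    are not uniform in g, which is enough for the finitely many initial data. *)
Lemma expansion_coef_bound (g : 'rV[Cplx R]_N -> Cplx R) (c : zseries R N) :
  expansion g c -> exists C K : R, [/\ 0 < C, 0 < K &
    forall b, cmod (c b) <= C * K ^+ mdeg b].
Proof.
move=> /near_rV_coord[d d0 hd].
pose rho := d / 2; have rho0 : 0 < rho by rewrite divr_gt0.
pose z : 'rV[Cplx R]_N := row_of (fun=> ofR rho).
have zs : zseries_sum c z (g z).
  by apply: hd => i; rewrite mxE cmod_ofR gtr0_norm // /rho; lra.
have zE b : cmod (zmonom z b) = rho ^+ mdeg b.
  rewrite /zmonom cmod_prod /mdeg -prodrXr; apply: eq_bigr => i _.
  by rewrite mxE cmodX cmod_ofR gtr0_norm.
have [A0 hA] := zs 1 ltr01.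
pose S := \sum_(b <- A0) cmod (c b * zmonom z b).
have S0 : 0 <= S by rewrite sumr_ge0 // => b _; exact: cmod_ge0.
exists (2 + S), rho^-1; split; [lra|by rewrite invr_gt0|].
move=> b; rewrite exprVn ler_pdivlMr ?exprn_gt0 // -zE -cmodM.
have [bA|bA] := boolP (b \in A0).
  rewrite /S (big_fsetD1 b bA) /= addrCA lerDl addr_ge0 // sumr_ge0 // => i _.
  exact: cmod_ge0.
have h1 := hA A0 (fsubset_refl _).
have h2 := hA (b |` A0)%fset (fsubsetU1 _ _).
rewrite big_fsetU1 //= in h2.
set T := \sum_(b <- A0) _ in h1 h2.
rewrite (_ : c b * zmonom z b = (c b * zmonom z b + T - g z) - (T - g z)); last by ring.
apply: (le_trans (cmodB _ _)); lra.
Qed.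

Lemma regular_ratio (s : R) (m : Cplx R -> Cplx R) (mr : nat -> R) : 0 < s ->
  (forall n : nat, m n%:R = ofR (mr n)) -> (forall n, 0 < mr n) ->
  regular_moment s m -> exists2 A : R, 1 <= A &
    forall n l, (l <= n)%N -> mr n / mr (n - l)%N <= A ^+ l * n%:R `^ (s * l%:R).
Proof.
move=> s0 mE mr0 [a [A [a0 A0 h]]]; exists (1 + A); first by lra.
have one n : (0 < n)%N -> mr n <= (1 + A) * n%:R `^ s * mr n.-1.
  move=> n0; have /andP[_] := h n n0.
  rewrite !mE -fmorphV -rmorphM /= ler_ofR ler_pdivrMr // => h1.
  apply: (le_trans h1); rewrite ler_wpM2r ?(ltW (mr0 _)) // ler_wpM2r ?powR_ge0 //.
  lra.
move=> n; elim=> [_|l IH ln].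
  by rewrite subn0 divff ?gt_eqF // expr0 mulr0 powRr0 mulr1.
have {}IH := IH (ltnW ln).
have nl : (0 < n - l)%N by rewrite subn_gt0.
have := one _ nl; rewrite -subnS => h1.
have nR : 0 < n%:R :> R by rewrite ltr0n (leq_trans _ ln).
apply: (@le_trans _ _ (mr n / mr (n - l)%N * ((1 + A) * n%:R `^ s))).
  rewrite -mulrA ler_pM2l // [leRHS]mulrC ler_pdivlMr // mulrC ler_pdivrMr //.
  apply: (le_trans h1); rewrite ler_wpM2r ?(ltW (mr0 _)) // ler_wpM2l //; first lra.
  by apply: ge0_ler_powR; rewrite ?nnegrE ?ler_nat ?leq_subr // ltW.
have -> : (1 + A) ^+ l.+1 * n%:R `^ (s * l.+1%:R) =
    ((1 + A) ^+ l * n%:R `^ (s * l%:R)) * ((1 + A) * n%:R `^ s).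
  have -> : s * l.+1%:R = s * l%:R + s by rewrite -natr1 mulrDr mulr1.
  rewrite exprSr powRD; last by rewrite (gt_eqF nR) implybT.
  by ring.
by rewrite ler_wpM2r // mulr_ge0 ?powR_ge0 //; lra.
Qed.

Lemma powR_sumr (X : R) (I : Type) (r : seq I) (F : I -> R) : 0 < X ->
  X `^ (\sum_(i <- r) F i) = \prod_(i <- r) X `^ F i.
Proof.
move=> X0; apply: (big_morph (fun y => X `^ y)); last exact: powRr0.
by move=> x y; rewrite powRD // (gt_eqF X0) implybT.
Qed.

Lemma prodr_exp_le (D : 'I_N -> R) (b : midx N) : (forall i, 0 <= D i) ->
  \prod_(i < N) D i ^+ b i <= (1 + \sum_(i < N) D i) ^+ mdeg b.
Proof.
move=> D0; rewrite /mdeg -prodrXr; apply: ler_prod => i _.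
rewrite exprn_ge0 //=; apply: lerXn2r; rewrite ?nnegrE ?addr_ge0 ?sumr_ge0 //.
rewrite (bigD1 i) //= addrCA lerDl addr_ge0 // sumr_ge0 //.
Qed.

Variables (s : 'I_N -> R) (mr : 'I_N -> nat -> R).
Hypothesis s_gt0 : forall i, 0 < s i.
Hypothesis mr_gt0 : forall i n, 0 < mr i n.

(** Each b_i is at most X / s_i, so the product of the b_i^(s_i b_i) is at most
    X^(s . b) up to a geometric factor. *)
Lemma moment_prod_le (C D : 'I_N -> R) : (forall i, 0 < C i) -> (forall i, 0 < D i) ->
  (forall i n, mr i n <= C i * D i ^+ n * n%:R `^ (s i * n%:R)) ->
  exists C' D' : R, [/\ 0 < C', 1 <= D' & forall (b : midx N) (X : R),
    1 <= X -> sdot s b <= X ->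
    moment_prod mr b <= C' * D' ^+ mdeg b * X `^ sdot s b].
Proof.
move=> C0 D0 h; pose D1 i := D i * (s i)^-1 `^ s i.
have D10 i : 0 <= D1 i by rewrite mulr_ge0 ?powR_ge0 // ltW.
exists (\prod_(i < N) C i), (1 + \sum_(i < N) D1 i); split.
- exact: prodr_gt0.
- by rewrite lerDl sumr_ge0.
move=> b X X1 bX; have X0 : 0 < X by lra.
apply: (@le_trans _ _ (\prod_(i < N) (C i * D1 i ^+ b i * X `^ (s i * (b i)%:R)))).
  apply: ler_prod => i _; rewrite (ltW (mr_gt0 _ _)) /=.
  apply: (le_trans (h i (b i))).
  have sb0 : 0 <= s i * (b i)%:R by rewrite mulr_ge0 // ltW.
  have bi : (b i)%:R <= (s i)^-1 * X.
    rewrite mulrC ler_pdivlMr //; apply: le_trans bX; rewrite /sdot (bigD1 i) //=.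
    rewrite mulrC lerDl sumr_ge0 // => k _; rewrite mulr_ge0 // ltW //.
  rewrite /D1 exprMn -!mulrA ler_wpM2l ?(ltW (C0 i)) // ler_wpM2l ?exprn_ge0 ?(ltW (D0 i)) //.
  have -> : ((s i)^-1 `^ s i) ^+ b i = (s i)^-1 `^ (s i * (b i)%:R).
    by rewrite powRrM powR_mulrn // powR_ge0.
  rewrite -powRM ?invr_ge0 ?(ltW (s_gt0 i)) ?(ltW X0) //.
  by apply: ge0_ler_powR; rewrite ?nnegrE ?mulr_ge0 ?invr_ge0 ?(ltW (s_gt0 i)) ?(ltW X0).
rewrite !big_split /= -powR_sumr // -/(sdot s b) ler_wpM2r ?powR_ge0 //.
rewrite ler_wpM2l ?prodr_exp_le //.
by apply: prodr_ge0 => i _; exact: ltW.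
Qed.

Lemma powR_sdot_le (c d : 'I_N -> R) : (forall i, 0 < c i) -> (forall i, 0 < d i) ->
  (forall i n, c i * d i ^+ n * n%:R `^ (s i * n%:R) <= mr i n) ->
  exists C' D' : R, [/\ 0 < C', 1 <= D' & forall (b : midx N) (X : R), 0 < X ->
    X `^ sdot s b <=
    C' * D' ^+ mdeg b * expR ((\sum_(i < N) s i) * X) * moment_prod mr b].
Proof.
move=> c0 d0 h.
have di0 i : 0 <= (d i)^-1 by rewrite invr_ge0 ltW.
exists (\prod_(i < N) (c i)^-1), (1 + \sum_(i < N) (d i)^-1); split.
- by apply: prodr_gt0 => i _; rewrite invr_gt0.
- by rewrite lerDl sumr_ge0.
move=> b X X0; rewrite /sdot powR_sumr //.
apply: (@le_trans _ _ (\prod_(i < N)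
    ((c i)^-1 * (d i)^-1 ^+ b i * expR (s i * X) * mr i (b i)))).
  apply: ler_prod => i _; rewrite powR_ge0 /=.
  apply: (le_trans (powR_le_expR (b i) X0 (ltW (s_gt0 i)))).
  rewrite [leLHS]mulrC [leRHS]mulrAC ler_wpM2r ?expR_ge0 //.
  have := h i (b i); set P := _ `^ _ => hi.
  have dp : 0 < d i ^+ b i by rewrite exprn_gt0.
  rewrite exprVn -invfM mulrC ler_pdivlMr ?mulr_gt0 //.
  by rewrite mulrC.
rewrite !big_split /= -/(moment_prod mr b) ler_wpM2r ?(ltW (moment_prod_gt0 mr_gt0 b)) //.
have -> : \prod_(i < N) expR (s i * X) = expR ((\sum_(i < N) s i) * X).
  by rewrite mulr_suml expR_sum.
rewrite ler_wpM2r ?expR_ge0 // ler_wpM2l ?prodr_exp_le //.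
by apply: prodr_ge0 => i _; rewrite invr_ge0 ltW.
Qed.

End Coefficients.

(** * The induction, and the role of the slope *)

Section GrowthInduction.
Variables (R : realType) (M N : nat) (s : 'I_N -> R) (A : R).
Hypothesis s_gt0 : forall i, 0 < s i.
Hypothesis A_gt0 : 0 < A.
Let gr := growth s A.
Variables (Ls : seq (nat * midx N)) (S : nat * midx N -> nat -> midx N -> R).
Variables (W F : nat -> midx N -> R).

(** Strong induction on n, the bound being proved for all b at once since the
    space derivatives raise b. With H large, the sum of the terms and the
    forcing term take at most one half of the claimed bound each. *)
Lemma growth_induction (C0 K0 C1 H1 K1 : R) :
  0 < C0 -> 0 < K0 -> 0 < C1 -> 0 < H1 -> 0 < K1 ->
  (forall n b, (n < M)%N -> W n b <= C0 * K0 ^+ mdeg b * gr n b) ->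
  (forall n b, F n b <= C1 * H1 ^+ n * K1 ^+ mdeg b * gr n b) ->
  (forall n b, W (n + M)%N b <= F n b + \sum_(p <- Ls) S p n b) ->
  (forall p, p \in Ls -> exists E H0 : R, [/\ 0 < E, 1 <= H0 &
     forall K C H : R, 1 <= K -> 0 <= C -> H0 <= H -> forall n b,
     (forall n' b', (n' < n + M)%N -> W n' b' <= C * H ^+ n' * K ^+ mdeg b' * gr n' b') ->
     S p n b <= E * K ^+ mdeg p.2 / H * (C * H ^+ (n + M) * K ^+ mdeg b * gr (n + M)%N b)]) ->
  exists C H K : R, [/\ 0 < C, 0 < H, 0 < K &
    forall n b, W n b <= C * H ^+ n * K ^+ mdeg b * gr n b].
Proof.
move=> C00 K00 C10 H10 K10 hW hF hstep hS.
pose good (p : nat * midx N) (q : R * R) := p \in Ls ->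
  [/\ 0 < q.1, 1 <= q.2 & forall K C H : R,
     1 <= K -> 0 <= C -> q.2 <= H -> forall n b,
     (forall n' b', (n' < n + M)%N -> W n' b' <= C * H ^+ n' * K ^+ mdeg b' * gr n' b') ->
     S p n b <= q.1 * K ^+ mdeg p.2 / H * (C * H ^+ (n + M) * K ^+ mdeg b * gr (n + M)%N b)].
have good_ex p : exists q, good p q.
  case: (boolP (p \in Ls)) => [/hS[E [H0 hE]]|pL]; first by exists (E, H0).
  by exists (0, 0) => pL'; rewrite pL' in pL.
have [EH hEH] := choice good_ex.
pose K := 1 + K0 + K1.
have K1' : 1 <= K by rewrite /K; lra.
have K0' : 0 < K by lra.
pose E := \sum_(p <- Ls) (EH p).1 * K ^+ mdeg p.2.
pose H2 := \sum_(p <- Ls) (EH p).2.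
have E0 : 0 <= E.
  rewrite /E big_seq sumr_ge0 // => p /hEH[e0 _ _].
  by rewrite mulr_ge0 ?exprn_ge0 // ltW.
have H20 : 0 <= H2.
  by rewrite /H2 big_seq sumr_ge0 // => p /hEH[_ h0 _]; lra.
(* 2 E <= H bounds the sum of the terms by one half of the claim *)
pose H := 1 + H1 + 2 * E + H2.
have Hge1 : 1 <= H by rewrite /H; lra.
have H0 : 0 < H by lra.
have hH2 p : p \in Ls -> (EH p).2 <= H.
  move=> pL; apply: (@le_trans _ _ H2); last by rewrite /H; lra.
  rewrite /H2 (perm_big _ (perm_to_rem pL)) big_cons lerDl.
  by rewrite big_seq sumr_ge0 // => q /mem_rem /hEH[_ h0 _]; lra.
pose C := C0 + 2 * C1.
have Cgt0 : 0 < C by rewrite /C; lra.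
have gr0 n b : 0 < gr n b by exact: growth_gt0.
exists C, H, K; split=> // n.
have [k] := ubnP n; elim: k n => // k IH n; rewrite ltnS => nk b.
have [nM|Mn] := ltnP n M.
  apply: (le_trans (hW n b nM)); rewrite ler_wpM2r ?(ltW (gr0 _ _)) //.
  apply: (@le_trans _ _ (C * K ^+ mdeg b)).
    apply: ler_pM; rewrite ?exprn_ge0 ?(ltW C00) ?(ltW K00) //; first by rewrite /C; lra.
    by apply: lerXn2r; rewrite ?nnegrE /K; lra.
  rewrite ler_wpM2r ?exprn_ge0 ?(ltW K0') // ler_peMr ?(ltW Cgt0) //.
  exact: exprn_ege1.
move: nk; rewrite -(subnK Mn); set n' := (n - M)%N => nk.
have prev n1 b1 : (n1 < n' + M)%N -> W n1 b1 <= C * H ^+ n1 * K ^+ mdeg b1 * gr n1 b1.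
  by move=> hn; apply: IH; exact: leq_trans hn nk.
apply: (le_trans (hstep n' b)).
set Z := C * H ^+ (n' + M) * K ^+ mdeg b * gr (n' + M)%N b.
have Z0 : 0 <= Z by rewrite /Z !mulr_ge0 ?exprn_ge0 // ltW.
have bF : F n' b <= Z / 2.
  apply: (le_trans (hF n' b)).
  apply: (@le_trans _ _ (C1 * H ^+ (n' + M) * K ^+ mdeg b * gr (n' + M)%N b)).
    have g1 : gr n' b <= gr (n' + M)%N b by apply: growth_mono => //; exact: leq_addr.
    have h1 : H1 ^+ n' <= H ^+ (n' + M).
      apply: (@le_trans _ _ (H ^+ n')).
        by apply: lerXn2r; rewrite ?nnegrE /H; lra.
      by apply: ler_weXn2l => //; exact: leq_addr.
    have k1 : K1 ^+ mdeg b <= K ^+ mdeg b.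
      by apply: lerXn2r; rewrite ?nnegrE /K; lra.
    apply: ler_pM => //; [by rewrite !mulr_ge0 ?exprn_ge0 // ltW|exact: ltW|].
    apply: ler_pM => //; [by rewrite !mulr_ge0 ?exprn_ge0 // ltW|by rewrite exprn_ge0 // ltW|].
    by apply: ler_wpM2l => //; exact: ltW.
  have -> : Z / 2 = (C / 2) * H ^+ (n' + M) * K ^+ mdeg b * gr (n' + M)%N b.
    by rewrite /Z; field.
  have c1 : C1 <= C / 2 by rewrite /C; lra.
  rewrite ler_wpM2r ?(ltW (gr0 _ _)) // ler_wpM2r ?exprn_ge0 ?(ltW K0') //.
  by rewrite ler_wpM2r ?exprn_ge0 // ltW.
have bS : \sum_(p <- Ls) S p n' b <= Z / 2.
  apply: (@le_trans _ _ (\sum_(p <- Ls) (EH p).1 * K ^+ mdeg p.2 / H * Z)).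
    rewrite big_seq [leRHS]big_seq; apply: ler_sum => p pL.
    have [_ _ h] := hEH p pL.
    by apply: h => //; [exact: ltW|exact: hH2].
  rewrite -!mulr_suml -/E [Z / 2]mulrC; apply: ler_wpM2r => //.
  rewrite ler_pdivrMr // /H; lra.
lra.
Qed.

End GrowthInduction.

Section Slope.
Variables (R : realType) (M N : nat) (s0 : R) (s : 'I_N -> R).
Variables (Lambda : set (nat * midx N)) (a : nat -> midx N -> nat -> Cplx R).
Hypothesis finL : finite_set Lambda.

Lemma inv_k1_ge0 : 0 <= inv_k1 M s0 s Lambda a.
Proof. exact: bigmax_ge_id. Qed.

Lemma slope_le_inv_k1 j alpha : Lambda (j, alpha) -> nonzero_series (a j alpha) ->
  slope M s0 s a j alpha <= inv_k1 M s0 s Lambda a.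
Proof.
move=> L nz; pose F (p : nat * midx N) := slope M s0 s a p.1 p.2.
have [e|ne] := eqVneq (F (j, alpha)) 0.
  by rewrite -[slope _ _ _ _ _ _]/(F (j, alpha)) e; exact: inv_k1_ge0.
apply: (@le_bigmax_seq _ R _ _ _ (j, alpha) xpredT F) => //.
rewrite in_finite_support; first by rewrite inE; split=> //=; exact/eqP.
apply: sub_finite_set finL => p [[h _] _]; exact: h.
Qed.

Lemma ord_t_lt (c : nat -> Cplx R) l : (l < ord_t c)%N -> c l = 0.
Proof.
rewrite /ord_t; case: pselect => // h; case: ex_minnP => o _ ho lo.
by apply/eqP/negPn/negP => /ho; rewrite leqNgt lo.
Qed.

End Slope.

(** * Passing between weighted and plain coefficients *)

Section WeightedBounds.
Variables (R : realType) (N : nat) (s : 'I_N -> R) (s0 sigma : R).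
Hypothesis s_gt0 : forall i, 0 < s i.
Hypothesis s0_gt0 : 0 < s0.
Hypothesis sigma_ge0 : 0 <= sigma.
Let A := s0 + sigma.
Let A_gt0 : 0 < A. Proof. by rewrite /A ltr_pwDl. Qed.
Let wt := weight s A.
Let gr := growth s A.
Variables (m0r : nat -> R) (mr : 'I_N -> nat -> R).
Hypothesis m0r_gt0 : forall n, 0 < m0r n.
Hypothesis mr_gt0 : forall i n, 0 < mr i n.

Lemma powR_sdot_le_growth n b : wt n b `^ sdot s b <= gr n b.
Proof.
apply: ler_powR; first exact: weight_ge1.
exact: sdot_le_weight.
Qed.

Section Upper.
Variables (C' D' : R).
Hypothesis C'_gt0 : 0 < C'.
Hypothesis D'_ge1 : 1 <= D'.
Hypothesis prod_le : forall (b : midx N) (X : R), 1 <= X -> sdot s b <= X ->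
  moment_prod mr b <= C' * D' ^+ mdeg b * X `^ sdot s b.

Lemma weighted_init_le (c : zseries R N) (C K : R) : 0 < C -> 0 < K ->
  (forall b, cmod (c b) <= C * K ^+ mdeg b) -> forall n b,
  cmod (c b) * (m0r 0 * moment_prod mr b) <=
    C * m0r 0 * C' * (K * D') ^+ mdeg b * gr n b.
Proof.
move=> C0 K0 hc n b.
have D0 : 0 <= D' by have := D'_ge1; lra.
apply: (@le_trans _ _ ((C * K ^+ mdeg b) * (m0r 0 * (C' * D' ^+ mdeg b * gr n b)))).
  apply: ler_pM; rewrite ?cmod_ge0 ?hc //.
    by rewrite mulr_ge0 // ltW // moment_prod_gt0.
  rewrite ler_pM2l //.
  apply: (le_trans (prod_le (weight_ge1 s_gt0 A_gt0 n b) (sdot_le_weight _ A_gt0 _ _))).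
  by rewrite ler_wpM2l ?powR_sdot_le_growth // mulr_ge0 ?exprn_ge0 // ltW.
by rewrite exprMn le_eqVlt; apply/orP; left; apply/eqP; ring.
Qed.

(** The exponents add up to (s0 + sigma) n + s . b, which is X - 1. *)
Lemma weighted_force_le (f : tzseries R N) (B H K C D : R) :
  0 < B -> 0 < H -> 0 < K -> 0 < C -> 0 < D ->
  (forall n, m0r n <= C * D ^+ n * n%:R `^ (s0 * n%:R)) ->
  (forall n b, cmod (f n b) <= B * H ^+ n * n%:R `^ (sigma * n%:R) * K ^+ mdeg b) ->
  exists C1 H1 K1 : R, [/\ 0 < C1, 0 < H1, 0 < K1 &
    forall n b, weighted m0r mr f n b <= C1 * H1 ^+ n * K1 ^+ mdeg b * gr n b].
Proof.
move=> B0 H0 K0 C0 D0 hm hf.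
have D'0 : 0 < D' by have := D'_ge1; lra.
have Ai0 : 0 < A^-1 by rewrite invr_gt0.
pose L := A^-1 `^ A.
have L0 : 0 < L by rewrite powR_gt0.
exists (B * C * C'), (H * D * L), (K * D'); split; rewrite ?mulr_gt0 //.
move=> n b; rewrite /weighted.
set X := wt n b.
have X1 : 1 <= X by exact: weight_ge1.
have X0 : 0 < X by lra.
have nX : n%:R <= X / A by exact: nat_le_weight.
have pn (x : R) : 0 <= x -> n%:R `^ (x * n%:R) <= X `^ (x * n%:R) * (A^-1 `^ x) ^+ n.
  move=> x0.
  have -> : (A^-1 `^ x) ^+ n = A^-1 `^ (x * n%:R) by rewrite powRrM powR_mulrn // powR_ge0.
  rewrite -powRM ?(ltW X0) ?(ltW Ai0) //; apply: powR_nat_le => //.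
    by rewrite mulr_ge0.
  by rewrite divr_gt0.
have P0 : 0 < moment_prod mr b := moment_prod_gt0 mr_gt0 b.
have hP : moment_prod mr b <= C' * D' ^+ mdeg b * X `^ sdot s b.
  by apply: prod_le => //; exact: sdot_le_weight.
apply: (@le_trans _ _
  ((B * H ^+ n * (X `^ (sigma * n%:R) * (A^-1 `^ sigma) ^+ n) * K ^+ mdeg b) *
   ((C * D ^+ n * (X `^ (s0 * n%:R) * (A^-1 `^ s0) ^+ n)) *
    (C' * D' ^+ mdeg b * X `^ sdot s b)))).
  apply: ler_pM; [exact: cmod_ge0|by rewrite mulr_ge0 // ltW| |].
    apply: (le_trans (hf n b)); rewrite ler_wpM2r ?exprn_ge0 ?(ltW K0) //.
    by rewrite ler_wpM2l ?pn // mulr_ge0 ?exprn_ge0 // ltW.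
  apply: ler_pM => //; [exact: ltW|exact: ltW|].
  apply: (le_trans (hm n)); rewrite ler_wpM2l ?pn ?(ltW s0_gt0) //.
  by rewrite mulr_ge0 ?exprn_ge0 // ltW.
have EL : L = A^-1 `^ sigma * A^-1 `^ s0.
  by rewrite /L {2}/A addrC powRD // (gt_eqF Ai0) implybT.
rewrite EL !exprMn.
rewrite [leLHS](_ : _ = B * C * C' * (H ^+ n * D ^+ n *
   ((A^-1 `^ sigma) ^+ n * (A^-1 `^ s0) ^+ n)) * (K ^+ mdeg b * D' ^+ mdeg b) *
   (X `^ (sigma * n%:R) * X `^ (s0 * n%:R) * X `^ sdot s b)); last by ring.
rewrite ler_wpM2l //; first by rewrite !mulr_ge0 ?exprn_ge0 ?powR_ge0 // ltW.
rewrite -!powRD ?(gt_eqF X0) ?implybT //.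
apply: ler_powR => //; rewrite /X /wt /weight /A; lra.
Qed.

End Upper.

(** Conversely to the bounds for the data, X^X factors as
    X X^(s0 n) X^(sigma n) X^(s . b), and each factor is brought back to its own
    scale: the first to e^X, the second to n^(s0 n), the third to n!^sigma and
    the last to m(b). *)
Lemma growth_le (C' D' : R) : 0 < C' -> 1 <= D' ->
  (forall (b : midx N) (X : R), 0 < X -> X `^ sdot s b <=
    C' * D' ^+ mdeg b * expR ((\sum_(i < N) s i) * X) * moment_prod mr b) ->
  exists C H K : R, [/\ 0 < C, 0 < H, 0 < K & forall n b,
    gr n b <= C * H ^+ n * K ^+ mdeg b * (n`!)%:R `^ sigma *
              (n%:R `^ (s0 * n%:R) * moment_prod mr b)].
Proof.
move=> C'0 D'1 hp.
have D'0 : 0 < D' by lra.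
pose g := 1 + s0 + sigma + \sum_(i < N) s i.
have g0 : 0 <= g.
  rewrite /g addr_ge0 ?sumr_ge0 // => [|i _]; last exact: ltW.
  by rewrite !addr_ge0 // ltW.
pose Kg := 1 + \sum_(i < N) expR (g * s i).
have Kg0 : 0 < Kg.
  by rewrite /Kg ltr_wpDr // sumr_ge0 // => i _; exact: expR_ge0.
exists (expR g * C'), (expR (g * A) * expR sigma), (Kg * D'); split.
- by rewrite mulr_gt0 ?expR_gt0.
- by rewrite mulr_gt0 ?expR_gt0.
- exact: mulr_gt0.
move=> n b; set P := moment_prod mr b.
have P0 : 0 < P := moment_prod_gt0 mr_gt0 b.
rewrite /gr /growth; set X := weight s A n b.
have X1 : 1 <= X by exact: weight_ge1.
have X0 : 0 < X by lra.
set S := \sum_(i < N) s i in hp *.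
have e1 : X <= expR (1 * X).
  by rewrite mul1r; apply: le_trans (expR_ge1Dx X); rewrite lerDr.
have e2 : X `^ (s0 * n%:R) <= expR (s0 * X) * n%:R `^ (s0 * n%:R).
  by apply: powR_le_expR => //; exact: ltW.
have e3 : X `^ (sigma * n%:R) <= expR (sigma * X) * (expR sigma ^+ n * (n`!)%:R `^ sigma).
  apply: (le_trans (powR_le_expR n X0 sigma_ge0)).
  by rewrite ler_wpM2l ?expR_ge0 ?nat_powR_fact.
have e4 := hp b X X0.
have -> : X `^ X = X * X `^ (s0 * n%:R) * X `^ (sigma * n%:R) * X `^ sdot s b.
  rewrite -{3}[X](powRr1 (ltW X0)) -!powRD ?(gt_eqF X0) ?implybT //.
  by congr (_ `^ _); rewrite /X /weight /A; ring.
apply: (@le_trans _ _ (expR (1 * X) * (expR (s0 * X) * n%:R `^ (s0 * n%:R)) *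
   (expR (sigma * X) * (expR sigma ^+ n * (n`!)%:R `^ sigma)) *
   (C' * D' ^+ mdeg b * expR (S * X) * P))).
  apply: ler_pM; rewrite ?mulr_ge0 ?powR_ge0 ?(ltW X0) //.
  apply: ler_pM; rewrite ?mulr_ge0 ?powR_ge0 ?(ltW X0) //.
  by apply: ler_pM; rewrite ?powR_ge0 ?(ltW X0).
rewrite [leLHS](_ : _ = expR (1 * X) * expR (s0 * X) * expR (sigma * X) * expR (S * X) *
  (C' * expR sigma ^+ n * D' ^+ mdeg b * (n`!)%:R `^ sigma *
   (n%:R `^ (s0 * n%:R) * P))); last by ring.
have -> : expR (1 * X) * expR (s0 * X) * expR (sigma * X) * expR (S * X) =
    expR g * expR (g * A) ^+ n * \prod_(i < N) expR (g * s i) ^+ b i.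
  have -> : \prod_(i < N) expR (g * s i) ^+ b i = expR (g * sdot s b).
    rewrite /sdot mulr_sumr expR_sum; apply: eq_bigr => i _.
    by rewrite -expRM_natr mulrA.
  rewrite -expRM_natr -!expRD; congr expR; rewrite /X /weight /g -/S; ring.
rewrite [leRHS](_ : _ = expR g * expR (g * A) ^+ n * Kg ^+ mdeg b *
  (C' * expR sigma ^+ n * D' ^+ mdeg b * (n`!)%:R `^ sigma *
   (n%:R `^ (s0 * n%:R) * P))); last by rewrite !exprMn; ring.
rewrite ler_wpM2r //.
  by rewrite !mulr_ge0 ?exprn_ge0 ?expR_ge0 ?powR_ge0 // ltW.
rewrite ler_wpM2l ?mulr_ge0 ?exprn_ge0 ?expR_ge0 //.
exact: (prodr_exp_le b (fun i => expR_ge0 (g * s i))).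
Qed.

End WeightedBounds.

(** * Gevrey order of the formal solution *)

Section Assembly.
Variables (R : realType) (M N : nat).

Lemma moment_family_bounds (s : 'I_N -> R) (m : 'I_N -> Cplx R -> Cplx R) :
  (forall i, 0 < s i) -> (forall i, moment_function (s i) (m i)) ->
  exists mr : 'I_N -> nat -> R,
  [/\ forall i (n : nat), m i n%:R = ofR (mr i n), forall i n, 0 < mr i n,
   exists C D : R, [/\ 0 < C, 1 <= D & forall (b : midx N) (X : R),
     1 <= X -> sdot s b <= X ->
     moment_prod mr b <= C * D ^+ mdeg b * X `^ sdot s b] &
   exists C D : R, [/\ 0 < C, 1 <= D & forall (b : midx N) (X : R), 0 < X ->
     X `^ sdot s b <=
     C * D ^+ mdeg b * expR ((\sum_(i < N) s i) * X) * moment_prod mr b]].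
Proof.
move=> hs hm.
pose good i (q : (nat -> R) * ((R * R) * (R * R))) :=
  [/\ forall n : nat, m i n%:R = ofR (q.1 n), forall n, 0 < q.1 n,
    [/\ 0 < q.2.1.1, 0 < q.2.1.2 &
      forall n, q.1 n <= q.2.1.1 * q.2.1.2 ^+ n * n%:R `^ (s i * n%:R)] &
    [/\ 0 < q.2.2.1, 0 < q.2.2.2 &
      forall n, q.2.2.1 * q.2.2.2 ^+ n * n%:R `^ (s i * n%:R) <= q.1 n]].
have ex i : exists q, good i q.
  have [mr [h1 h2 [C [D h3]] [c [d h4]]]] := moment_function_bounds (hs i) (hm i).
  by exists (mr, ((C, D), (c, d))).
have [q hq] := choice ex.
have q0 i n : 0 < (q i).1 n by case: (hq i).
exists (fun i => (q i).1); split.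
- by move=> i; case: (hq i).
- by move=> i; case: (hq i).
- by apply: (@moment_prod_le _ _ s (fun i => (q i).1) hs q0
    (fun i => (q i).2.1.1) (fun i => (q i).2.1.2)) => i; case: (hq i) => _ _ [].
- by apply: (@powR_sdot_le _ _ s (fun i => (q i).1) hs q0
    (fun i => (q i).2.2.1) (fun i => (q i).2.2.2)) => i; case: (hq i) => _ _ _ [].
Qed.

Lemma initial_coef_bound (R0 : R) (phi : nat -> zseries R N) :
  (forall j, (j < M)%N -> exists g, in_O R0 g /\ expansion g (phi j)) ->
  exists C K : R, [/\ 0 < C, 0 < K &
    forall j b, (j < M)%N -> cmod (phi j b) <= C * K ^+ mdeg b].
Proof.
move=> h.
pose good j (q : R * R) := (j < M)%N ->
  [/\ 0 < q.1, 0 < q.2 & forall b, cmod (phi j b) <= q.1 * q.2 ^+ mdeg b].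
have ex j : exists q, good j q.
  have [jM|Mj] := ltnP j M; last first.
    by exists (0, 0) => jM; rewrite ltnNge Mj in jM.
  have [g [_ /expansion_coef_bound[C [K hK]]]] := h j jM.
  by exists (C, K).
have [q hq] := choice ex.
have s0 (F : nat -> R) : (forall j, (j < M)%N -> 0 < F j) -> 0 <= \sum_(j < M) F j.
  by move=> hF; rewrite sumr_ge0 // => j _; exact/ltW/hF.
have q10 j : (j < M)%N -> 0 < (q j).1 by move=> /hq[].
have q20 j : (j < M)%N -> 0 < (q j).2 by move=> /hq[].
have le (F : nat -> R) : (forall j, (j < M)%N -> 0 < F j) -> forall j, (j < M)%N ->
    F j <= 1 + \sum_(j < M) F j.
  move=> hF j jM; rewrite (bigD1 (Ordinal jM)) //= addrCA lerDl addr_ge0 //.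
  by rewrite sumr_ge0 // => k _; exact/ltW/hF.
exists (1 + \sum_(j < M) (q j).1), (1 + \sum_(j < M) (q j).2).
have S1 := s0 _ q10; have S2 := s0 _ q20.
split; [lra|lra|] => j b jM; have [a1 a2 hb] := hq j jM.
apply: (le_trans (hb b)); apply: ler_pM.
- exact: ltW.
- by rewrite exprn_ge0 // ltW.
- exact: le q10 j jM.
- apply: lerXn2r; rewrite ?nnegrE; [exact: ltW|lra|exact: le q20 j jM].
Qed.

(** Here the uniform Cauchy estimates are indispensable: the germs f n are
    bounded on a common polydisc, but their expansions converge to F n only
    near 0, in neighbourhoods that may shrink with n. *)
Lemma force_coef_bound (R0 sigma : R) (f : tzseries R N)
    (F : nat -> 'rV[Cplx R]_N -> Cplx R) : 0 < R0 -> 0 <= sigma ->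
  (forall n, in_O R0 (F n) /\ expansion (F n) (f n)) ->
  gevrey sigma (fun n => sup_norm R0 (F n)) ->
  exists B H K : R, [/\ 0 < B, 0 < H, 0 < K &
    forall n b, cmod (f n b) <= B * H ^+ n * n%:R `^ (sigma * n%:R) * K ^+ mdeg b].
Proof.
move=> R00 sg hF /gevrey_powR[//|B [H [B0 H0 hB]]].
exists B, H, (16 / R0); split=> //; first exact: divr_gt0.
move=> n b; have [[dF _] eF] := hF n.
apply: (cauchy_polydisc R00 dF _ eF) => z hz.
rewrite -lee_fin; apply: le_trans (hB n).
by apply: ereal_sup_ubound; exists z.
Qed.

Lemma order_gap (j o : nat) :
  (j%:Z - M%:Z + 1 <= o%:Z)%R -> (j < M + o)%N.
Proof. lia. Qed.

End Assembly.

Theorem theorem5p1 (R : realType) (M N : nat) (hM : (0 < M)%N) (hN : (0 < N)%N)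
  (s0 : R) (s : 'I_N -> R) (m0 : Cplx R -> Cplx R)
  (m : 'I_N -> Cplx R -> Cplx R)
  (hs0 : 0 < s0) (hs : forall i, 0 < s i)
  (hm0 : moment_function s0 m0) (hm : forall i, moment_function (s i) (m i))
  (Lambda : set (nat * midx N)) (a : nat -> midx N -> nat -> Cplx R)
  (ha : forall j alpha, Lambda (j, alpha) -> holomorphic_germ (a j alpha))
  (phi : nat -> zseries R N) (f : tzseries R N)
  (h_i : exists R0 : R, [/\ 0 < R0,
     forall j, (j < M)%N -> exists g, in_O R0 g /\ expansion g (phi j) &
     exists F : nat -> 'rV[Cplx R]_N -> Cplx R,
       (forall n, in_O R0 (F n) /\ expansion (F n) (f n)) /\
       gevrey (inv_k1 M s0 s Lambda a) (fun n => sup_norm R0 (F n))])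
  (h_ii : finite_set Lambda)
  (h_iii : forall j alpha, Lambda (j, alpha) ->
     gevrey (inv_k1 M s0 s Lambda a) (fun n => (cmod (a j alpha n))%:E))
  (h_iv : forall j alpha, Lambda (j, alpha) -> nonzero_series (a j alpha) ->
     (Num.max 0 (j%:Z - M%:Z + 1) <= (ord_t (a j alpha))%:Z)%R)
  (h_v : regular_moment s0 m0)
  (u : tzseries R N)
  (hu : formal_solution M m0 m Lambda a phi f u) :
  exists Rt : R, 0 < Rt /\
    forall r : R, 0 < r < Rt ->
      exists C H : R, [/\ 0 < C, 0 < H &
        forall n : nat, exists U : 'rV[Cplx R]_N -> Cplx R,
          (forall z, polydisc r z -> zseries_sum (u n) z (U z)) /\
          (sup_norm r U <=
             (C * H ^+ n * (n`!)%:R `^ inv_k1 M s0 s Lambda a)%:E)%E].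
Proof.
set sigma := inv_k1 M s0 s Lambda a.
have sg0 : 0 <= sigma by exact: inv_k1_ge0.
pose A := s0 + sigma.
have A0 : 0 < A by rewrite /A ltr_pwDl.
have [m0r [m0E m0r0 [C0 [D0 [C00 D00 hup]]] [c0 [d0 [c00 d00 hlo]]]]] :=
  moment_function_bounds hs0 hm0.
have [mr [mE mr0 [C' [D' [C'0 D'1 hprod]]] [c' [d' [c'0 d'1 hsdot]]]]] :=
  moment_family_bounds hs hm.
have [Am Am1 hratio] := regular_ratio hs0 m0E m0r0 h_v.
have [R0 [R00 hphi [F [hF gF]]]] := h_i.
have [Cp [Kp [Cp0 Kp0 hp]]] := initial_coef_bound hphi.
have [B [H [K [B0 H0 K0 hf]]]] := force_coef_bound R00 sg0 hF gF.
pose W := weighted m0r mr u.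
have W_init n b : (n < M)%N ->
    W n b <= Cp * m0r 0 * C' * (Kp * D') ^+ mdeg b * growth s A n b.
  move=> nM; rewrite /W (weighted_init mr m0E m0r0 hu b nM).
  exact: (weighted_init_le hs hs0 sg0 m0r0 mr0 C'0 D'1 hprod Cp0 Kp0
    (fun b => hp n b nM)).
have [C1 [H1 [K1 [C10 H10 K10 W_force]]]] :=
  weighted_force_le hs hs0 sg0 m0r0 mr0 C'0 D'1 hprod B0 H0 K0 C00 D00 hup hf.
have W_step := weighted_step m0E mE m0r0 mr0 h_ii hu.
pose S (p : nat * midx N) n b := \sum_(l < n.+1)
  cmod (a p.1 p.2 l) * (m0r n / m0r (n - l)%N) * W (n - l + p.1)%N (midx_add b p.2).
have D'0 : 0 < D' := lt_le_trans ltr01 D'1.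
have [C [H2 [K2 [Cgt H2gt K2gt hW]]]] :
    exists C H K : R, [/\ 0 < C, 0 < H, 0 < K &
      forall n b, W n b <= C * H ^+ n * K ^+ mdeg b * growth s A n b].
  apply: (@growth_induction R M N s A hs A0 (fset_set Lambda) S W (weighted m0r mr f)
     (Cp * m0r 0 * C') (Kp * D') C1 H1 K1) => //; rewrite ?mulr_gt0 //.
  move=> [j alpha]; rewrite in_fset_set // inE => pL.
  have [nz|z] := pselect (nonzero_series (a j alpha)); last first.
    exists 1, 1; split=> // K' C'' H' K1' C0' H1' n b _.
    have -> : S (j, alpha) n b = 0.
      rewrite /S big1 // => l _ /=; rewrite (_ : a j alpha l = 0) ?cmod0 ?mul0r //.
      by apply/eqP/negPn/negP => al; apply: z; exists l.
    have g0 : 0 < growth s A (n + M) b by exact: growth_gt0.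
    have H'0 : 0 <= H' := le_trans ler01 H1'.
    have K'0 : 0 <= K' := le_trans ler01 K1'.
    by rewrite !mulr_ge0 ?exprn_ge0 ?invr_ge0 ?(ltW g0).
  have [Ba [Ta [Ba0 Ta0 hal]]] := gevrey_powR sg0 (h_iii j alpha pL).
  have := h_iv j alpha pL nz; rewrite ge_max => /andP[_ hord].
  have jo : (j < M + ord_t (a j alpha))%N by exact: order_gap.
  have qE : (q_exp M a j alpha)%:~R = (ord_t (a j alpha))%:R - j%:R + M%:R :> R.
    by rewrite /q_exp rmorphD rmorphB.
  have hslope : s0 * (j%:R - M%:R) + sdot s alpha <=
      sigma * ((ord_t (a j alpha))%:R - j%:R + M%:R).
    have := slope_le_inv_k1 M s0 s h_ii pL nz.
    rewrite /slope qE ler_pdivrMr //.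
    have jR : j%:R < M%:R + (ord_t (a j alpha))%:R :> R by rewrite -natrD ltr_nat.
    by clear -jR; lra.
  have [E [H' [E0 H'1 hT]]] := @term_bound R M N s s0 sigma hs hs0 sg0 m0r Am m0r0 Am1
    hratio j alpha (ord_t (a j alpha)) (fun l => cmod (a j alpha l))
    (fun l => cmod_ge0 _) (fun l hl => etrans (congr1 _ (ord_t_lt hl)) (cmod0 R))
    Ba Ta (ltW Ba0) (ltW Ta0) hal jo hslope.
  exists E, H'; split=> // K' C'' H'' K1' C0' H1' n b hn.
  exact: hT.
have [Cg [Hg [Kg [Cg0 Hg0 Kg0 hg]]]] := growth_le hs hs0 sg0 mr0 c'0 d'1 hsdot.
pose Ku := K2 * Kg.
have Ku0 : 0 < Ku by exact: mulr_gt0.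
pose Hu := H2 * Hg / d0.
have Hu0 : 0 < Hu by rewrite divr_gt0 // mulr_gt0.
pose Cu := C * Cg / c0.
have Cu0 : 0 < Cu by rewrite divr_gt0 // mulr_gt0.
have u_le n b : cmod (u n b) <= Cu * Hu ^+ n * (n`!)%:R `^ sigma * Ku ^+ mdeg b.
  have P0 := moment_prod_gt0 mr0 b.
  set P := moment_prod mr b in P0.
  have w0 : 0 < m0r n * P by rewrite mulr_gt0.
  rewrite -(ler_pM2r w0).
  apply: (le_trans (hW n b)).
  apply: (@le_trans _ _ (C * H2 ^+ n * K2 ^+ mdeg b *
     (Cg * Hg ^+ n * Kg ^+ mdeg b * (n`!)%:R `^ sigma * (n%:R `^ (s0 * n%:R) * P)))).
    by rewrite ler_wpM2l ?hg // !mulr_ge0 ?exprn_ge0 // ltW.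
  have dn0 : 0 < d0 ^+ n by rewrite exprn_gt0.
  have hm0n : n%:R `^ (s0 * n%:R) <= c0^-1 * (d0 ^+ n)^-1 * m0r n.
    by rewrite -invfM ler_pdivlMl ?mulr_gt0.
  rewrite [leLHS](_ : _ = (C * H2 ^+ n * K2 ^+ mdeg b *
     (Cg * Hg ^+ n * Kg ^+ mdeg b * (n`!)%:R `^ sigma) * P) * n%:R `^ (s0 * n%:R));
     last by ring.
  rewrite [leRHS](_ : _ = (C * H2 ^+ n * K2 ^+ mdeg b *
     (Cg * Hg ^+ n * Kg ^+ mdeg b * (n`!)%:R `^ sigma) * P) *
     (c0^-1 * (d0 ^+ n)^-1 * m0r n)); last first.
    rewrite /Cu /Hu /Ku !exprMn exprVn; ring.
  rewrite ler_wpM2l // !mulr_ge0 ?exprn_ge0 ?powR_ge0 // ltW //.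
exists (4 * Ku)^-1; split; first by rewrite invr_gt0 mulr_gt0.
move=> r /andP[r0 hr].
exists (Cu * 2 ^+ N), Hu; split=> //; first by rewrite mulr_gt0 ?exprn_gt0.
move=> n.
have Bn0 : 0 <= Cu * Hu ^+ n * (n`!)%:R `^ sigma.
  apply: mulr_ge0; last exact: powR_ge0.
  by apply: mulr_ge0; [exact: ltW|exact/exprn_ge0/ltW].
have Kr : Ku * r <= 4^-1.
  by rewrite -ler_pdivlMl // -invfM [Ku * 4]mulrC ltW.
have [U [hU hsup]] := geometric_zseries_sum Bn0 (ltW Ku0) (ltW r0) Kr (u_le n).
exists U; split=> //; apply: (le_trans hsup).
rewrite lee_fin le_eqVlt; apply/orP; left; apply/eqP; ring.
Qed.
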